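(* Let $T=V_1V_2V_3V_4$ be a tetrahedron all of whose dihedral angles are of the form $\theta_{ij}=2\pi/n_{ij}$ with $n_{ij}\in\mathbb{N}$. Then $T$ tiles $\mathbb{R}^3$ face-to-face if and only if, up to permutation of the vertices, the sextuple $(n_{12},n_{13},n_{14},n_{23},n_{24},n_{34})$ is one of the following five: $(3,6,6,8,8,4)$, $(4,4,4,6,6,8)$, $(4,4,8,8,4,6)$, $(4,5,6,10,5,4)$, $(4,6,6,6,6,4)$.
   Context: A tetrahedron means a nondegenerate tetrahedron in $\mathbb{R}^3$; $\theta_{ij}$ denotes the dihedral angle at the edge $e_{ij}$ joining $V_i$ and $V_j$. A tetrahedron $T$ tiles $\mathbb{R}^3$ face-to-face if $\mathbb{R}^3$ is the union of congruent copies of $T$ (images of $T$ under isometries of $\mathbb{R}^3$, orientation-reversing isometries being allowed) with pairwise disjoint interiors such that any two copies intersect in the empty set, a common vertex, a common edge, or a common face. ''Up to permutation of the vertices'' means after relabeling $V_1,\dots,V_4$ by an arbitrary permutation of the indices (so mirror images are identified). *)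

(* Defs.v *)
From mathcomp Require Import all_boot all_order all_algebra all_fingroup.
From mathcomp Require Import all_classical all_reals all_analysis.

Set Implicit Arguments.
Unset Strict Implicit.
Unset Printing Implicit Defensive.

Import Order.TTheory GRing.Theory Num.Theory.
Import numFieldNormedType.Exports.

Local Open Scope classical_set_scope.
Local Open Scope ring_scope.

(* The library norm on ['rV[R]_3] is the sup norm, so the Euclidean structure
   is defined here; the topology (used for interiors) is the same. *)
Definition dotp (R : realType) (u v : 'rV[R]_3) : R := \sum_i u 0 i * v 0 i.

Definition enorm (R : realType) (u : 'rV[R]_3) : R := Num.sqrt (dotp u u).

Definition euclidean_isometry (R : realType) (f : 'rV[R]_3 -> 'rV[R]_3) : Prop :=
  forall x y, enorm (f x - f y) = enorm (x - y).

Definition angle (R : realType) (u v : 'rV[R]_3) : R :=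
  acos (dotp u v / (enorm u * enorm v)).

Definition orth_part (R : realType) (e u : 'rV[R]_3) : 'rV[R]_3 :=
  u - (dotp u e / dotp e e) *: e.

(* Angle along the line PQ between the half-planes bounded by PQ that contain
   A and B respectively. *)
Definition dihedral_angle (R : realType) (P Q A B : 'rV[R]_3) : R :=
  angle (orth_part (Q - P) (A - P)) (orth_part (Q - P) (B - P)).

Definition nondegenerate_tetrahedron (R : realType) (V : 'I_4 -> 'rV[R]_3) : Prop :=
  row_free (\matrix_(i < 3) (V (lift ord0 i) - V ord0)).

(* Convex hull of the V_i with i in A: a vertex, an edge or a face of the
   tetrahedron when #|A| = 1, 2 or 3, and empty when A is. *)
Definition face (R : realType) (V : 'I_4 -> 'rV[R]_3) (A : {set 'I_4}) :
    set 'rV[R]_3 :=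
  [set x | exists w : 'I_4 -> R,
     [/\ forall i, i \in A -> 0 <= w i,
         \sum_(i in A) w i = 1
       & x = \sum_(i in A) w i *: V i]].

Definition tetrahedron (R : realType) (V : 'I_4 -> 'rV[R]_3) : set 'rV[R]_3 :=
  face V [set: 'I_4].

(* The copies are f(T) for f in F. Distinct elements of F must give copies with
   disjoint interiors, so a symmetric T is not counted twice at one place. *)
Definition tiles_face_to_face (R : realType) (V : 'I_4 -> 'rV[R]_3) : Prop :=
  let T := tetrahedron V in
  exists F : set ('rV[R]_3 -> 'rV[R]_3),
    [/\ forall f, F f -> euclidean_isometry f,
        \bigcup_(f in F) (f @` T) = setT,
        forall f g, F f -> F g -> f <> g ->
          interior (f @` T) `&` interior (g @` T) = set0
      & forall f g, F f -> F g -> f <> g ->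
          exists A B : {set 'I_4},
            [/\ (#|A| <= 3)%N, (#|B| <= 3)%N,
                f @` T `&` g @` T = f @` face V A
              & f @` T `&` g @` T = g @` face V B]].

Definition i1 : 'I_4 := @Ordinal 4 0 isT.
Definition i2 : 'I_4 := @Ordinal 4 1 isT.
Definition i3 : 'I_4 := @Ordinal 4 2 isT.
Definition i4 : 'I_4 := @Ordinal 4 3 isT.

Definition sextuple (n : 'I_4 -> 'I_4 -> nat) : seq nat :=
  [:: n i1 i2; n i1 i3; n i1 i4; n i2 i3; n i2 i4; n i3 i4].

(* Main.v *)
From Stdlib Require Import ZArith.
Require Import Defs.
From HB Require Import structures.
From mathcomp Require Import all_boot all_order all_algebra all_fingroup.
From mathcomp Require Import all_classical all_reals all_analysis.
From mathcomp Require Import ring lra zify ssrZ.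
Set Implicit Arguments.
Unset Strict Implicit.
Unset Printing Implicit Defensive.
Import Order.TTheory GRing.Theory Num.Theory.
Import numFieldNormedType.Exports.
Local Open Scope classical_set_scope.
Local Open Scope ring_scope.

(* Necessity.  Scale the outer unit normals of the faces by the face areas; since they sum to
   zero, the areas form a positive null vector of the matrix whose off-diagonal entries are the
   negatives of the cosines of the dihedral angles.  At each vertex the three angles are those of
   a spherical triangle.  A tiny angle [2 pi / n], n >= 50, forces the two other angles at each
   end of its edge to add up to [pi], and then two of the area equations contradict each other.
   For 3 <= n <= 49 a branch and bound search, pruned by the vertex conditions and by Farkas
   vectors for the area equations, leaves eleven sextuples up to relabelling.  Six of them do not
   tile: they have an edge length L such that all edges of length L have the angle [2 pi / p]
   with the same odd p and separate a small face from a large one.  Walking around such an edge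
   of a tiling, the small and the large faces alternate, which is impossible as p is odd.

   Sufficiency.  The angles determine the ratios of the edge lengths.  In each of the five cases
   the edges fit a simplex obtained by subdividing a lattice of cubes or parallelepipeds, and the
   subdivisions are regular: their cells are the domains of linearity of a convex function. *)

(** * Euclidean geometry *)

(** Face areas are the convenient unknowns: given the angles they solve linear equations, and the
    squared length of the edge [ij] is proportional to [a_k ^ 2 * a_l ^ 2 * sin(theta_ij) ^ 2]. So
    they yield both the edge classes of the odd-walk obstruction and the shapes that are recognised
    as tiles. A tiling is an arbitrary set of isometries; its local finiteness has to be deduced,
    from balls inscribed in the tiles. Copies may be mirror images and adjacent copies may carry
    different labels on their common face, so the walk around an edge records only lengths, areas
    and the side of a plane. Support functions give disjoint interiors and the face-to-face property
    at once, without comparing pairs of neighbouring tiles. Kuhn simplices of rhombohedra form a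
    one-parameter family that covers three of the five types. The fourth is an alcove of a
    reflection group. The fifth, half of a pyramid over a face of a cube, is not a cell of a
    hyperplane arrangement and needs its own convex function. *)

Section EuclideanSpace.
Variable R : realType.
Implicit Types (u v w x y : 'rV[R]_3).

Definition c0 u : R := u 0 ord0.
Definition c1 u : R := u 0 (lift ord0 ord0).
Definition c2 u : R := u 0 (lift ord0 (lift ord0 ord0)).

Lemma ord3P (P : 'I_3 -> Prop) :
  P ord0 -> P (lift ord0 ord0) -> P (lift ord0 (lift ord0 ord0)) -> forall i, P i.
Proof.
move=> P0 P1 P2 [[|[|[|i]]] lti] //.
- by rewrite (_ : Ordinal _ = ord0) //; apply: val_inj.
- by rewrite (_ : Ordinal _ = lift ord0 ord0) //; apply: val_inj.
- by rewrite (_ : Ordinal _ = lift ord0 (lift ord0 ord0)) //; apply: val_inj.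
Qed.

Lemma sum3E (V : nmodType) (F : 'I_3 -> V) :
  \sum_i F i = F ord0 + F (lift ord0 ord0) + F (lift ord0 (lift ord0 ord0)).
Proof. by rewrite !big_ord_recl big_ord0 addr0 addrA. Qed.

Lemma row3P u v : c0 u = c0 v -> c1 u = c1 v -> c2 u = c2 v -> u = v.
Proof. by move=> h0 h1 h2; apply/rowP; apply: ord3P. Qed.

Lemma c0D u v : c0 (u + v) = c0 u + c0 v. Proof. by rewrite /c0 mxE. Qed.
Lemma c1D u v : c1 (u + v) = c1 u + c1 v. Proof. by rewrite /c1 mxE. Qed.
Lemma c2D u v : c2 (u + v) = c2 u + c2 v. Proof. by rewrite /c2 mxE. Qed.
Lemma c0N u : c0 (- u) = - c0 u. Proof. by rewrite /c0 mxE. Qed.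
Lemma c1N u : c1 (- u) = - c1 u. Proof. by rewrite /c1 mxE. Qed.
Lemma c2N u : c2 (- u) = - c2 u. Proof. by rewrite /c2 mxE. Qed.
Lemma c0Z a u : c0 (a *: u) = a * c0 u. Proof. by rewrite /c0 mxE. Qed.
Lemma c1Z a u : c1 (a *: u) = a * c1 u. Proof. by rewrite /c1 mxE. Qed.
Lemma c2Z a u : c2 (a *: u) = a * c2 u. Proof. by rewrite /c2 mxE. Qed.
Lemma c00 : c0 0 = 0. Proof. by rewrite /c0 mxE. Qed.
Lemma c10 : c1 0 = 0. Proof. by rewrite /c1 mxE. Qed.
Lemma c20 : c2 0 = 0. Proof. by rewrite /c2 mxE. Qed.

Lemma dotpE u v : dotp u v = c0 u * c0 v + c1 u * c1 v + c2 u * c2 v.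
Proof. by rewrite /dotp sum3E. Qed.

Definition vec3 (a b c : R) : 'rV[R]_3 := \row_i [:: a; b; c]`_i.
Lemma c0v a b c : c0 (vec3 a b c) = a. Proof. by rewrite /c0 mxE. Qed.
Lemma c1v a b c : c1 (vec3 a b c) = b. Proof. by rewrite /c1 mxE. Qed.
Lemma c2v a b c : c2 (vec3 a b c) = c. Proof. by rewrite /c2 mxE. Qed.

Definition cross u v : 'rV[R]_3 :=
  vec3 (c1 u * c2 v - c2 u * c1 v) (c2 u * c0 v - c0 u * c2 v)
       (c0 u * c1 v - c1 u * c0 v).

Definition coordE := (c0D, c1D, c2D, c0N, c1N, c2N, c0Z, c1Z, c2Z, c0v, c1v, c2v,
  c00, c10, c20).

Lemma dotpC u v : dotp u v = dotp v u. Proof. by rewrite !dotpE; ring. Qed.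
Lemma dotpDl u v w : dotp (u + v) w = dotp u w + dotp v w.
Proof. by rewrite !dotpE !coordE; ring. Qed.
Lemma dotpDr u v w : dotp w (u + v) = dotp w u + dotp w v.
Proof. by rewrite !dotpE !coordE; ring. Qed.
Lemma dotpNl u w : dotp (- u) w = - dotp u w.
Proof. by rewrite !dotpE !coordE; ring. Qed.
Lemma dotpNr u w : dotp w (- u) = - dotp w u.
Proof. by rewrite !dotpE !coordE; ring. Qed.
Lemma dotpZl a u w : dotp (a *: u) w = a * dotp u w.
Proof. by rewrite !dotpE !coordE; ring. Qed.
Lemma dotpZr a u w : dotp w (a *: u) = a * dotp w u.
Proof. by rewrite !dotpE !coordE; ring. Qed.
Lemma dotp0l w : dotp 0 w = 0. Proof. by rewrite !dotpE !coordE; ring. Qed.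
Lemma dotp0r w : dotp w 0 = 0. Proof. by rewrite !dotpE !coordE; ring. Qed.

Definition dotpL := (dotpDl, dotpDr, dotpNl, dotpNr, dotpZl, dotpZr, dotp0l, dotp0r).

Lemma dotp_suml (I : finType) (P : pred I) (F : I -> 'rV[R]_3) w :
  dotp (\sum_(i | P i) F i) w = \sum_(i | P i) dotp (F i) w.
Proof. by elim/big_rec2: _ => [|i a b _ <-]; rewrite ?dotp0l ?dotpDl. Qed.
Lemma dotp_sumr (I : finType) (P : pred I) (F : I -> 'rV[R]_3) w :
  dotp w (\sum_(i | P i) F i) = \sum_(i | P i) dotp w (F i).
Proof. by elim/big_rec2: _ => [|i a b _ <-]; rewrite ?dotp0r ?dotpDr. Qed.

Lemma dotp_ge0 u : 0 <= dotp u u.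
Proof. by rewrite dotpE -!expr2 !addr_ge0 ?sqr_ge0. Qed.

Lemma dotp_eq0 u : (dotp u u == 0) = (u == 0).
Proof.
apply/eqP/eqP => [|->]; last exact: dotp0l.
rewrite dotpE -!expr2 => /eqP.
rewrite paddr_eq0 ?addr_ge0 ?sqr_ge0 // paddr_eq0 ?sqr_ge0 // !sqrf_eq0.
by case/andP=> /andP[/eqP h0 /eqP h1] /eqP h2; apply: row3P; rewrite !coordE.
Qed.

Lemma dotp_gt0 u : (0 < dotp u u) = (u != 0).
Proof. by rewrite lt_def dotp_ge0 andbT dotp_eq0. Qed.

Lemma enorm_ge0 u : 0 <= enorm u. Proof. exact: sqrtr_ge0. Qed.
Lemma enorm_sqr u : enorm u ^+ 2 = dotp u u.
Proof. by rewrite sqr_sqrtr ?dotp_ge0. Qed.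
Lemma enorm_gt0 u : (0 < enorm u) = (u != 0).
Proof. by rewrite sqrtr_gt0 dotp_gt0. Qed.
Lemma eq_enorm u v : enorm u = enorm v <-> dotp u u = dotp v v.
Proof. by split=> [h|h]; [rewrite -!enorm_sqr h | rewrite /enorm h]. Qed.

Lemma dotp_cross u v w x :
  dotp (cross u v) (cross w x) = dotp u w * dotp v x - dotp u x * dotp v w.
Proof. by rewrite !dotpE !coordE; ring. Qed.

Lemma dotp_CS u v : dotp u v ^+ 2 <= dotp u u * dotp v v.
Proof.
have := dotp_ge0 (cross u v); rewrite dotp_cross (dotpC v u) subr_ge0.
by rewrite expr2.
Qed.

Lemma cos_angle u v : dotp u v = cos (angle u v) * (enorm u * enorm v).
Proof.
have [->|u0] := eqVneq u 0.
  by rewrite dotp0l /enorm dotp0l sqrtr0 mul0r mulr0.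
have [->|v0] := eqVneq v 0.
  by rewrite dotp0r /enorm dotp0l sqrtr0 !mulr0.
have uv : 0 < enorm u * enorm v by rewrite mulr_gt0 ?enorm_gt0.
rewrite acosK ?divfK ?gt_eqF //.
have: (dotp u v / (enorm u * enorm v)) ^+ 2 <= 1.
  by rewrite expr_div_n exprMn !enorm_sqr ler_pdivrMr ?mulr_gt0 ?dotp_gt0 // mul1r dotp_CS.
by rewrite itv_boundlr/= /Order.le/= -ler_norml -(@expr_le1 _ 2) // real_normK ?num_real.
Qed.

Lemma dotp_orth_part e u v : e != 0 ->
  dotp (orth_part e u) (orth_part e v) = dotp u v - dotp u e * dotp v e / dotp e e.
Proof.
rewrite -dotp_eq0 => e0.
by rewrite /orth_part !dotpL (dotpC e v); field.
Qed.

(** The map [cross e] kills the component along [e] and is a quarter turn, scaled by the length of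
    [e], on the plane orthogonal to [e]. This turns dihedral angles into angles between face
    normals. *)
Lemma dotp_orth_cross e u v : e != 0 ->
  dotp (orth_part e u) (orth_part e v) = dotp (cross e u) (cross e v) / dotp e e.
Proof.
move=> e0; rewrite dotp_orth_part // dotp_cross (dotpC e v).
by move: e0; rewrite -dotp_eq0 => e0; field.
Qed.

Lemma enorm_orth_part e u : e != 0 ->
  enorm (orth_part e u) = enorm (cross e u) / enorm e.
Proof.
move=> e0; rewrite /enorm dotp_orth_cross // sqrtrM ?dotp_ge0 //.
by rewrite sqrtrV ?dotp_ge0.
Qed.

Lemma cos_dihedral P Q A B : Q - P != 0 ->
  dotp (cross (Q - P) (A - P)) (cross (Q - P) (B - P)) =
  cos (dihedral_angle P Q A B) *
    (enorm (cross (Q - P) (A - P)) * enorm (cross (Q - P) (B - P))).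
Proof.
move=> e0; have := cos_angle (orth_part (Q - P) (A - P)) (orth_part (Q - P) (B - P)).
rewrite -/(dihedral_angle P Q A B) dotp_orth_cross // !enorm_orth_part //.
move: e0; rewrite -enorm_gt0 -enorm_sqr => e0 h.
have e1 : enorm (Q - P) != 0 by rewrite gt_eqF.
apply: (@mulIf _ (enorm (Q - P) ^- 2)); first by rewrite invr_neq0 // expf_neq0.
by rewrite h; field.
Qed.

Definition triple u v w := dotp (cross u v) w.

Lemma det_mx33 (M : 'M[R]_3) :
  \det M = triple (row ord0 M) (row (lift ord0 ord0) M) (row (lift ord0 (lift ord0 ord0)) M).
Proof.
rewrite /triple dotpE !coordE /c0 /c1 /c2 !mxE.
rewrite (expand_det_row _ ord0) sum3E /cofactor !(expand_det_row _ ord0).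
rewrite !big_ord_recl !big_ord0 /cofactor !det_mx11 !mxE /=.
pose m a b := M (inord a) (inord b).
have E i j : M i j = m i j by rewrite /m !inord_val.
by rewrite !E /= /bump /=; ring.
Qed.

Definition affine_fun (h : 'rV[R]_3 -> R) := exists c d, forall x, h x = dotp c x + d.

Lemma affine_fun_sum h (I : finType) (P : pred I) (w : I -> R) (v : I -> 'rV[R]_3) :
  affine_fun h -> \sum_(i | P i) w i = 1 ->
  h (\sum_(i | P i) w i *: v i) = \sum_(i | P i) w i * h (v i).
Proof.
move=> [c [d hE]] w1; rewrite hE dotp_sumr -[d]mul1r -w1 mulr_suml -big_split /=.
by apply: eq_bigr => i _; rewrite dotpZr hE mulrDr.
Qed.

Lemma affine_fun_line h x y t : affine_fun h ->
  h (x + t *: (y - x)) = h x + t * (h y - h x).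
Proof. by move=> [c [d hE]]; rewrite !hE !dotpL; ring. Qed.

Lemma affine_funD h k : affine_fun h -> affine_fun k -> affine_fun (fun x => h x + k x).
Proof.
move=> [c [d hE]] [c' [d' kE]]; exists (c + c'), (d + d') => x.
by rewrite hE kE !dotpL; ring.
Qed.
Lemma affine_funZ a h : affine_fun h -> affine_fun (fun x => a * h x).
Proof. by move=> [c [d hE]]; exists (a *: c), (a * d) => x; rewrite hE !dotpL; ring. Qed.
Lemma affine_fun_cst a : affine_fun (fun=> a).
Proof. by exists 0, a => x; rewrite dotp0l add0r. Qed.
Lemma affine_funB h k : affine_fun h -> affine_fun k -> affine_fun (fun x => h x - k x).
Proof.
move=> ah ak; have := affine_funD ah (affine_funZ (-1) ak).
by move=> [c [d E]]; exists c, d => x; rewrite -E mulN1r.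
Qed.
Lemma affine_fun_bigsum (I : Type) (r : seq I) (P : pred I) (h : I -> 'rV[R]_3 -> R) :
  (forall i, affine_fun (h i)) -> affine_fun (fun x => \sum_(i <- r | P i) h i x).
Proof.
move=> ah; elim: r => [|i r IH].
  by have [c [d E]] := affine_fun_cst 0; exists c, d => x; rewrite big_nil -E.
case: (boolP (P i)) => Pi.
  by have [c [d E]] := affine_funD (ah i) IH; exists c, d => x; rewrite big_cons Pi -E.
by have [c [d E]] := IH; exists c, d => x; rewrite big_cons (negbTE Pi) -E.
Qed.

Section Barycentric.
Variable V : 'I_4 -> 'rV[R]_3.

Definition edge_mx : 'M[R]_3 := \matrix_(i < 3) (V (lift ord0 i) - V ord0).

(** The total function [invmx] makes this affine with sum 1 even before [V] is known to be
    nondegenerate. *)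
Definition bary (i : 'I_4) x : R :=
  let y := (x - V ord0) *m invmx edge_mx in
  if unlift ord0 i is Some j then y 0 j else 1 - \sum_j y 0 j.

Lemma bary_sum x : \sum_i bary i x = 1.
Proof.
rewrite big_ord_recl /bary unlift_none.
by under [X in _ + X]eq_bigr do rewrite liftK; rewrite subrK.
Qed.

Lemma sum_bary_affine (w : 'I_4 -> R) : \sum_i w i = 1 ->
  \sum_i w i *: V i = V ord0 + (\row_j w (lift ord0 j)) *m edge_mx.
Proof.
rewrite big_ord_recl => w1; rewrite big_ord_recl.
have -> : w ord0 = 1 - \sum_(i < 3) w (lift ord0 i) by rewrite -w1 addrK.
rewrite mulmx_sum_row scalerBl scale1r -addrA; congr (_ + _).
under [RHS]eq_bigr do rewrite mxE rowK scalerBr.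
by rewrite sumrB -scaler_suml addrC.
Qed.

Lemma bary_affine i : affine_fun (bary i).
Proof.
have H j : affine_fun (fun x => ((x - V ord0) *m invmx edge_mx) 0 j).
  exists (col j (invmx edge_mx))^T, (- (V ord0 *m invmx edge_mx) 0 j) => x.
  rewrite mulmxBl !mxE; congr (_ + _).
  by rewrite /dotp; apply: eq_bigr => k _; rewrite !mxE mulrC.
rewrite /bary; case: (unlift ord0 i) => [j|]; first exact: H.
apply: affine_funB; first exact: affine_fun_cst.
exact: affine_fun_bigsum.
Qed.

Hypothesis Vn : nondegenerate_tetrahedron V.

Lemma edge_mx_unit : edge_mx \in unitmx.
Proof. by rewrite -row_free_unit. Qed.

Lemma baryE x : \sum_i bary i x *: V i = x.
Proof.
rewrite sum_bary_affine ?bary_sum //.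
have -> : \row_j bary (lift ord0 j) x = (x - V ord0) *m invmx edge_mx.
  by apply/rowP => j; rewrite mxE /bary liftK.
by rewrite mulmxKV ?edge_mx_unit // addrC subrK.
Qed.

Lemma bary_unique (w : 'I_4 -> R) i : \sum_i w i = 1 -> bary i (\sum_j w j *: V j) = w i.
Proof.
move=> w1; rewrite sum_bary_affine // /bary addrC addKr mulmxK ?edge_mx_unit //.
case: unliftP => [j ->|->]; first by rewrite mxE.
under eq_bigr do rewrite mxE.
by rewrite -w1 big_ord_recl addrK.
Qed.

Lemma bary_vertex i j : bary i (V j) = (i == j)%:R.
Proof.
rewrite -[V j](_ : \sum_k (k == j)%:R *: V k = _).
  by rewrite bary_unique // (bigD1 j) //= eqxx big1 ?addr0 // => k /negbTE ->.
rewrite (bigD1 j) //= eqxx scale1r big1 ?addr0 // => k /negbTE ->.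
by rewrite scale0r.
Qed.

Lemma affine_fun_baryE h x : affine_fun h -> h x = \sum_i bary i x * h (V i).
Proof. by move=> ah; rewrite -{1}(baryE x) affine_fun_sum ?bary_sum. Qed.

Lemma faceP (A : {set 'I_4}) x :
  face V A x <-> (forall i, 0 <= bary i x) /\ (forall i, i \notin A -> bary i x = 0).
Proof.
split=> [[w [w0 w1 ->]]|[b0 bA]].
  pose w' i := if i \in A then w i else 0.
  have w'1 : \sum_i w' i = 1 by rewrite -big_mkcond.
  have -> : \sum_(i in A) w i *: V i = \sum_i w' i *: V i.
    rewrite big_mkcond; apply: eq_bigr => i _; rewrite /w'.
    by case: ifP; rewrite ?scale0r.
  split=> i => [|iA]; rewrite bary_unique // /w'; last by rewrite (negbTE iA).
  by case: ifP => // /w0.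
exists (bary^~ x); split=> //.
  rewrite -[RHS](bary_sum x) [LHS]big_mkcond; apply: eq_bigr => i _.
  by case: ifPn => // /bA.
rewrite -[LHS]baryE [RHS]big_mkcond; apply: eq_bigr => i _.
by case: ifPn => // /bA ->; rewrite scale0r.
Qed.

Lemma tetrahedronP x : tetrahedron V x <-> forall i, 0 <= bary i x.
Proof.
by rewrite /tetrahedron faceP; split=> [[]//|h]; split=> // i; rewrite inE.
Qed.

End Barycentric.
End EuclideanSpace.

(** * Isometries as affine maps with orthogonal linear part *)

Section Isometries.
Variable R : realType.
Implicit Types (u v w x y z : 'rV[R]_3) (f g : 'rV[R]_3 -> 'rV[R]_3).

Lemma isometry_dotp f x y z : euclidean_isometry f ->
  dotp (f x - f z) (f y - f z) = dotp (x - z) (y - z).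
Proof.
move=> fi.
have pol a b : dotp a b = (dotp a a + dotp b b - dotp (a - b) (a - b)) / 2.
  by rewrite !dotpL (dotpC b a); field.
have nE a b : dotp (f a - f b) (f a - f b) = dotp (a - b) (a - b).
  by apply/eq_enorm.
by rewrite pol [RHS]pol !opprB !addrA !subrK !nE.
Qed.

(** The squared norm of the difference between [g x] and the combination of the images of the basis
    vectors involves only products that [g] preserves, and so it vanishes. *)
Lemma dotp_linear g : (forall x y, dotp (g x) (g y) = dotp x y) ->
  exists2 A : 'M[R]_3, A *m A^T = 1%:M & forall x, g x = x *m A.
Proof.
move=> gd; pose d (i : 'I_3) : 'rV[R]_3 := delta_mx 0 i.
exists (\matrix_i g (d i)).
  apply/matrixP => i j; rewrite !mxE.
  under eq_bigr do rewrite !mxE.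
  rewrite -/(dotp (g (d i)) (g (d j))) gd /dotp (bigD1 i) //= big1 => [|k ki].
    by rewrite !mxE !eqxx /= mul1r addr0.
  by rewrite !mxE (negbTE ki) mul0r.
move=> x; apply/eqP; rewrite -subr_eq0 -dotp_eq0 mulmx_sum_row sum3E !rowK !dotpL !gd.
by rewrite !dotpE /c0 /c1 /c2 !mxE /=; apply/eqP; ring.
Qed.

Lemma isometry_mx f : euclidean_isometry f ->
  exists2 A : 'M[R]_3, A *m A^T = 1%:M & forall x, f x = x *m A + f 0.
Proof.
move=> fi; have [x y|A AA fA] := @dotp_linear (fun x => f x - f 0).
  by rewrite isometry_dotp // !subr0.
by exists A => // x; rewrite -fA subrK.
Qed.

Lemma isometry_sum f (I : finType) (P : pred I) (a : I -> R) (v : I -> 'rV[R]_3) :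
  euclidean_isometry f -> \sum_(i | P i) a i = 1 ->
  f (\sum_(i | P i) a i *: v i) = \sum_(i | P i) a i *: f (v i).
Proof.
move=> /isometry_mx[A _ fA] a1; rewrite fA mulmx_suml.
under [RHS]eq_bigr do rewrite fA scalerDr.
rewrite big_split /= -scaler_suml a1 scale1r; congr (_ + _).
by apply: eq_bigr => i _; rewrite scalemxAl.
Qed.

Lemma isometry_surj f y : euclidean_isometry f -> exists x, f x = y.
Proof.
move=> /isometry_mx[A /mulmx1C AA fA]; exists ((y - f 0) *m A^T).
by rewrite fA -mulmxA AA mulmx1 subrK.
Qed.

Lemma isometry_face f (V : 'I_4 -> 'rV[R]_3) A : euclidean_isometry f ->
  f @` face V A = face (f \o V) A.
Proof.
move=> fi; apply/seteqP; split=> [_ [x [a [a0 a1 ->]] <-]|_ [a [a0 a1 ->]]].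
  by exists a; split=> //; rewrite isometry_sum.
by exists (\sum_(i in A) a i *: V i); [exists a | rewrite isometry_sum].
Qed.

Lemma isometry_tetrahedron f (V : 'I_4 -> 'rV[R]_3) : euclidean_isometry f ->
  f @` tetrahedron V = tetrahedron (f \o V).
Proof. exact: isometry_face. Qed.

Lemma isometry_nondegenerate f (V : 'I_4 -> 'rV[R]_3) : euclidean_isometry f ->
  nondegenerate_tetrahedron V -> nondegenerate_tetrahedron (f \o V).
Proof.
move=> /isometry_mx[A AA fA]; rewrite /nondegenerate_tetrahedron !row_free_unit => Vn.
have -> : \matrix_(i < 3) ((f \o V) (lift ord0 i) - (f \o V) ord0) =
          (\matrix_(i < 3) (V (lift ord0 i) - V ord0)) *m A.
  have fB x y : f x - f y = (x - y) *m A.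
    by rewrite fA [f y]fA opprD addrACA subrr addr0 mulmxBl.
  by apply/row_matrixP => i; rewrite row_mul !rowK /= fB.
by rewrite unitmx_mul Vn; case/mulmx1_unit: AA.
Qed.

Lemma isometry_bary f (V : 'I_4 -> 'rV[R]_3) i x : euclidean_isometry f ->
  nondegenerate_tetrahedron V -> bary (f \o V) i (f x) = bary V i x.
Proof.
move=> fi Vn; rewrite -{1}(baryE Vn x) isometry_sum ?bary_sum //.
by rewrite (bary_unique (isometry_nondegenerate fi Vn)) ?bary_sum.
Qed.

End Isometries.

(** * Interiors and closedness of tetrahedra *)

Section Topology.
Variable R : realType.
Implicit Types (x y : 'rV[R]_3) (h : 'rV[R]_3 -> R) (S : set 'rV[R]_3).

Lemma affine_fun_continuous h : affine_fun h -> continuous h.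
Proof.
move=> [c [d hE]].
pose p (k : 'I_3) (y : 'rV[R]_3) : R := c 0 k * y 0 k.
have H k : continuous (p k).
  by move=> x; apply: continuousM; [exact: cst_continuous | exact: coord_continuous].
have -> : h = p ord0 + p (lift ord0 ord0) + p (lift ord0 (lift ord0 ord0)) + cst d.
  by apply/funext => x; rewrite hE dotpE.
move=> x; apply: continuousD; last exact: cst_continuous.
by apply: continuousD; [apply: continuousD|]; exact: H.
Qed.

Lemma bary_gt0_interior (V : 'I_4 -> 'rV[R]_3) x : nondegenerate_tetrahedron V ->
  (forall i, 0 < bary V i x) -> interior (tetrahedron V) x.
Proof.
move=> Vn x0.
have cl i : \forall y \near x, 0 < bary V i y.
  have c := affine_fun_continuous (bary_affine V i).
  by apply: (cvgr_gt _ (c x)); exact: x0.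
have : \forall y \near x, forall i, 0 < bary V i y.
  have [] := (cl i1, cl i2, cl i3, cl i4) => - [[]].
  move=> n1 n2 n3 n4.
  near=> y => i.
  have: i \in [:: i1; i2; i3; i4] by case: i => [[|[|[|[]]]]].
  rewrite !inE => /or4P[]/eqP ->; near: y; done.
apply: filterS => y y0; apply/tetrahedronP => // i; exact: ltW.
Unshelve. all: by end_near. Qed.

Lemma interior_line S x y : interior S x -> exists2 t : R, 0 < t & S (x + t *: (y - x)).
Proof.
move=> Sx.
have c : {for 0, continuous (fun t : R => x + t *: (y - x))}.
  by apply: cvgD; [exact: cvg_cst | apply: cvgZr_tmp; exact: cvg_id].
have : nbhs (0 : R) ((fun t : R => x + t *: (y - x)) @^-1` S).
  by apply: c; rewrite scale0r addr0.
move=> /nbhs_ballP[e /= e0 eS]; exists (e / 2); first by rewrite divr_gt0.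
apply: eS; rewrite /ball /= sub0r normrN gtr0_norm ?divr_gt0 //.
by rewrite gtr_pMr // invf_lt1 // ltr1n.
Qed.

Lemma tetrahedron_closed (V : 'I_4 -> 'rV[R]_3) : nondegenerate_tetrahedron V ->
  closed (tetrahedron V).
Proof.
move=> Vn.
have -> : tetrahedron V = \bigcap_(i in [set: 'I_4]) (bary V i @^-1` [set t | 0 <= t]).
  apply/seteqP; split=> x; first by move=> /(tetrahedronP Vn) h i _; exact: h.
  by move=> h; apply/(tetrahedronP Vn) => i; exact: h.
apply: closed_bigI => i _; apply: closed_comp; last exact: closed_ge.
by move=> y _; exact: affine_fun_continuous (bary_affine V i) y.
Qed.

End Topology.

(** * Tiles around a point and around an edge *)

Section Ord4.

Lemma uniq4_mem (i j k l a : 'I_4) : uniq [:: i; j; k; l] -> a \in [:: i; j; k; l].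
Proof.
move=> u; have /subset_cardP e : #|[:: i; j; k; l]| = #|'I_4| by rewrite (card_uniqP u) card_ord.
have /e -> // : [:: i; j; k; l] \subset 'I_4 by apply/fintype.subsetP.
Qed.

Lemma sum_ord4 (T : nmodType) (F : 'I_4 -> T) (i j k l : 'I_4) : uniq [:: i; j; k; l] ->
  \sum_a F a = F i + F j + F k + F l.
Proof.
move=> u; have p : perm_eq [:: i; j; k; l] (index_enum 'I_4).
  apply: uniq_perm => //; first exact: index_enum_uniq.
  by move=> a; rewrite mem_index_enum uniq4_mem.
by rewrite -(perm_big _ p) /= !big_cons big_nil addr0 !addrA.
Qed.

Lemma uniq4P (i j k l a : 'I_4) : uniq [:: i; j; k; l] ->
  [\/ a = i, a = j, a = k | a = l].
Proof.
move=> u; have := uniq4_mem a u.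
by rewrite !inE => /or4P[]/eqP ->; [constructor 1|constructor 2|constructor 3|constructor 4].
Qed.

Lemma uniq3_ex (i j k : 'I_4) : uniq [:: i; j; k] -> exists l, uniq [:: i; j; k; l].
Proof.
move=> u; have [l] : exists l, l \notin [:: i; j; k].
  apply: contrapT => h.
  have: (#|'I_4| <= #|[:: i; j; k]|)%N.
    apply: subset_leq_card; apply/fintype.subsetP => l _.
    by apply: contrapT => /negP hl; apply: h; exists l.
  by rewrite (card_uniqP u) card_ord.
move=> lN; exists l; have := rcons_uniq [:: i; j; k] l; rewrite lN u; exact.
Qed.

End Ord4.

(** * Local finiteness of a tiling *)

Section Tiling.
Variables (R : realType) (V : 'I_4 -> 'rV[R]_3) (F : set ('rV[R]_3 -> 'rV[R]_3)).
Hypothesis Vn : nondegenerate_tetrahedron V.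
Let T := tetrahedron V.
Hypothesis F_isometry : forall f, F f -> euclidean_isometry f.
Hypothesis F_cover : \bigcup_(f in F) (f @` T) = setT.
Hypothesis F_disjoint : forall f g, F f -> F g -> f <> g ->
          interior (f @` T) `&` interior (g @` T) = set0.

Lemma vertex_inj : injective V.
Proof.
move=> i j eV; have := bary_vertex Vn i j.
by rewrite -eV bary_vertex // eqxx; case: eqVneq => // _ /eqP; rewrite oner_eq0.
Qed.

Lemma isometry_vertex_inj f i j : F f -> f (V i) = f (V j) -> i = j.
Proof.
move=> /F_isometry fi /eqP; rewrite -subr_eq0 -dotp_eq0 isometry_dotp // dotp_eq0.
by rewrite subr_eq0 => /eqP /vertex_inj.
Qed.

Lemma tileE f : F f -> f @` T = tetrahedron (f \o V).
Proof. by move=> /F_isometry; exact: isometry_tetrahedron. Qed.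

Lemma tileP f x : F f -> (f @` T) x <-> forall i, 0 <= bary (f \o V) i x.
Proof.
move=> Ff; rewrite tileE //; apply: tetrahedronP.
exact: (isometry_nondegenerate (F_isometry Ff)).
Qed.

Lemma tile_unique f g x : F f -> F g ->
  (forall i, 0 < bary (f \o V) i x) -> (forall i, 0 < bary (g \o V) i x) -> f = g.
Proof.
move=> Ff Fg fx gx; apply: contrapT => fg.
suff : set0 x by [].
rewrite -(F_disjoint Ff Fg fg) (tileE Ff) (tileE Fg).
by split; apply: bary_gt0_interior => //; apply: isometry_nondegenerate => //; exact: F_isometry.
Qed.

Let c : 'rV[R]_3 := \sum_i (4^-1 : R) *: V i.

Lemma bary_center i : bary V i c = 4^-1.
Proof.
rewrite (bary_unique Vn (w := fun=> 4^-1)) // sumr_const card_ord.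
by rewrite -[LHS]mulr_natl mulfV // pnatr_eq0.
Qed.

Lemma inball : exists2 e : R, 0 < e &
  forall x, dotp (x - c) (x - c) < e -> forall i, 0 < bary V i x.
Proof.
have H i : exists2 e : R, 0 < e & forall x, dotp (x - c) (x - c) < e -> 0 < bary V i x.
  have [u [d bE]] := bary_affine V i.
  have u1 : 0 < 1 + dotp u u by rewrite ltr_pwDl ?dotp_ge0.
  (* At the centre every coordinate is 1/4. By Cauchy-Schwarz this radius keeps the change below
     1/4; the summand 1 makes the divisor positive. *)
  exists (16^-1 / (1 + dotp u u)) => [|x]; first by rewrite divr_gt0 // invr_gt0.
  rewrite ltr_pdivlMr // => xe.
  have -> : bary V i x = 4^-1 + dotp u (x - c).
    by rewrite -(bary_center i) !bE !dotpL; ring.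
  have : dotp u (x - c) ^+ 2 < 16^-1.
    apply: le_lt_trans (dotp_CS _ _) _; apply: le_lt_trans xe.
    by rewrite mulrC ler_wpM2l ?dotp_ge0 // lerDr.
  set z := dotp _ _ => z2; nra.
have [e1 p1 h1] := H i1; have [e2 p2 h2] := H i2.
have [e3 p3 h3] := H i3; have [e4 p4 h4] := H i4.
exists (Num.min (Num.min e1 e2) (Num.min e3 e4)) => [|x]; first by rewrite !lt_min p1 p2 p3 p4.
rewrite !lt_min => /andP[/andP[x1 x2] /andP[x3 x4]] i.
by have [] := @uniq4P i1 i2 i3 i4 i isT => ->; auto.
Qed.

(** If the centre of [g] were in the inscribed ball of [f], it would be interior to both tiles. *)
Lemma centers_apart : exists2 e : R, 0 < e &
  forall f g, F f -> F g -> dotp (f c - g c) (f c - g c) < e -> f = g.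
Proof.
have [e e0 ball] := inball; exists e => // f g Ff Fg fg.
have [fi gi] := (F_isometry Ff, F_isometry Fg).
apply: (@tile_unique f g (g c)) => // i; last by rewrite isometry_bary // bary_center invr_gt0.
have [y yE] := isometry_surj (g c) fi; rewrite -yE isometry_bary //; apply: ball.
by rewrite -(isometry_dotp _ _ _ fi) yE -opprB dotpNl dotpNr opprK.
Qed.

Lemma tile_bounded : exists K : R, forall f y, F f -> (f @` T) y -> dotp (f c - y) (f c - y) <= K.
Proof.
exists (\sum_i dotp (V i - c) (V i - c)) => f _ Ff [x /(tetrahedronP Vn) bx <-].
rewrite (isometry_dotp _ _ _ (F_isometry Ff)) -[c - x]opprB dotpNl dotpNr opprK.
have b1 i : bary V i x <= 1.
  by rewrite -(bary_sum V x) (bigD1 i) //= lerDl sumr_ge0.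
have xE : x - c = \sum_i bary V i x *: (V i - c).
  under eq_bigr do rewrite scalerBr.
  by rewrite sumrB -scaler_suml bary_sum scale1r baryE.
(* Writing one factor of the squared distance as a convex combination, this bounds it by half of
   itself plus half of the sum over the vertices. *)
have AG u v : dotp u v <= (dotp u u + dotp v v) / 2.
  by rewrite ler_pdivlMr //; have := dotp_ge0 (u - v); rewrite !dotpL (dotpC v u); lra.
have : dotp (x - c) (x - c) <=
    \sum_i bary V i x * ((dotp (V i - c) (V i - c) + dotp (x - c) (x - c)) / 2).
  rewrite {1}xE dotp_suml; apply: ler_sum => i _.
  by rewrite dotpZl ler_wpM2l ?AG.
under eq_bigr do rewrite mulrDl mulrDr.
rewrite big_split /=.
have -> : \sum_i bary V i x * (dotp (x - c) (x - c) / 2) = dotp (x - c) (x - c) / 2.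
  by rewrite -mulr_suml bary_sum mul1r.
move=> h.
have : \sum_i bary V i x * (dotp (V i - c) (V i - c) / 2) <=
       (\sum_i dotp (V i - c) (V i - c)) / 2.
  rewrite mulr_suml; apply: ler_sum => i _.
  by rewrite ler_piMl // divr_ge0 ?dotp_ge0.
by move: h; set a := \sum_i _; set b := dotp (x - c) _; set d := \sum_i _; lra.
Qed.

Lemma finite_int_itv (a b : int) : finite_set [set z : int | a <= z <= b].
Proof.
apply: (@sub_finite_set _ _ [set a + n%:Z | n in `I_(`|b - a|.+1)%N]).
  move=> z /= /andP[az zb]; exists `|z - a|%N; last by lia.
  by lia.
exact/finite_image/finite_II.
Qed.

(* The centres of distinct tiles lie in distinct cells of a fine grid. *)
Lemma local_cover (x0 : 'rV[R]_3) : \forall x \near x0, exists g, [/\ F g, (g @` T) x & (g @` T) x0].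
Proof.
have [e e0 far] := centers_apart; have [K bd] := tile_bounded.
(* Two centres in one cell of side [1 / N] have squared distance at most [3 / N ^ 2], which is below
   [e] because [N >= 1] and [N * e > 3]. *)
pose N : R := 3 / e + 1.
have N1 : 1 <= N by rewrite lerDr divr_ge0 // ltW.
have N0 : 0 < N by exact: lt_le_trans N1.
pose phi (f : 'rV[R]_3 -> 'rV[R]_3) : int * int * int :=
  (Num.floor (c0 (f c) * N), Num.floor (c1 (f c) * N), Num.floor (c2 (f c) * N)).
have phi_inj f g : F f -> F g -> phi f = phi g -> f = g.
  move=> Ff Fg [E0 E1 E2]; apply: far => //.
  have cell (a b : R) : Num.floor (a * N) = Num.floor (b * N) -> (a - b) ^+ 2 <= N ^- 2.
    move=> ab; have := floor_itv (a * N); have := floor_itv (b * N).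
    rewrite ab intrD; set m := (_ %:~R); move=> /andP[l1 l2] /andP[l3 l4].
    rewrite -(ler_pM2r (x := N ^+ 2)) ?exprn_gt0 // mulVf ?expf_neq0 ?gt_eqF // -exprMn.
    have : `|(a - b) * N| <= 1 by rewrite ler_norml mulrBl; apply/andP; split; lra.
    by rewrite -(@expr_le1 _ 2) // real_normK ?num_real.
  apply: le_lt_trans (_ : N ^- 2 + N ^- 2 + N ^- 2 < e).
    by rewrite dotpE !coordE -!expr2 !lerD ?cell.
  have : 3 / e < N by rewrite ltrDl.
  rewrite ltr_pdivrMr // => NeL.
  have -> : N ^- 2 + N ^- 2 + N ^- 2 = 3 / N ^+ 2 by ring.
  rewrite ltr_pdivrMr ?exprn_gt0 //; apply: lt_le_trans NeL _.
  rewrite -subr_ge0 (_ : _ - _ = e * N * (N - 1)); last by ring.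
  by rewrite !mulr_ge0 ?subr_ge0 // ltW.
(* A coordinate of the centre of a tile through [x] differs from that of [x] by at most
   [(1 + K) / 2], and [x] is within 1 of [x0]. *)
pose B := K + 3.
pose itv (a : R) := [set z : int | Num.floor ((a - B) * N) <= z <= Num.floor ((a + B) * N)].
pose box := itv (c0 x0) `*` itv (c1 x0) `*` itv (c2 x0).
have boxf : finite_set box by do ?apply: finite_setX; exact: finite_int_itv.
(* A cell holds at most one centre, so [C z] is one tile or empty, hence closed. The finite union of
   these sets misses [x0], and therefore a neighbourhood of [x0]. *)
pose C z := \bigcup_(f in [set f | [/\ F f, phi f = z & ~ (f @` T) x0]]) (f @` T).
have Ccl z : closed (C z).
  have [[f [Ff fz fx]]|no] := pselect (exists f, [/\ F f, phi f = z & ~ (f @` T) x0]).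
    have -> : C z = f @` T.
      apply/seteqP; split=> [y [g [Fg gz _] gy]|y fy]; last by exists f.
      by rewrite (phi_inj f g) // fz gz.
    rewrite tileE //; apply: tetrahedron_closed.
    exact: isometry_nondegenerate (F_isometry Ff) Vn.
  have -> : C z = set0.
    by apply/seteqP; split=> // y [f ff _]; apply: no; exists f.
  exact: closed0.
pose U := \bigcup_(z in box) C z.
have Ucl : closed U by apply: closed_bigcup.
have Ux0 : (~` U) x0 by move=> [z _ [f [_ _ nf] fx]].
have nU : \forall x \near x0, ~ U x by apply: open_nbhs_nbhs; split=> //; rewrite openC.
have nc k : \forall x \near x0, `|x0 0 k - (x : 'rV[R]_3) 0 k| < 1.
  exact: (@cvgr_dist_lt _ _ _ _ _ _ _ (@coord_continuous _ _ _ 0 k x0)).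
near=> x.
have [f Ff fx] : (\bigcup_(f in F) (f @` T)) x by rewrite F_cover.
exists f; split=> //; apply: contrapT => fx0.
have : ~ U x by near: x.
apply; exists (phi f); last by exists f.
have bx := bd f x Ff fx.
have main k : forall a, `|x0 0 k - x 0 k| < 1 -> (a - x 0 k) ^+ 2 <= K ->
    itv (x0 0 k) (Num.floor (a * N)).
  move=> a; rewrite ltr_norml => /andP[h1 h2] aK /=.
  set z := a - x 0 k in aK.
  have z1 : 2 * z <= 1 + z ^+ 2 by rewrite -subr_ge0 (_ : _ - _ = (z - 1) ^+ 2) ?sqr_ge0 //; ring.
  have z2 : - (2 * z) <= 1 + z ^+ 2.
    by rewrite -subr_ge0 (_ : _ - _ = (z + 1) ^+ 2) ?sqr_ge0 //; ring.
  have z3 := sqr_ge0 z; have za : a = x 0 k + z by rewrite addrC subrK.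
  by apply/andP; split; apply: le_floor; rewrite ler_pM2r // za /B; lra.
move: bx; rewrite dotpE !coordE -!expr2.
set u := (_ - _) ^+ 2; set v := (_ - _) ^+ 2; set w := (_ - _) ^+ 2 => bx.
have [u0 [v0 w0]] : 0 <= u /\ 0 <= v /\ 0 <= w by rewrite !sqr_ge0.
split; first split.
- by apply: main; [near: x; exact: nc | rewrite -/u; lra].
- by apply: main; [near: x; exact: nc | rewrite -/v; lra].
- by apply: main; [near: x; exact: nc | rewrite -/w; lra].
Unshelve. all: by end_near. Qed.

End Tiling.

(** * Crossing a face of a tile *)

Section Neighbour.
Variables (R : realType) (V : 'I_4 -> 'rV[R]_3) (F : set ('rV[R]_3 -> 'rV[R]_3)).
Hypothesis Vn : nondegenerate_tetrahedron V.
Let T := tetrahedron V.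
Hypothesis F_isometry : forall f, F f -> euclidean_isometry f.
Hypothesis F_cover : \bigcup_(f in F) (f @` T) = setT.
Hypothesis F_disjoint : forall f g, F f -> F g -> f <> g ->
          interior (f @` T) `&` interior (g @` T) = set0.
Hypothesis F_face : forall f g, F f -> F g -> f <> g ->
          exists A B : {set 'I_4},
            [/\ (#|A| <= 3)%N, (#|B| <= 3)%N,
                f @` T `&` g @` T = f @` face V A
              & f @` T `&` g @` T = g @` face V B].

Lemma copy_nondegenerate f : F f -> nondegenerate_tetrahedron (f \o V).
Proof. by move=> Ff; apply: isometry_nondegenerate => //; exact: F_isometry. Qed.

(** Just beyond the centre of the face opposite [k] there is a point whose tile also contains that
    centre, by [local_cover]. The two tiles meet in a face, which can only be this one. *)
Lemma neighbour f i j k l : F f -> uniq [:: i; j; k; l] ->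
  exists g i' j' k' l',
    [/\ F g, uniq [:: i'; j'; k'; l'],
        [/\ g (V i') = f (V i), g (V j') = f (V j) & g (V l') = f (V l)]
      & bary (f \o V) k (g (V k')) < 0].
Proof.
move=> Ff u; have fn := copy_nondegenerate Ff.
pose w a : R := if a == k then 0 else 3^-1.
pose x0 : 'rV[R]_3 := \sum_a w a *: f (V a).
have w1 : \sum_a w a = 1.
  have := u; rewrite (sum_ord4 _ u) /w /= !inE !negb_or.
  move=> /and4P[/and3P[_ /negbTE -> _] /andP[/negbTE -> _] /negbTE kl _].
  by rewrite eqxx eq_sym kl; field.
have bx0 a : bary (f \o V) a x0 = w a by rewrite (bary_unique fn).
have [t t0 [g [Fg gx gx0]]] :=
  interior_line (x0 + (x0 - f (V k))) (local_cover Vn F_isometry F_cover F_disjoint x0).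
set x := x0 + t *: _ in gx.
have bxk : bary (f \o V) k x = - t.
  rewrite /x affine_fun_line; last exact: bary_affine.
  rewrite bx0 /w eqxx add0r subr0.
  have [c [d bE]] := bary_affine (f \o V) k.
  have := bary_vertex fn k k; have := bx0 k; rewrite /w eqxx !bE /= !dotpL => h0 h1.
  have -> : dotp c x0 + (dotp c x0 - dotp c (f (V k))) + d =
    (dotp c x0 + d) + (dotp c x0 + d) - (dotp c (f (V k)) + d) by ring.
  by rewrite h0 h1; ring.
have gn := copy_nondegenerate Fg.
have fg : f <> g.
  move=> fg; move: gx; rewrite -fg => /(tileP Vn F_isometry _ Ff)/(_ k).
  by rewrite bxk oppr_ge0 leNgt t0.
have fx0 : (f @` T) x0.
  by apply/(tileP Vn F_isometry _ Ff) => a; rewrite bx0 /w; case: ifP; rewrite // invr_ge0.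
have [A [B [A3 B3 fA gB]]] := F_face Ff Fg fg.
rewrite (isometry_face V A (F_isometry Ff)) in fA.
rewrite (isometry_face V B (F_isometry Fg)) in gB.
have x0A : face (f \o V) A x0 by rewrite -fA.
(* [x0] has positive weight at the three vertices other than [k], so all of them belong to the
   common face, and a common face has at most three vertices. *)
have AE : A = ~: [set k].
  apply/esym/eqP; rewrite eqEcard cardsC1 card_ord A3 andbT.
  apply/fintype.subsetP => a; rewrite !inE => ak.
  apply: contrapT => /negP aA; move/(faceP fn): x0A => [_ /(_ a aA)].
  by rewrite bx0 /w (negbTE ak) => /eqP; rewrite invr_eq0 pnatr_eq0.
have fgA a : a \in A -> exists2 b, b \in B & g (V b) = f (V a).
  move=> aA; pose v := f (V a).
  have vB : face (g \o V) B v.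
    rewrite -gB fA; apply/(faceP fn); split=> [b|b bA]; rewrite (bary_vertex fn b a) ?ler0n //.
    by case: eqVneq bA => // ->; rewrite aA.
  have vg := @affine_fun_baryE _ _ gn _ v (bary_affine (f \o V) a).
  rewrite (bary_vertex fn a a) eqxx in vg.
  have [vB0 vB1] := (faceP gn B v).1 vB.
  have bA b : b \in B -> (forall e, 0 <= bary (f \o V) e (g (V b))).
    move=> bB; suff /(faceP fn)[] : face (f \o V) A (g (V b)) by [].
    rewrite -fA gB; apply/(faceP gn); split=> [e|e eB]; rewrite (bary_vertex gn e b) ?ler0n //.
    by case: eqVneq eB => // ->; rewrite bB.
  (* On the common face the coordinate [a] is at most 1, with value 1 at [v]. As [v] is a convex
     combination of vertices of [g] on that face, one of these attains 1, and a point of the tile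
     [f] with coordinate 1 is the vertex itself. *)
  have [b bB /eqP p] : exists2 b, b \in B & bary (f \o V) a (g (V b)) == 1.
    apply: contrapT => no.
    have : \sum_b bary (g \o V) b v * bary (f \o V) a (g (V b)) < 1.
      rewrite -(bary_sum (g \o V) v).
      have [b vb] : exists b, 0 < bary (g \o V) b v.
        apply: contrapT => nb; have := bary_sum (g \o V) v.
        rewrite big1 => [/eqP|b _]; first by rewrite eq_sym oner_eq0.
        by apply/eqP; rewrite eq_le vB0 andbT leNgt; apply/negP => ?; apply: nb; exists b.
      have lt1 e : e \in B -> bary (f \o V) a (g (V e)) < 1.
        move=> eB; rewrite lt_neqAle; apply/andP; split.
          by apply/negP => e1; apply: no; exists e.
        by rewrite -(bary_sum (f \o V) (g (V e))) (bigD1 a) //= lerDl sumr_ge0 // => c _; exact: bA.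
      have bB : b \in B by apply: contrapT => /negP /vB1 b0; move: vb; rewrite b0 ltxx.
      rewrite (bigD1 b) //= [X in _ < X](bigD1 b) //=; apply: ltr_leD.
        by rewrite gtr_pMr // lt1.
      apply: ler_sum => e _; have [eB|eB] := boolP (e \in B).
        by rewrite ler_piMr // ltW // lt1.
      by rewrite vB1 // mul0r.
    by rewrite -vg ltxx.
  exists b => //; rewrite -[LHS](baryE fn) (bigD1 a) //= p scale1r big1 ?addr0 // => e ea.
  have := bary_sum (f \o V) (g (V b)); rewrite (bigD1 a) //= p => /eqP.
  rewrite -subr_eq0 addrAC subrr add0r psumr_eq0 => [/allP/(_ e)|c _]; last exact: bA.
  by rewrite mem_index_enum ea => /(_ isT)/eqP ->; rewrite scale0r.
have inA a : a != k -> a \in A by rewrite AE !inE.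
have := u; rewrite /= !inE !negb_or => /and4P[/and3P[ij ik il] /andP[jk jl] kl _].
have [i' i'B fi] := fgA i (inA i ik); have [j' j'B fj] := fgA j (inA j jk).
have lk : l != k by rewrite eq_sym.
have [l' l'B fl] := fgA l (inA l lk).
have u3 : uniq [:: i'; j'; l'].
  have ne a b a' b' : a != b -> g (V a') = f (V a) -> g (V b') = f (V b) -> a' != b'.
    move=> ab ga gb; apply: contra_neq ab => ab'.
    by apply: (isometry_vertex_inj Vn F_isometry Ff); rewrite -ga -gb ab'.
  by rewrite /= !inE !negb_or (ne i j) // (ne i l) // (ne j l).
have [k' u4] := uniq3_ex u3.
have u5 : uniq [:: i'; j'; k'; l'].
  move: u4; rewrite /= !inE !negb_or !andbT => /and3P[/and3P[-> -> ->] /andP[-> ->]].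
  by rewrite eq_sym => ->.
exists g, i', j', k', l'; split=> //.
(* Only [k'] lies off the plane of the common face, and [x] is strictly beyond this plane, so [k']
   is too. *)
have bk := bary_affine (f \o V) k.
have := affine_fun_baryE gn x bk; rewrite bxk (sum_ord4 _ u5) /= fi fj fl.
have E a : a != k -> bary (f \o V) k (f (V a)) = 0.
  by move=> ak; rewrite -[f (V a)]/((f \o V) a) bary_vertex // eq_sym (negbTE ak).
rewrite !E // ?mulr0 ?add0r ?addr0 // 1?eq_sym // => h.
have bk0 : 0 <= bary (g \o V) k' x by move/(tileP Vn F_isometry _ Fg): gx; exact.
rewrite ltNge; apply/negP => b0; have := mulr_ge0 bk0 b0.
by rewrite -h oppr_ge0 leNgt t0.
Qed.

End Neighbour.

(** * Walking around an edge *)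

Section Walk.
Variable R : realType.
Implicit Types (P Q S e u v : 'rV[R]_3).

(** Four times the squared area of the triangle. *)
Definition area2 P Q S : R := dotp (cross (Q - P) (S - P)) (cross (Q - P) (S - P)).

Lemma isometry_area2 f P Q S : euclidean_isometry f ->
  area2 (f P) (f Q) (f S) = area2 P Q S.
Proof. by move=> fi; rewrite /area2 !dotp_cross !isometry_dotp. Qed.

Lemma orth_partD e u v : orth_part e (u + v) = orth_part e u + orth_part e v.
Proof. by rewrite /orth_part !dotpL mulrDl scalerDl opprD addrACA. Qed.
Lemma orth_partZ e a u : orth_part e (a *: u) = a *: orth_part e u.
Proof. by rewrite /orth_part !dotpL scalerBr scalerA mulrA. Qed.
Lemma orth_part_self e : orth_part e e = 0.
Proof.
rewrite /orth_part; have [->|e0] := eqVneq e 0; first by rewrite scaler0 subr0.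
by rewrite divff ?dotp_eq0 // scale1r subrr.
Qed.

Lemma isometry_dihedral f P Q A B : euclidean_isometry f ->
  dihedral_angle (f P) (f Q) (f A) (f B) = dihedral_angle P Q A B.
Proof.
move=> fi; have E C D : dotp (orth_part (f Q - f P) (f C - f P)) (orth_part (f Q - f P) (f D - f P))
    = dotp (orth_part (Q - P) (C - P)) (orth_part (Q - P) (D - P)).
  have [e0|e0] := eqVneq (Q - P) 0.
    have fe0 : f Q - f P = 0.
      by apply/eqP; rewrite -dotp_eq0 isometry_dotp // e0 dotp0l.
    by rewrite e0 fe0 /orth_part !dotp0r !mul0r !scale0r !subr0 isometry_dotp.
  have fe0 : f Q - f P != 0 by rewrite -dotp_eq0 isometry_dotp // dotp_eq0.
  by rewrite !dotp_orth_part // !isometry_dotp.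
by rewrite /dihedral_angle /angle /enorm !E.
Qed.

Lemma orth_part_vertex_neq0 (V : 'I_4 -> 'rV[R]_3) i j k l :
  nondegenerate_tetrahedron V -> uniq [:: i; j; k; l] ->
  orth_part (V j - V i) (V k - V i) != 0.
Proof.
move=> Vn u; apply/eqP; rewrite /orth_part; set t := (_ / _) => /eqP.
rewrite subr_eq0 => /eqP h.
have := affine_fun_line (V i) (V j) t (bary_affine V k).
rewrite -h addrC subrK !bary_vertex // eqxx.
move: u; rewrite /= !inE !negb_or => /and4P[/and3P[_ ik _] /andP[jk _] _ _].
rewrite !(eq_sym k) (negbTE ik) (negbTE jk) subrr mulr0 addr0 => /eqP.
by rewrite oner_eq0.
Qed.

Variables (V : 'I_4 -> 'rV[R]_3) (F : set ('rV[R]_3 -> 'rV[R]_3)).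
Hypothesis Vn : nondegenerate_tetrahedron V.
Let T := tetrahedron V.
Hypothesis F_isometry : forall f, F f -> euclidean_isometry f.
Hypothesis F_cover : \bigcup_(f in F) (f @` T) = setT.
Hypothesis F_disjoint : forall f g, F f -> F g -> f <> g ->
          interior (f @` T) `&` interior (g @` T) = set0.
Hypothesis F_face : forall f g, F f -> F g -> f <> g ->
          exists A B : {set 'I_4},
            [/\ (#|A| <= 3)%N, (#|B| <= 3)%N,
                f @` T `&` g @` T = f @` face V A
              & f @` T `&` g @` T = g @` face V B].

(** [L] is a squared edge length, and [t] separates the small faces from the large ones. *)
Variables (p : nat) (L t : R).
Hypothesis p_gt2 : (2 < p)%N.
Hypothesis angle_L : forall i j k l, uniq [:: i; j; k; l] ->
  dotp (V j - V i) (V j - V i) = L ->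
  dihedral_angle (V i) (V j) (V k) (V l) = 2 * pi / p%:R.
Hypothesis area_L : forall i j k l, uniq [:: i; j; k; l] ->
  dotp (V j - V i) (V j - V i) = L ->
  (area2 (V i) (V j) (V k) < t) != (area2 (V i) (V j) (V l) < t).

Let theta : R := 2 * pi / p%:R.
Let c := cos theta.
Let s := sin theta.

Lemma p_gt0 : 0 < p%:R :> R.
Proof. by rewrite ltr0n (ltn_trans _ p_gt2). Qed.

Lemma sin_theta_gt0 : 0 < s.
Proof.
apply: sin_gt0_pi; rewrite /theta divr_gt0 ?mulr_gt0 ?pi_gt0 ?p_gt0 //=.
by rewrite ltr_pdivrMr ?p_gt0 // mulrC ltr_pM2l ?pi_gt0 // ltr_nat.
Qed.

Lemma cs1 : c ^+ 2 + s ^+ 2 = 1. Proof. exact: cos2Dsin2. Qed.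

Section Rotation.
Variables (u v : 'rV[R]_3).
Hypotheses (uu : dotp u u = 1) (vv : dotp v v = 1) (uv : dotp u v = 0).
Definition rot_dir (m : nat) : 'rV[R]_3 := cos (m%:R * theta) *: u + sin (m%:R * theta) *: v.

Lemma rot_dot m : dotp (rot_dir m) (rot_dir m) = 1.
Proof.
rewrite /rot_dir !dotpL uu vv uv (dotpC v u) uv !mulr0 !mulr1 add0r addr0 -!expr2.
exact: cos2Dsin2.
Qed.

Lemma rotS m : rot_dir m.+1 = (c * cos (m%:R * theta) - s * sin (m%:R * theta)) *: u +
   (s * cos (m%:R * theta) + c * sin (m%:R * theta)) *: v.
Proof.
rewrite /rot_dir -natr1 mulrDl mul1r cosD sinD -/c -/s; congr (_ *: _ + _ *: _); ring.
Qed.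

Lemma rot_dotS m : dotp (rot_dir m) (rot_dir m.+1) = c.
Proof.
rewrite rotS /rot_dir !dotpL uu vv uv (dotpC v u) uv.
have := cos2Dsin2 (m%:R * theta).
set x := cos (m%:R * theta); set y := sin (m%:R * theta) => xy.
by transitivity (c * (x ^+ 2 + y ^+ 2)); [ring | rewrite xy mulr1].
Qed.

(** The next direction is the reflection of [rot_dir m] in the line of [rot_dir m.+1]; [walk_step]
    finds it in this form, without measuring oriented angles. *)
Lemma rotSS m : rot_dir m.+2 = (2 * c) *: rot_dir m.+1 - rot_dir m.
Proof.
have e := cs1; have s2 : s ^+ 2 = 1 - c ^+ 2 by rewrite -e; ring.
rewrite (rotS m.+1) (rotS m) -[m.+1%:R]natr1 mulrDl mul1r cosD sinD -/c -/s /rot_dir.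
set a := cos (m%:R * theta); set b := sin (m%:R * theta).
have -> : c * (a * c - b * s) - s * (b * c + a * s) = 2 * c * (c * a - s * b) - a.
  by transitivity (c * (a * c - b * s) - s * (b * c) - a * s ^+ 2); [ring|rewrite s2; ring].
have -> : s * (a * c - b * s) + c * (b * c + a * s) = 2 * c * (s * a + c * b) - b.
  by transitivity (s * (a * c) - b * s ^+ 2 + c * (b * c + a * s)); [ring|rewrite s2; ring].
by apply/rowP => k; rewrite !mxE; ring.
Qed.

Lemma rot_period : rot_dir p = rot_dir 0 /\ rot_dir p.+1 = rot_dir 1.
Proof.
have pth : p%:R * theta = pi *+ 2 by rewrite /theta mulr2n; field; exact: lt0r_neq0 p_gt0.
have hp : rot_dir p = rot_dir 0 by rewrite /rot_dir pth cos2pi sin2pi mul0r cos0 sin0.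
split=> //; rewrite !rotS pth mul0r cos2pi sin2pi cos0 sin0 //.
Qed.

End Rotation.

Section Orbit.
Variables (P Q : 'rV[R]_3) (h : nat -> 'rV[R]_3).
Hypothesis h_dot : forall m, dotp (h m) (h m) = 1.
Hypothesis h_dotS : forall m, dotp (h m) (h m.+1) = c.
Hypothesis hSS : forall m, h m.+2 = (2 * c) *: h m.+1 - h m.
Hypothesis PQ : dotp (Q - P) (Q - P) = L.
Let H S := orth_part (Q - P) (S - P).

(** Seen along the edge [PQ], the tile [g] fills the sector between [h m] and [h m.+1]. The face
    [ijk] is the one through which the walk enters it, and [b] tells whether this face is small. *)
Definition walk_state (m : nat) (b : bool) g i j k l :=
  [/\ F g, uniq [:: i; j; k; l], g (V i) = P /\ g (V j) = Q,
      (exists2 al : R, 0 < al & H (g (V k)) = al *: h m) /\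
      (exists2 be : R, 0 < be & H (g (V l)) = be *: h m.+1)
    & (area2 (V i) (V j) (V k) < t) = b].

Lemma walk_edge f i j : F f -> f (V i) = P -> f (V j) = Q ->
  dotp (V j - V i) (V j - V i) = L.
Proof.
by move=> /F_isometry fi fP fQ; rewrite -(isometry_dotp _ _ _ fi) fP fQ.
Qed.

Lemma walk_dihedral f i j k l : F f -> uniq [:: i; j; k; l] -> f (V i) = P -> f (V j) = Q ->
  dotp (H (f (V k))) (H (f (V l))) = c * (enorm (H (f (V k))) * enorm (H (f (V l)))).
Proof.
move=> Ff u fP fQ; rewrite cos_angle.
have := isometry_dihedral (V i) (V j) (V k) (V l) (F_isometry Ff).
by rewrite fP fQ (angle_L u (walk_edge Ff fP fQ)) -/theta /dihedral_angle => ->.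
Qed.

Lemma H_bary f x i j k l : F f -> uniq [:: i; j; k; l] -> f (V i) = P -> f (V j) = Q ->
  H x = bary (f \o V) k x *: H (f (V k)) + bary (f \o V) l x *: H (f (V l)).
Proof.
move=> Ff u fP fQ; have fn := copy_nondegenerate Vn F_isometry Ff.
rewrite /H; have -> : x - P = bary (f \o V) j x *: (Q - P) + bary (f \o V) k x *: (f (V k) - P)
   + bary (f \o V) l x *: (f (V l) - P).
  have := bary_sum (f \o V) x; have := baryE fn x.
  rewrite !(sum_ord4 _ u) /= fP fQ => xE b1; rewrite -{1}xE.
  have -> : bary (f \o V) i x = 1 - bary (f \o V) j x - bary (f \o V) k x - bary (f \o V) l x.
    by rewrite -b1; ring.
  by apply/rowP => q; rewrite !mxE; ring.
rewrite [LHS]orth_partD (orth_partD _ (_ *: _) (_ *: _)) !orth_partZ.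
by rewrite orth_part_self scaler0 add0r.
Qed.

Lemma enorm_scale (al : R) (m : nat) : 0 <= al -> enorm (al *: h m) = al.
Proof. by move=> al0; rewrite /enorm !dotpL h_dot mulr1 -expr2 sqrtr_sqr ger0_norm. Qed.

(** The far vertex of the next tile is seen at angle [theta] from [h m.+1]. Only the directions
    [h m] and [h m.+2] qualify, and lying beyond the shared face excludes [h m]. The walk leaves
    through the face [ijl], which by [area_L] is of the other size than [ijk]. *)
Lemma walk_step m b f i j k l : walk_state m b f i j k l ->
  exists g i' j' k' l', walk_state m.+1 (~~ b) g i' j' k' l'.
Proof.
move=> [Ff u [fP fQ] [[al al0 Hk] [be be0 Hl]] ab].
have [g [i' [j' [k' [l' [Fg u' [gi gj gl] bk]]]]]] :=
  neighbour Vn F_isometry F_cover F_disjoint F_face Ff u.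
have [gP gQ] : g (V i') = P /\ g (V j') = Q by rewrite gi gj.
have u2 : uniq [:: i'; j'; l'; k'].
  move: u'; rewrite /= !inE !negb_or !andbT => /and3P[/and3P[-> -> ->] /andP[-> ->]].
  by rewrite eq_sym => ->.
exists g, i', j', l', k'; split=> //; first split.
- by exists be => //; rewrite gl.
- set x := g (V k'); have := H_bary x Ff u fP fQ; rewrite Hk Hl !scalerA.
  move: bk; rewrite -/x; set bk := bary _ k x; set bl := bary _ l x => bk0 Hx.
  have := walk_dihedral Fg u2 gP gQ; rewrite gl -/x Hl enorm_scale ?ltW //.
  have := enorm_sqr (H x); have := enorm_ge0 (H x); set ga := enorm (H x).
  rewrite Hx !dotpL !h_dot (dotpC (h m.+1) (h m)) h_dotS !mulr1.
  set a := - (bk * al); set d := bl * be => ga0 ga2 dih.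
  have a0 : 0 < a by rewrite /a -mulNr mulr_gt0 // oppr_gt0.
  have akE : bk * al = - a by rewrite opprK.
  rewrite akE in ga2 dih Hx.
  have dE : d = c * (ga + a).
    apply: (mulIf (lt0r_neq0 be0)); transitivity (be * (- a * c + d) + be * (a * c)); first ring.
    have -> : be * (- a * c + d) = c * (be * ga) by rewrite -dih; ring.
    ring.
  (* Inserting [dE] into the squared length [ga2] leaves [(a ^ 2 - ga ^ 2) * s ^ 2 = 0]. *)
  have aga : a = ga.
    have s0 := sin_theta_gt0; have cs := cs1.
    have : (a - ga) * (a + ga) * s ^+ 2 = 0.
      have -> : s ^+ 2 = 1 - c ^+ 2 by rewrite -cs; ring.
      move: ga2; rewrite dE => ga2.
      transitivity (- a * (- a) + - a * (c * (ga + a) * c) +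
        (c * (ga + a) * (- a * c) + c * (ga + a) * (c * (ga + a))) - ga ^+ 2); first ring.
      by rewrite ga2; ring.
    move/eqP; rewrite !mulf_eq0 (gt_eqF s0) !orbF => /orP[].
      by rewrite subr_eq0 => /eqP.
    by rewrite gt_eqF // ltr_wpDr.
  exists a => //; rewrite akE hSS dE -aga; apply/rowP => q; rewrite !mxE; ring.
- have [ai aj al'] : [/\ area2 (V i') (V j') (V l') = area2 (V i) (V j) (V l), True & True].
    by rewrite -(isometry_area2 _ _ _ (F_isometry Fg)) gi gj gl isometry_area2 //; exact: F_isometry.
  have := area_L u (walk_edge Ff fP fQ); rewrite ai ab.
  by case: b (_ < t) {ab} => [] [].
Qed.

Lemma eps_gt0 (b ka : R) : 0 < b \/ (b = 0 /\ 0 < ka) ->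
  exists2 e, 0 < e & forall ep, 0 < ep < e -> 0 < b + ep * ka.
Proof.
case=> [b0|[-> k0]]; last by exists 1 => // ep /andP[ep0 _]; rewrite add0r mulr_gt0.
have k1 : 0 < 1 + `|ka| by rewrite ltr_wpDr.
exists (b / (1 + `|ka|)) => [|ep /andP[ep0]]; first by rewrite divr_gt0.
rewrite ltr_pdivlMr // => epb; have : - `|ka| <= ka by rewrite lerNl ler_normr lexx orbT.
by have := normr_ge0 ka; nra.
Qed.

(** A point slightly off the midpoint of the edge, towards the middle of the sector, is interior to
    the tile. Hence the two directions determine the tile. *)
Lemma wedge m b f i j k l : walk_state m b f i j k l ->
  exists2 e, 0 < e & forall ep, 0 < ep < e ->
    forall a, 0 < bary (f \o V) a (2^-1 *: (P + Q) + ep *: (h m + h m.+1)).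
Proof.
move=> [Ff u [fP fQ] [[al al0 Hk] [be be0 Hl]] _].
have fn := copy_nondegenerate Vn F_isometry Ff.
have W a : exists2 e, 0 < e & forall ep, 0 < ep < e ->
    0 < bary (f \o V) a (2^-1 *: (P + Q) + ep *: (h m + h m.+1)).
  have [w [d bE]] := bary_affine (f \o V) a.
  have B q : dotp w (f (V q)) + d = (a == q)%:R.
    by rewrite -bE; exact: (bary_vertex fn a q).
  have := congr1 (dotp w) Hk; have := congr1 (dotp w) Hl.
  rewrite /H /orth_part; set tl := (_ / _); set tk := (_ / _).
  move: (B i) (B j) (B k) (B l); rewrite fP fQ => Bi Bj Bk Bl.
  rewrite !dotpZr !(dotpDr, dotpNr, dotpZr) => El Ek.
  suff [e e0 he] : exists2 e, 0 < e & forall ep, 0 < ep < e ->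
      0 < ((a == i)%:R + (a == j)%:R) / 2 + ep * (dotp w (h m) + dotp w (h m.+1)).
    exists e => // ep /he; rewrite bE -Bi -Bj !dotpDr !dotpZr !dotpDr => lt0.
    by apply: lt_le_trans lt0 _; lra.
  apply: eps_gt0.
  have := u; rewrite /= !inE !negb_or => /and4P[/and3P[ij ik il] /andP[jk jl] kl _].
  have [E|E|E|E] := uniq4P a u; rewrite ?E ?eqxx ?(negbTE ij) /= in Bi Bj Bk Bl *.
  - by left; rewrite divr_gt0 // ltr_wpDr.
  - by left; rewrite divr_gt0 // ltr_wpDl.
  - right; rewrite (eq_sym k i) (eq_sym k j) (negbTE ik) (negbTE jk) /= in Bi Bj *.
    rewrite (negbTE kl) /= in Bl.
    rewrite addr0 mul0r; split=> //.
    have eQ : dotp w Q = dotp w P by lra.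
    have -> : dotp w (h m.+1) = 0.
      apply: (mulfI (lt0r_neq0 be0)); rewrite -El mulr0 eQ.
      have -> : dotp w (f (V l)) = dotp w P by lra.
      ring.
    rewrite addr0 -(pmulr_rgt0 _ al0) -Ek eQ.
    have -> : dotp w (f (V k)) = dotp w P + 1 by lra.
    by rewrite (_ : _ - _ = 1) //; ring.
  - right; rewrite (eq_sym l i) (eq_sym l j) (negbTE il) (negbTE jl) /= in Bi Bj *.
    rewrite (eq_sym l k) (negbTE kl) /= in Bk.
    rewrite addr0 mul0r; split=> //.
    have eQ : dotp w Q = dotp w P by lra.
    have -> : dotp w (h m) = 0.
      apply: (mulfI (lt0r_neq0 al0)); rewrite -Ek mulr0 eQ.
      have -> : dotp w (f (V k)) = dotp w P by lra.
      ring.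
    rewrite add0r -(pmulr_rgt0 _ be0) -El eQ.
    have -> : dotp w (f (V l)) = dotp w P + 1 by lra.
    by rewrite (_ : _ - _ = 1) //; ring.
have [e1 p1 h1] := W i1; have [e2 p2 h2] := W i2.
have [e3 p3 h3] := W i3; have [e4 p4 h4] := W i4.
exists (Num.min (Num.min e1 e2) (Num.min e3 e4)) => [|ep]; first by rewrite !lt_min p1 p2 p3 p4.
rewrite !lt_min => /andP[ep0 /andP[/andP[x1 x2] /andP[x3 x4]]] a.
have [] := @uniq4P i1 i2 i3 i4 a isT => ->; [apply: h1|apply: h2|apply: h3|apply: h4];
  exact/andP.
Qed.

Lemma walk_closed m m' b b' f f' i j k l i' j' k' l' :
  walk_state m b f i j k l -> walk_state m' b' f' i' j' k' l' ->
  h m' = h m -> h m'.+1 = h m.+1 -> b = b'.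
Proof.
move=> W W' hm hm1.
have [e e0 he] := wedge W; have [e' e0' he'] := wedge W'.
have ff : f = f'.
  have [[Ff _ _ _ _] [Ff' _ _ _ _]] := (W, W').
  pose ep := Num.min e e' / 2.
  have ep1 : 0 < Num.min e e' by rewrite lt_min e0.
  have ep2 : 0 < ep < Num.min e e' by rewrite /ep; apply/andP; split; lra.
  move: ep2; rewrite lt_min => /and3P[x1 x2 x3].
  apply: (tile_unique Vn F_isometry F_disjoint Ff Ff' (x := 2^-1 *: (P + Q) + ep *: (h m + h m.+1))).
    by apply: he; rewrite x1.
  by rewrite -hm -hm1; apply: he'; rewrite x1.
case: W' => Ff' u' [fP' fQ'] [[al' al0' Hk'] _] <-.
case: W => Ff u [fP fQ] [[al al0 Hk] [be be0 Hl]] <-.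
rewrite -ff in fP' fQ' Hk'.
have ii : i' = i by apply: (isometry_vertex_inj Vn F_isometry Ff); rewrite fP.
have jj : j' = j by apply: (isometry_vertex_inj Vn F_isometry Ff); rewrite fQ.
suff -> : k' = k by rewrite ii jj.
rewrite ii jj in u'.
move: u'; rewrite /= !inE !negb_or => /and4P[/and3P[_ ik' _] /andP[jk' _] _ _].
have [E|E|//|E] := uniq4P k' u; first by rewrite E eqxx in ik'.
  by rewrite E eqxx in jk'.
(* If the tile were entered through the other face, two consecutive directions would agree, against
   [sin theta > 0]. *)
move: Hk'; rewrite E Hl hm => Hbe.
have bal : be = al' by rewrite -(enorm_scale m.+1 (ltW be0)) Hbe enorm_scale // ltW.
have := congr1 (dotp (h m)) Hbe; rewrite !dotpZr h_dot h_dotS -bal => /(mulfI (lt0r_neq0 be0)) c1.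
have := cs1; rewrite c1 expr1n => /eqP; rewrite -subr_eq0 addrAC subrr add0r.
by rewrite sqrf_eq0 (gt_eqF sin_theta_gt0).
Qed.

Lemma walk_all b f i j k l : walk_state 0 b f i j k l -> forall m,
  exists g i' j' k' l', walk_state m (odd m (+) b) g i' j' k' l'.
Proof.
move=> W; elim=> [|m [g [i' [j' [k' [l' W']]]]]]; first by exists f, i, j, k, l.
by have := walk_step W'; rewrite /= -addNb.
Qed.

End Orbit.

(* The [p] tiles around a copy of such an edge alternate between starting at a small and at a
   large face, so the walk around it cannot close up after an odd number of steps. *)
Theorem no_odd_edge_class i j k l : odd p -> uniq [:: i; j; k; l] ->
  dotp (V j - V i) (V j - V i) = L -> False.
Proof.
move=> pod u ijL.
have [f Ff _] : (\bigcup_(f in F) (f @` T)) 0 by rewrite F_cover.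
have fi := F_isometry Ff; have fn := copy_nondegenerate Vn F_isometry Ff.
pose P := f (V i); pose Q := f (V j).
pose Hk := orth_part (Q - P) (f (V k) - P); pose Hl := orth_part (Q - P) (f (V l) - P).
have u2 : uniq [:: i; j; l; k].
  move: u; rewrite /= !inE !negb_or !andbT => /and3P[/and3P[-> -> ->] /andP[-> ->]].
  by rewrite eq_sym => ->.
have Hk0 : 0 < enorm Hk by rewrite enorm_gt0; exact: (orth_part_vertex_neq0 fn u).
have Hl0 : 0 < enorm Hl by rewrite enorm_gt0; exact: (orth_part_vertex_neq0 fn u2).
have dih : dotp Hk Hl = c * (enorm Hk * enorm Hl).
  rewrite cos_angle; have := isometry_dihedral (V i) (V j) (V k) (V l) fi.
  by rewrite (angle_L u ijL) -/theta /dihedral_angle => ->.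
have s0 := sin_theta_gt0; have cs := cs1.
pose a := (enorm Hk)^-1 *: Hk; pose b := (enorm Hl)^-1 *: Hl.
have aa : dotp a a = 1.
  by rewrite !(dotpZl, dotpZr) -enorm_sqr; field; exact: lt0r_neq0.
have bb : dotp b b = 1.
  by rewrite !(dotpZl, dotpZr) -enorm_sqr; field; exact: lt0r_neq0.
have ab : dotp a b = c.
  by rewrite !(dotpZl, dotpZr) dih; field; rewrite !lt0r_neq0.
have Ha : Hk = enorm Hk *: a by rewrite /a scalerA divff ?scale1r // lt0r_neq0.
have Hb : Hl = enorm Hl *: b by rewrite /b scalerA divff ?scale1r // lt0r_neq0.
clearbody a b.
(* Gram-Schmidt: [a], [v] is an orthonormal pair in which [b] is [a] turned by [theta]. *)
pose v := s^-1 *: (b - c *: a).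
have sn : s != 0 by exact: lt0r_neq0.
have av : dotp a v = 0.
  by rewrite /v !(dotpZl, dotpZr, dotpDr, dotpNr) aa ab; ring.
have vv : dotp v v = 1.
  rewrite /v !(dotpZl, dotpZr, dotpDr, dotpNr, dotpDl, dotpNl) aa bb (dotpC b a) ab.
  have s2 : s ^+ 2 = 1 - c ^+ 2 by rewrite -cs; ring.
  transitivity ((1 - c ^+ 2) / s ^+ 2); first by field.
  by rewrite -s2 divff // expf_neq0.
pose h := rot_dir a v.
have W0 : walk_state P Q h 0 (area2 (V i) (V j) (V k) < t) f i j k l.
  split=> //; split.
    exists (enorm Hk) => //; by rewrite /h /rot_dir mul0r cos0 sin0 scale1r scale0r addr0.
  exists (enorm Hl) => //; rewrite /h /rot_dir mul1r -/c -/s /v scalerA divff // scale1r.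
  by rewrite (addrC (c *: a)) subrK.
have PQ : dotp (Q - P) (Q - P) = L by rewrite /P /Q isometry_dotp.
have hd := rot_dot aa vv av; have hdS := rot_dotS aa vv av; have hSS := rotSS a v.
have [g [i' [j' [k' [l' Wp]]]]] := walk_all hd hdS hSS PQ W0 p.
have [hp hp1] := rot_period a v.
have : (area2 (V i) (V j) (V k) < t) = odd p (+) (area2 (V i) (V j) (V k) < t).
  by apply: walk_closed W0 Wp hp hp1.
by rewrite pod; case: (_ < _).
Qed.

End Walk.

(** * Regular subdivisions *)

Section SupportTiling.
Variables (R : realType) (V : 'I_4 -> 'rV[R]_3).
Hypothesis Vn : nondegenerate_tetrahedron V.
Let T := tetrahedron V.

(* A regular subdivision: the tiles are the domains on which a convex piecewise
   affine function coincides with one of its affine pieces [ell i]. *)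
Lemma tiles_of_support (I : Type) (f : I -> 'rV[R]_3 -> 'rV[R]_3)
    (ell : I -> 'rV[R]_3 -> R) :
  (forall i, euclidean_isometry (f i)) ->
  (forall i, affine_fun (ell i)) ->
  (forall x, exists i, (f i @` T) x) ->
  (forall i j x, (f i @` T) x -> ell j x <= ell i x) ->
  (forall i j x, (f i @` T) x -> ell j x = ell i x -> (f j @` T) x) ->
  tiles_face_to_face V.
Proof.
move=> fi la cov le_ell eq_ell.
(* Several indices may describe the same tile, for instance when it has symmetries. One index is
   chosen for each affine piece, so that distinct chosen tiles have distinct pieces. *)
have [c cE] : {c : ('rV[R]_3 -> R) -> option I &
    forall e, (exists i, ell i = e) -> exists2 i, c e = Some i & ell i = e}.
  apply: (boolp.choice (P := fun e oi => (exists i, ell i = e) ->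
    exists2 i, oi = Some i & ell i = e)) => e.
  have [[i <-]|no] := pselect (exists i, ell i = e); first by exists (Some i) => _; exists i.
  by exists None.
have tE i j x : (f i @` T) x -> (f j @` T) x <-> ell j x = ell i x.
  move=> fx; split=> [fjx|]; last exact: eq_ell.
  by apply/eqP; rewrite eq_le !le_ell.
have common i j : ell i <> ell j -> exists2 A : {set 'I_4}, (#|A| <= 3)%N &
    f i @` T `&` f j @` T = f i @` face V A.
  move=> neq; pose h x := ell i x - ell j x.
  have ha : affine_fun h by exact: affine_funB.
  have fn := isometry_nondegenerate (fi i) Vn.
  have tP x : (f i @` T) x <-> forall a, 0 <= bary (f i \o V) a x.
    by rewrite isometry_tetrahedron //; exact: tetrahedronP.
  have hE x := @affine_fun_baryE _ _ fn _ x ha.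
  have h0 a : 0 <= h ((f i \o V) a).
    rewrite subr_ge0; apply: le_ell; apply/tP => b.
    by rewrite bary_vertex // ler0n.
  (* [h] is nonnegative on the tile [i] and vanishes exactly on the intersection, which is thus
     spanned by the vertices where [h] vanishes. If these were all four, the two pieces would be
     equal. *)
  pose Z : {set 'I_4} := finset (fun a => h ((f i \o V) a) == 0).
  exists Z.
    have Z4 : (#|Z| <= 4)%N by rewrite -[X in (_ <= X)%N](card_ord 4) max_card.
    rewrite leqNgt; apply/negP => Z3; have full : #|Z| = 4%N by apply/eqP; rewrite eqn_leq Z4.
    apply: neq; apply/funext => x; apply/eqP; rewrite -subr_eq0 -/(h x) hE big1 // => a _.
    have /subset_cardP e : #|Z| = #|'I_4| by rewrite full card_ord.
    have : a \in Z by have /e -> : Z \subset 'I_4 by apply/fintype.subsetP.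
    by rewrite inE => /eqP ->; rewrite mulr0.
  rewrite isometry_face //; apply/seteqP; split=> x.
    move=> [fx gx]; have /eqP := (tE i j x fx).1 gx; rewrite eq_sym -subr_eq0 -/(h x) => hx.
    apply/(faceP fn); split; first exact/tP.
    move=> a; rewrite inE => ha0.
    move: hx; rewrite hE psumr_eq0 => [/allP/(_ a)|b _]; last first.
      by rewrite mulr_ge0 //; move/tP: fx.
    rewrite mem_index_enum mulf_eq0 (negbTE ha0) orbF => /(_ isT)/eqP; exact.
  move=> /(faceP fn)[b0 bA]; have fx : (f i @` T) x by exact/tP.
  split=> //; apply/(tE i j x fx); apply/esym/eqP; rewrite -subr_eq0 -/(h x) hE.
  apply/eqP; apply: big1 => a _.
  have [aA|aA] := boolP (a \in Z); last by rewrite bA ?mul0r.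
  by move: aA; rewrite inE => /eqP ->; rewrite mulr0.
exists [set g | exists2 i, c (ell i) = Some i & g = f i].
have canon i j : c (ell i) = Some i -> c (ell j) = Some j -> f i <> f j -> ell i <> ell j.
  by move=> ci cj + e; apply; move: cj; rewrite -e ci => -[->].
split.
- by move=> _ [i _ ->].
- apply/seteqP; split=> // x _; have [i fx] := cov x.
  have [j cj ej] := cE (ell i) (ex_intro _ i erefl).
  exists (f j); first by exists j => //; rewrite ej.
  by apply/(tE i j x fx); rewrite ej.
- move=> _ _ [i ci ->] [j cj ->] ne; have neq := canon i j ci cj ne.
  apply/seteqP; split=> // x [xi xj]; apply: neq; apply/funext => y.
  (* The difference of the two pieces vanishes near [x], hence along every line through [x]. *)
  have : interior (f i @` T `&` f j @` T) x by rewrite interiorI.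
  move=> xij; have [t t0 [yi yj]] := interior_line y xij.
  have ha : affine_fun (fun z => ell i z - ell j z) by exact: affine_funB.
  have hx : ell i x - ell j x = 0.
    by rewrite (_ : ell j x = ell i x) ?subrr //; apply/tE; exact: interior_subset.
  have := affine_fun_line x y t ha; rewrite /= hx ((tE i j _ yi).1 yj) subrr subr0 add0r.
  by move/esym/eqP; rewrite mulf_eq0 (gt_eqF t0) subr_eq0 => /eqP.
- move=> _ _ [i ci ->] [j cj ->] ne; have neq := canon i j ci cj ne.
  have [A A3 fA] := common i j neq; have [B B3 fB] := common j i (nesym neq).
  by exists A, B; split=> //; rewrite setIC.
Qed.

(* [line m] is the piece over [m, m+1] of the convex interpolation of the square
   function at the integers. *)
Definition line (m : int) (s : R) : R := (2 * m%:~R + 1) * s - m%:~R * (m%:~R + 1).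

(** The difference of the pieces is [(m' - m) * (2 * s - m' - m - 1)]. On the interval of [m'] the
    second factor is zero or has the sign of the first; for [m <> m'] it vanishes only at a common
    end point of the two intervals. *)
Lemma line_leif m m' (s : R) : m'%:~R <= s <= m'%:~R + 1 ->
  line m s <= line m' s ?= iff (m%:~R <= s <= m%:~R + 1).
Proof.
move=> s'; have key : line m' s - line m s = (m'%:~R - m%:~R) * (2 * s - m'%:~R - m%:~R - 1).
  by rewrite /line; ring.
suff [k0 kE] : 0 <= line m' s - line m s /\
    ((line m' s - line m s == 0) = (m%:~R <= s <= m%:~R + 1)).
  by split; [rewrite -subr_ge0 | rewrite -kE subr_eq0 eq_sym].
rewrite key mulf_eq0 subr_eq0 eqr_int; move: s' => /andP[s1 s2].
have [mm|mm|->] := ltgtP m m'.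
- have : m%:~R + 1 <= m'%:~R :> R by rewrite -[1]/(1%:~R) -intrD ler_int lezD1.
  move=> d; rewrite /=; split; first by rewrite mulr_ge0 //; lra.
  apply/eqP/andP => [e|[e1 e2]]; [split|]; lra.
- have : m'%:~R + 1 <= m%:~R :> R by rewrite -[1]/(1%:~R) -intrD ler_int lezD1.
  move=> d; rewrite /=; split; first by rewrite mulr_le0 //; lra.
  apply/eqP/andP => [e|[e1 e2]]; [split|]; lra.
- by rewrite subrr mul0r lexx s1 s2.
Qed.

Lemma line_affine m (h : 'rV[R]_3 -> R) : affine_fun h -> affine_fun (fun x => line m (h x)).
Proof.
by move=> [c [d E]]; exists ((2 * m%:~R + 1) *: c), ((2 * m%:~R + 1) * d - m%:~R * (m%:~R + 1))
  => x; rewrite /line E !dotpL; ring.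
Qed.

(** The cells of the hyperplanes on which some [alpha a] is an integer are the domains of linearity
    of the sum over [a] of the interpolated squares of [alpha a]. *)
Lemma arrangement_tiles (I : Type) (A : finType) (f : I -> 'rV[R]_3 -> 'rV[R]_3)
    (alpha : A -> 'rV[R]_3 -> R) (m : I -> A -> int) :
  (forall i, euclidean_isometry (f i)) ->
  (forall a, affine_fun (alpha a)) ->
  (forall x, exists i, (f i @` T) x) ->
  (forall i x, (f i @` T) x <-> forall a, (m i a)%:~R <= alpha a x <= (m i a)%:~R + 1) ->
  tiles_face_to_face V.
Proof.
move=> fi aa cov fP.
have L i j x : (f i @` T) x -> \sum_a line (m j a) (alpha a x) <= \sum_a line (m i a) (alpha a x)
    ?= iff [forall a, (m j a)%:~R <= alpha a x <= (m j a)%:~R + 1].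
  by move=> /fP fx; apply: leif_sum => a _; apply: line_leif.
apply: (@tiles_of_support _ f (fun i x => \sum_a line (m i a) (alpha a x))) => //.
- by move=> i; apply: affine_fun_bigsum => a; exact: line_affine.
- by move=> i j x /(L i j)[].
- move=> i j x /(L i j)[_ lE] /eqP; rewrite lE => /forallP h; exact/fP.
Qed.

End SupportTiling.

Lemma perm_of_uniq n (t : n.-tuple 'I_n) : uniq t -> exists s : 'S_n, forall i, s i = tnth t i.
Proof.
move=> tu; have inj : injective (tnth t) by apply/tuple_uniqP.
by exists (perm inj) => i; rewrite permE.
Qed.

Notation o0 := (ord0 : 'I_3).
Notation o1 := (lift ord0 (ord0 : 'I_2) : 'I_3).
Notation o2 := (lift ord0 (lift ord0 (ord0 : 'I_1)) : 'I_3).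

Lemma perm_of_uniq3 (a b c : 'I_3) : uniq [:: a; b; c] ->
  exists s : 'S_3, [/\ s o0 = a, s o1 = b & s o2 = c].
Proof.
by move=> u; have [s sE] := perm_of_uniq (t := [tuple a; b; c]) u; exists s; rewrite !sE.
Qed.

Lemma sort3 (R : realType) (u : 'I_3 -> R) :
  exists s : 'S_3, u (s o1) <= u (s o0) /\ u (s o2) <= u (s o1).
Proof.
have P a b c : uniq [:: a; b; c] -> u b <= u a -> u c <= u b ->
    exists s : 'S_3, u (s o1) <= u (s o0) /\ u (s o2) <= u (s o1).
  by move=> /perm_of_uniq3[s [<- <- <-]] *; exists s.
have [h01|/ltW h01] := leP (u o0) (u o1); have [h02|/ltW h02] := leP (u o0) (u o2);
  have [h12|/ltW h12] := leP (u o1) (u o2).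
- exact: (P o2 o1 o0).
- exact: (P o1 o2 o0).
- exact: (P o1 o0 o2).
- exact: (P o1 o0 o2).
- exact: (P o2 o0 o1).
- exact: (P o2 o0 o1).
- exact: (P o0 o2 o1).
- exact: (P o0 o1 o2).
Qed.

(** * Frames with a permutation-invariant Gram matrix *)

Section Frame.
Variables (R : realType) (V v : 'I_4 -> 'rV[R]_3) (o : 'rV[R]_3) (B : 'M[R]_3) (p q : R).
Hypothesis Vn : nondegenerate_tetrahedron V.
Hypothesis VE : forall a, V a = o + v a *m B.
Hypothesis gram : forall i j, dotp (row i B) (row j B) = if i == j then p else q.
Let T := tetrahedron V.

Lemma frame_unit : B \in unitmx.
Proof.
have := edge_mx_unit Vn; rewrite (_ : edge_mx V = edge_mx v *m B) ?unitmx_mul => [/andP[]//|].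
apply/row_matrixP => i; rewrite row_mul !rowK !VE mulmxBl.
by rewrite opprD addrACA subrr add0r.
Qed.

Definition pt (y : 'I_3 -> R) : 'rV[R]_3 := o + (\row_i y i) *m B.
Definition coord (x : 'rV[R]_3) (i : 'I_3) : R := ((x - o) *m invmx B) 0 i.

Lemma coordK x : pt (coord x) = x.
Proof.
rewrite /pt (_ : \row_i _ = (x - o) *m invmx B); last by apply/rowP => i; rewrite mxE.
by rewrite mulmxKV ?frame_unit // addrC subrK.
Qed.

Lemma ptK y : coord (pt y) = y.
Proof.
by apply/funext => i; rewrite /coord /pt addrC addKr mulmxK ?frame_unit // mxE.
Qed.

Lemma coord_affine i : affine_fun (coord^~ i).
Proof.
exists (col i (invmx B))^T, (- (o *m invmx B) 0 i) => x.
rewrite /coord mulmxBl !mxE; congr (_ + _).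
by rewrite /dotp; apply: eq_bigr => k _; rewrite !mxE mulrC.
Qed.

Lemma frame_bary (w : 'I_4 -> R) y a : \sum_a w a = 1 ->
  (forall i, \sum_a w a * v a 0 i = y i) -> bary V a (pt y) = w a.
Proof.
move=> w1 wv; rewrite -(bary_unique Vn a w1); congr (bary _ _ _).
under [RHS]eq_bigr do rewrite VE scalerDr scalemxAl.
rewrite big_split /= -scaler_suml w1 scale1r -mulmx_suml; congr (_ + _ *m _).
by apply/rowP => i; rewrite mxE summxE -wv; apply: eq_bigr => k _; rewrite mxE.
Qed.

Lemma pt_norm y y' : dotp (pt y - pt y') (pt y - pt y') =
  (p - q) * (\sum_i (y i - y' i) ^+ 2) + q * (\sum_i (y i - y' i)) ^+ 2.
Proof.
have -> : pt y - pt y' = (\row_i (y i - y' i)) *m B.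
  rewrite /pt opprD addrACA subrr add0r -mulmxBl; congr (_ *m _).
  by apply/rowP => i; rewrite !mxE.
by rewrite mulmx_sum_row !sum3E !mxE !dotpL !gram /=; ring.
Qed.

Definition sgn (e : bool) : R := (-1) ^+ e.
Lemma sgnK e : sgn e * sgn e = 1. Proof. by rewrite /sgn -expr2 sqrr_sign. Qed.

Definition place (s : 'S_3) (e : 'I_3 -> bool) (t : 'I_3 -> R) (x : 'rV[R]_3) : 'rV[R]_3 :=
  pt (fun i => t i + sgn (e ((s^-1)%g i)) * coord x ((s^-1)%g i)).

(** By [pt_norm] the norm depends only on the sum of the squares and on the square of the sum of the
    coordinates. Permutations and a common sign preserve both; independent signs preserve only the
    first. *)
Lemma place_isometry s e t : (q = 0 \/ forall j j', e j = e j') ->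
  euclidean_isometry (place s e t).
Proof.
move=> qe x y; apply/eq_enorm; rewrite -{3 4}(coordK x) -{3 4}(coordK y) !pt_norm.
have E j : t j + sgn (e ((s^-1)%g j)) * coord x ((s^-1)%g j) -
           (t j + sgn (e ((s^-1)%g j)) * coord y ((s^-1)%g j)) =
           sgn (e ((s^-1)%g j)) * (coord x ((s^-1)%g j) - coord y ((s^-1)%g j)) by ring.
congr (_ * _ + _).
  rewrite [RHS](reindex_inj (@perm_inj _ (s^-1)%g)); apply: eq_bigr => j _.
  by rewrite E exprMn /sgn sqrr_sign mul1r.
case: qe => [->|ee]; first by rewrite !mul0r.
congr (_ * _); under eq_bigr do rewrite E (ee _ ord0).
rewrite -mulr_sumr exprMn /sgn sqrr_sign mul1r; congr (_ ^+ 2).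
by rewrite [RHS](reindex_inj (@perm_inj _ (s^-1)%g)).
Qed.

Variable Rg : ('I_3 -> R) -> Prop.
Hypothesis TE : forall y, T (pt y) <-> Rg y.

Lemma placeP s e t x : (place s e t @` T) x <->
  Rg (fun j => sgn (e j) * (coord x (s j) - t (s j))).
Proof.
split=> [[z Tz <-]|rg].
  move: Tz; rewrite -{1}(coordK z) => /TE; congr Rg; apply/funext => j.
  rewrite /place ptK permK; set a := sgn _; have aa : a * a = 1 := sgnK _.
  by transitivity (a * a * coord z j); [rewrite aa mul1r | ring].
exists (pt (fun j => sgn (e j) * (coord x (s j) - t (s j)))); first exact/TE.
rewrite -[RHS]coordK /place; congr pt; apply/funext => i; rewrite ptK permKV.
set a := sgn _; have aa : a * a = 1 := sgnK _.
transitivity (t i + a * a * (coord x i - t i)); first ring.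
by rewrite aa; ring.
Qed.

End Frame.

Lemma ord4_enum (P : 'I_4 -> Prop) : P i1 -> P i2 -> P i3 -> P i4 -> forall a, P a.
Proof. by move=> h1 h2 h3 h4 a; case: (@uniq4P i1 i2 i3 i4 a isT) => ->. Qed.

Lemma sum4E (T : nmodType) (F : 'I_4 -> T) : \sum_a F a = F i1 + F i2 + F i3 + F i4.
Proof. exact: (@sum_ord4 T F i1 i2 i3 i4). Qed.

(** * Kuhn simplices and an alcove of type B3 *)

Section ThreeTilings.
Variables (R : realType) (V : 'I_4 -> 'rV[R]_3) (o : 'rV[R]_3) (B : 'M[R]_3) (p q : R).
Hypothesis Vn : nondegenerate_tetrahedron V.
Hypothesis gram : forall i j, dotp (row i B) (row j B) = if i == j then p else q.
Let T := tetrahedron V.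
Let index := (('S_3 * ('I_3 -> bool)) * ('I_3 -> int))%type.

Definition simplex_vertex (s : seq ('rV[R]_3)) (a : 'I_4) : 'rV[R]_3 := s`_a.

Definition kuhn_vertex :=
  simplex_vertex [:: 0; vec3 1 0 0; vec3 1 1 0; vec3 1 1 1].
Definition kuhn_region (y : 'I_3 -> R) : Prop :=
  [/\ y o0 <= 1, y o1 <= y o0, y o2 <= y o1 & 0 <= y o2].

Lemma kuhn_regionP : (forall a, V a = o + kuhn_vertex a *m B) ->
  forall y, T (pt o B y) <-> kuhn_region y.
Proof.
move=> VE y.
pose w (a : 'I_4) := [:: 1 - y o0; y o0 - y o1; y o1 - y o2; y o2]`_a.
have w1 : \sum_a w a = 1 by rewrite sum4E /w /=; ring.
have E a : bary V a (pt o B y) = w a.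
  apply: (frame_bary Vn VE) => //; apply: ord3P; rewrite sum4E /kuhn_vertex /w /= !mxE /=; ring.
split=> [/(tetrahedronP Vn) h|[h1 h2 h3 h4]].
  have := h i1; have := h i2; have := h i3; have := h i4; rewrite !E /w /=.
  by move=> *; split; lra.
by apply/(tetrahedronP Vn); apply: ord4_enum; rewrite E /w /=; lra.
Qed.

Theorem kuhn_tiles : (forall a, V a = o + kuhn_vertex a *m B) -> tiles_face_to_face V.
Proof.
move=> VE; have U := frame_unit Vn VE.
have RP := kuhn_regionP VE.
pose f (i : 'S_3 * ('I_3 -> int)) := place o B i.1 (fun=> false) (fun j => (i.2 j)%:~R).
have fP i x : (f i @` T) x <-> kuhn_region (fun j => coord o B x (i.1 j) - (i.2 (i.1 j))%:~R).
  rewrite (placeP Vn VE RP); suff -> : (fun j => sgn R false * (coord o B x (i.1 j) - (i.2 (i.1 j))%:~R)) =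
    (fun j => coord o B x (i.1 j) - (i.2 (i.1 j))%:~R) by [].
  by apply/funext => j; rewrite /sgn expr0 mul1r.
pose alpha (a : 'I_3 + 'I_3 * 'I_3) x :=
  match a with inl i => coord o B x i | inr (i, j) => coord o B x i - coord o B x j end.
(* The offsets in the cell decrease along [s], so that of [j] minus that of [k] lies in [-1, 0] when
   [k] comes before [j], and in [0, 1] otherwise. *)
pose m (i : 'S_3 * ('I_3 -> int)) (a : 'I_3 + 'I_3 * 'I_3) : int :=
  match a with inl j => i.2 j
  | inr (j, k) => i.2 j - i.2 k - (((i.1^-1)%g k < (i.1^-1)%g j)%N : nat)%:Z end.
apply: (@arrangement_tiles _ _ Vn _ _ f alpha m).
- by move=> i; apply: (place_isometry Vn VE gram); right.
- by case=> [i|[i j]]; [|apply: affine_funB]; exact: coord_affine.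
- move=> x; pose k j := Num.floor (coord o B x j).
  have [s [s1 s2]] := sort3 (fun j => coord o B x j - (k j)%:~R).
  exists (s, k); apply/fP; split=> //=.
    by have /andP[_ /ltW] := floor_itv (coord o B x (s o0)); rewrite intrD /k; lra.
  by have /andP[+ _] := floor_itv (coord o B x (s o2)); rewrite /k; lra.
- move=> [s k] x; rewrite fP /=; set y := fun j => _.
  have cE j : coord o B x j = (k j)%:~R + y ((s^-1)%g j) by rewrite /y permKV addrC subrK.
  split.
    case=> r1 r2 r3 r4; case=> [j|[j j']] /=; rewrite !cE; move: ((s^-1)%g j).
      by apply: ord3P; apply/andP; split; lra.
    move=> a; move: a ((s^-1)%g j'); clear -r1 r2 r3 r4; apply: ord3P; apply: ord3P; rewrite !intrB /=;
      by apply/andP; split; lra.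
  move=> h; have := h (inl (s o0)); have := h (inr (s o0, s o1)); have := h (inr (s o1, s o2)).
  have := h (inl (s o2)); rewrite /= !cE !permK !intrB /=.
  by move=> /andP[? ?] /andP[? ?] /andP[? ?] /andP[? ?]; split; lra.
Qed.

(** An alcove of the affine Weyl group of type B3. Its mirrors are the planes where a coordinate is
    odd or the sum or difference of two coordinates is even. *)
Definition b3_vertex :=
  simplex_vertex [:: 0; vec3 1 0 0; vec3 1 1 1; vec3 1 1 (-1)].
Definition b3_region (y : 'I_3 -> R) : Prop :=
  [/\ y o0 <= 1, y o1 <= y o0, y o2 <= y o1 & - y o1 <= y o2].

Lemma b3_regionP : (forall a, V a = o + b3_vertex a *m B) ->
  forall y, T (pt o B y) <-> b3_region y.
Proof.
move=> VE y.
pose w (a : 'I_4) := [:: 1 - y o0; y o0 - y o1; (y o1 + y o2) / 2; (y o1 - y o2) / 2]`_a.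
have w1 : \sum_a w a = 1 by rewrite sum4E /w /=; field.
have E a : bary V a (pt o B y) = w a.
  apply: (frame_bary Vn VE) => //; apply: ord3P; rewrite sum4E /b3_vertex /w /= !mxE /=; by field.
split=> [/(tetrahedronP Vn) h|[h1 h2 h3 h4]].
  have := h i1; have := h i2; have := h i3; have := h i4; rewrite !E /w /=.
  by move=> *; split; lra.
by apply/(tetrahedronP Vn); apply: ord4_enum; rewrite E /w /=; lra.
Qed.

Theorem b3_tiles : (forall a, V a = o + b3_vertex a *m B) -> q = 0 -> tiles_face_to_face V.
Proof.
move=> VE q0; have U := frame_unit Vn VE.
have RP := b3_regionP VE.
pose f (i : index) := place o B i.1.1 i.1.2 (fun j => 2 * (i.2 j)%:~R).
have fP i x := placeP Vn VE RP i.1.1 i.1.2 (fun j => 2 * (i.2 j)%:~R) x.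
(* The case [i == j] must be neutralised: half of the sum would be the coordinate itself, and its
   integral planes would cut the tiles. *)
pose alpha (a : 'I_3 + ('I_3 * 'I_3 + 'I_3 * 'I_3)) x :=
  match a with inl i => (2^-1) * coord o B x i + (2^-1)
  | inr (inl (i, j)) => if i == j then 0 else 2^-1 * (coord o B x i + coord o B x j)
  | inr (inr (i, j)) => 2^-1 * (coord o B x i - coord o B x j) end.
(* Half the sum or difference of two offsets has the sign given by the offset of larger absolute
   value, which is the earlier one in the order [s]. *)
pose m (i : index) (a : 'I_3 + ('I_3 * 'I_3 + 'I_3 * 'I_3)) : int :=
  let J := (i.1.1^-1)%g in let e j : int := ((i.1.2 j : nat)%:Z) in
  match a with inl j => i.2 j
  | inr (inl (j, k)) => if j == k then 0 else
      i.2 j + i.2 k - (if (J j < J k)%N then e (J j) else e (J k))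
  | inr (inr (j, k)) =>
      i.2 j - i.2 k - (if (J j < J k)%N then e (J j) else 1 - e (J k)) end.
apply: (@arrangement_tiles _ _ Vn _ _ f alpha m).
- by move=> i; apply: (place_isometry Vn VE gram); left.
- case=> [i|[[i j]|[i j]]] /=.
  + apply: affine_funD; last exact: affine_fun_cst.
    by apply: affine_funZ; exact: coord_affine.
  + rewrite /alpha; case: (i == j); first exact: (@affine_fun_cst R 0).
    by apply: affine_funZ; apply: affine_funD; exact: coord_affine.
  + by apply: affine_funZ; apply: affine_funB; exact: coord_affine.
- move=> x; pose k j := Num.floor (2^-1 * coord o B x j + 2^-1).
  pose r j := coord o B x j - 2 * (k j)%:~R.
  have [s [s1 s2]] := sort3 (fun j => `|r j|).
  exists ((s, fun j => r (s j) < 0), k); apply/fP => /=.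
  have E (e : R) : sgn R (e < 0) * e = `|e|.
    rewrite /sgn; case: (ltP e 0) => h /=; first by rewrite expr1 mulN1r ltr0_norm.
    by rewrite expr0 mul1r ger0_norm.
  have r1 j : `|r j| <= 1.
    have := floor_itv (2^-1 * coord o B x j + 2^-1); rewrite -/(k j) intrD /r => /andP[l1 l2].
    by rewrite ler_norml; apply/andP; split; lra.
  split; rewrite -/(r _) ?E //.
  by have := normr_ge0 (r (s o2)); have := normr_ge0 (r (s o1)); lra.
- move=> [[s e] k] x; rewrite fP /=; set y := fun j => _.
  have cE j : coord o B x j = 2 * (k j)%:~R + sgn R (e ((s^-1)%g j)) * y ((s^-1)%g j).
    by rewrite /y mulrA sgnK mul1r permKV addrC subrK.
  split.
    case=> r1 r2 r3 r4.
    have y1 a : -1 <= y a <= 1 by move: a; apply: ord3P; apply/andP; split; lra.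
    have yl (a b : 'I_3) : (a < b)%N -> - y a <= y b <= y a.
      by move: a b; apply: ord3P; apply: ord3P => //= _; apply/andP; split; lra.
    case=> [j|[[j j']|[j j']]] /=; rewrite ?cE.
    + have := y1 ((s^-1)%g j); case: (e _); rewrite /sgn /= ?expr1 ?expr0 => /andP[? ?];
      by apply/andP; split; lra.
    + case: eqP => [_|/eqP jj]; first by apply/andP; split; lra.
      have: (s^-1)%g j != (s^-1)%g j' by rewrite (inj_eq perm_inj).
      rewrite !intrB !intrD; move: ((s^-1)%g j) ((s^-1)%g j') => a b ab.
      have := y1 a; have := y1 b => /andP[b1 b2] /andP[a1 a2].
      have [/yl/andP[l1 l2]|/yl/andP[l1 l2]|/val_inj abE] := ltngtP a b; last by rewrite abE eqxx in ab.
      * clear -a1 a2 b1 b2 l1 l2; case: (e a); case: (e b); rewrite /sgn /= ?expr1 ?expr0; apply/andP; split; lra.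
      * clear -a1 a2 b1 b2 l1 l2; case: (e a); case: (e b); rewrite /sgn /= ?expr1 ?expr0; apply/andP; split; lra.
    + rewrite !intrB; move: ((s^-1)%g j) ((s^-1)%g j') => a b.
      have := y1 a; have := y1 b => /andP[b1 b2] /andP[a1 a2].
      have [/yl/andP[l1 l2]|/yl/andP[l1 l2]|/val_inj ->] := ltngtP a b.
      * clear -a1 a2 b1 b2 l1 l2; case: (e a); case: (e b); rewrite /sgn /= ?intrB ?expr1 ?expr0; apply/andP; split; lra.
      * clear -a1 a2 b1 b2 l1 l2; case: (e a); case: (e b); rewrite /sgn /= ?intrB ?expr1 ?expr0; apply/andP; split; lra.
      * clear -b1 b2; case: (e b); rewrite /sgn /= ?intrB ?expr1 ?expr0; apply/andP; split; lra.
  move=> h.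
  have dom (a b : 'I_3) : (a < b)%N -> - y a <= y b <= y a.
    move=> ab; have ab' : a != b by rewrite neq_ltn ab.
    have := h (inr (inr (s a, s b))); have := h (inr (inl (s a, s b))).
    rewrite /= (inj_eq perm_inj) (negbTE ab') !cE !permK ab !intrB !intrD => /andP[p1 p2] /andP[p3 p4].
    apply/andP; split; move: p1 p2 p3 p4; case: (e a); case: (e b);
      rewrite /sgn /= ?expr1 ?expr0; clear; lra.
  have /andP[d1 d2] := dom o1 o2 isT; have /andP[d3 d4] := dom o0 o1 isT.
  split=> //; have := h (inl (s o0)); rewrite /= !cE permK => /andP[p1 p2].
  by move: p1 p2; case: (e o0); rewrite /sgn /= ?expr1 ?expr0; clear -d3 d4; lra.
Qed.
End ThreeTilings.

(** * Halves of the pyramids over the faces of a cube *)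

Section HalfKuhnTiling.
Variables (R : realType) (V : 'I_4 -> 'rV[R]_3) (o : 'rV[R]_3) (B : 'M[R]_3) (p q : R).
Hypothesis Vn : nondegenerate_tetrahedron V.
Hypothesis gram : forall i j, dotp (row i B) (row j B) = if i == j then p else q.
Let T := tetrahedron V.

(* Half of the cone from the centre of a cube over one of its faces. *)
Definition half_vertex : 'I_4 -> 'rV[R]_3 :=
  simplex_vertex [:: 0; vec3 1 1 1; vec3 1 1 (-1); vec3 1 (-1) (-1)].
Definition half_region (y : 'I_3 -> R) : Prop :=
  [/\ y o0 <= 1, y o1 <= y o0, y o2 <= y o1 & - y o0 <= y o2].

Lemma half_regionP : (forall a, V a = o + half_vertex a *m B) ->
  forall y, T (pt o B y) <-> half_region y.
Proof.
move=> VE y.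
pose w (a : 'I_4) := [:: 1 - y o0; (y o0 + y o2) / 2; (y o1 - y o2) / 2; (y o0 - y o1) / 2]`_a.
have w1 : \sum_a w a = 1 by rewrite sum4E /w /=; field.
have E a : bary V a (pt o B y) = w a.
  by apply: (frame_bary Vn VE) => //; apply: ord3P; rewrite sum4E /half_vertex /w /= !mxE /=; field.
split=> [/(tetrahedronP Vn) h|[h1 h2 h3 h4]].
  have := h i1; have := h i2; have := h i3; have := h i4; rewrite !E /w /=.
  by move=> *; split; lra.
by apply/(tetrahedronP Vn); apply: ord4_enum; rewrite E /w /=; lra.
Qed.

(** The critical case is the adjacent cube, [d = 1], with the positive sign. There the gap is at
    least [2 * (z + 1)], which vanishes only on the common face [z = -1]. For larger [d] the
    quadratic term dominates. *)
Lemma apex_gap_pos (z M : R) (d : int) (e : bool) : 0 < d -> -1 <= z <= 1 -> `|z| <= M -> M <= 1 ->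
  let g := 4 * d%:~R * (z + d%:~R) + M - sgn R e * (z + 2 * d%:~R) in
  0 <= g /\ (g = 0 -> sgn R e * (z + 2 * d%:~R) = M).
Proof.
move=> d0 /andP[z1 z2]; rewrite ler_norml => /andP[zM1 zM2] M1.
have [->|d2] : d = 1 \/ 2 <= d by lia.
  by case: e; rewrite /sgn /= ?expr1 ?expr0; split; lra.
have {d2} : 2 <= d%:~R :> R by rewrite -[2]/(2%:~R) ler_int.
set x := d%:~R => x2.
have xx : 0 <= (x - 2) * (4 * x + 2) by rewrite mulr_ge0; lra.
have zx : 0 <= 4 * x * (z + 1) by rewrite mulr_ge0; lra.
by case: e; rewrite /sgn /= ?expr1 ?expr0; split; nra.
Qed.

(* Crossing a face of a cube costs at least what can be gained by the height of the pyramid. *)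
Lemma apex_gap (z M : R) (d : int) (e : bool) : -1 <= z <= 1 -> `|z| <= M -> M <= 1 ->
  let g := 4 * d%:~R * (z + d%:~R) + M - sgn R e * (z + 2 * d%:~R) in
  0 <= g /\ (g = 0 -> sgn R e * (z + 2 * d%:~R) = M).
Proof.
move=> z1 zM M1; have [d0|d0|->] := ltgtP d 0; last first.
- rewrite /= mulr0z !(mulr0, mul0r, addr0, add0r); split; last lra.
  by move: zM; rewrite ler_norml subr_ge0 => /andP[? ?]; case: e; rewrite /sgn /= ?expr1 ?expr0; lra.
- exact: apex_gap_pos.
have := @apex_gap_pos (- z) M (- d) (~~ e); rewrite oppr_gt0 normrN => /(_ d0).
have -> : -1 <= - z <= 1 by move: z1 => /andP[? ?]; apply/andP; split; lra.
move=> /(_ isT zM M1); rewrite intrN /=; set g := (_ - _); set g' := (_ - _).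
have -> : g = g' by rewrite /g /g'; case: (e); rewrite /sgn /= ?expr1 ?expr0; ring.
by case=> g0 gE; split=> // /gE <-; case: (e); rewrite /sgn /= ?expr1 ?expr0; ring.
Qed.

Lemma norm_two_cubes (z : R) (d : int) : `|z| <= 1 -> `|z + 2 * d%:~R| <= 1 ->
  `|z + 2 * d%:~R| = `|z|.
Proof.
rewrite !ler_norml => /andP[z1 z2] /andP[z3 z4].
have [->|[d1|d1]] : d = 0 \/ (1 <= d \/ d <= -1) by lia.
- by rewrite mulr0z mulr0 addr0.
- have {d1} : 1 <= d%:~R :> R by rewrite -[1]/(1%:~R) ler_int.
  by move=> d1; rewrite [`|z|]ler0_norm ?[LHS]ger0_norm; lra.
- have {d1} : d%:~R <= -1 :> R by rewrite -[-1]/((-1)%:~R) ler_int.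
  by move=> d1; rewrite [`|z|]ger0_norm ?[LHS]ler0_norm; lra.
Qed.

(** The plane of the wall [y o0 + y o2 = 0] cuts other tiles of the same cube, so no arrangement
    will do. Inside a cube the pyramids are instead the domains of linearity of the sup norm of the
    offset from the centre, whose pieces are the functions [apex]. *)
Theorem half_kuhn_tiles : (forall a, V a = o + half_vertex a *m B) -> tiles_face_to_face V.
Proof.
move=> VE; have U := frame_unit Vn VE.
have RP := half_regionP VE.
pose index := (('S_3 * bool) * ('I_3 -> int))%type.
pose f (i : index) := place o B i.1.1 (fun=> i.1.2) (fun j => 2 * (i.2 j)%:~R).
have fP (i : index) x : (f i @` T) x <-> half_region (fun j => sgn R i.1.2 *
    (coord o B x (i.1.1 j) - 2 * (i.2 (i.1.1 j))%:~R)) := placeP Vn VE RP _ _ _ x.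
pose u j x := 2^-1 * coord o B x j + 2^-1.
pose d (a : 'I_3 * 'I_3) x := 2^-1 * (coord o B x a.1 - coord o B x a.2).
pose m (i : index) (a : 'I_3 * 'I_3) : int := let J := (i.1.1^-1)%g in
  i.2 a.1 - i.2 a.2 - (if (J a.1 < J a.2)%N then (i.1.2 : nat)%:Z else 1 - (i.1.2 : nat)%:Z).
pose apex (i : index) x := sgn R i.1.2 * (coord o B x (i.1.1 o0) - 2 * (i.2 (i.1.1 o0))%:~R).
(* The sup norm of the offset has a concave break at the faces of the cubes, where its slope falls
   by 2. The weight 4 restores convexity: the first sum gains 4 in slope there. *)
pose ell (i : index) x :=
  \sum_j 4 * line (i.2 j) (u j x) + \sum_a line (m i a) (d a x) + apex i x.
have tile_norm (i : index) x : (f i @` T) x ->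
    apex i x <= 1 /\ forall j, `|coord o B x j - 2 * (i.2 j)%:~R| <= apex i x.
  pose y j := sgn R i.1.2 * (coord o B x (i.1.1 j) - 2 * (i.2 (i.1.1 j))%:~R).
  move=> /fP[]; rewrite -/(y o0) -/(y o1) -/(y o2) => r1 r2 r3 r4.
  have ayx : apex i x = y o0 by [].
  split=> // j; rewrite ayx -(permKV i.1.1 j); move: ((i.1.1^-1)%g j) => a.
  have -> : `|coord o B x (i.1.1 a) - 2 * (i.2 (i.1.1 a))%:~R| = `|y a|.
    by rewrite /y normrM /sgn normr_sign mul1r.
  by move: a; apply: ord3P; rewrite ler_norml; apply/andP; split; lra.
have tile_d (i : index) x : (f i @` T) x ->
    forall a, (m i a)%:~R <= d a x <= (m i a)%:~R + 1.
  pose y j := sgn R i.1.2 * (coord o B x (i.1.1 j) - 2 * (i.2 (i.1.1 j))%:~R).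
  move=> /fP[]; rewrite -/(y o0) -/(y o1) -/(y o2) => r1 r2 r3 r4 a.
  have cE j : coord o B x j = 2 * (i.2 j)%:~R + sgn R i.1.2 * y ((i.1.1^-1)%g j).
    by rewrite /y mulrA sgnK mul1r permKV addrC subrK.
  rewrite /m /d !cE !intrB; move: ((i.1.1^-1)%g a.1) ((i.1.1^-1)%g a.2) => b c.
  have ymon (b' c' : 'I_3) : (b' <= c')%N -> y c' <= y b' <= y c' + 2.
    by clear -r1 r2 r3 r4; move: b' c'; apply: ord3P; apply: ord3P => //= _; apply/andP; split; lra.
  have [/ltnW/ymon/andP[l1 l2]|/ymon/andP[l1 l2]] := ltnP b c; clear -l1 l2;
    by case: (i.1.2); rewrite /sgn /= ?intrB ?expr1 ?expr0; apply/andP; split; lra.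
have gap (i j : index) x : (f i @` T) x ->
    [/\ ell j x <= ell i x &
     ell j x = ell i x -> (f j @` T) x].
  move=> fx; have [M1 zM] := tile_norm i x fx.
  have z1 l : `|coord o B x l - 2 * (i.2 l)%:~R| <= 1 by exact: le_trans (zM l) M1.
  have uL l : 4 * line (j.2 l) (u l x) <= 4 * line (i.2 l) (u l x)
      ?= iff ((j.2 l)%:~R <= u l x <= (j.2 l)%:~R + 1).
    apply/leifP; have := line_leif (j.2 l) (m' := i.2 l) (s := u l x).
    have -> : (i.2 l)%:~R <= u l x <= (i.2 l)%:~R + 1.
      by move: (z1 l); rewrite ler_norml /u => /andP[? ?]; apply/andP; split; lra.
    by move=> /(_ isT)/leifP; case: ifP => _ h; [rewrite (eqP h) | rewrite ltr_pM2l].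
  have dL : \sum_a line (m j a) (d a x) <= \sum_a line (m i a) (d a x)
      ?= iff [forall a, (m j a)%:~R <= d a x <= (m j a)%:~R + 1].
    by apply: leif_sum => a _; apply: line_leif; exact: tile_d.
  pose l := j.1.1 o0.
  have rL : \sum_(l' | l' != l) 4 * line (j.2 l') (u l' x) <=
      \sum_(l' | l' != l) 4 * line (i.2 l') (u l' x)
      ?= iff [forall (l' | l' != l), (j.2 l')%:~R <= u l' x <= (j.2 l')%:~R + 1].
    by apply: leif_sum => l' _; exact: uL.
  have z1' : -1 <= coord o B x l - 2 * (i.2 l)%:~R <= 1 by rewrite -ler_norml.
  have [g0 gE] := apex_gap (i.2 l - j.2 l) j.1.2 z1' (zM l) M1.
  have zE : coord o B x l - 2 * (i.2 l)%:~R + 2 * (i.2 l - j.2 l)%:~R = coord o B x l - 2 * (j.2 l)%:~R.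
    by rewrite intrB; ring.
  rewrite zE -/(apex j x) in g0 gE.
  have lE : 4 * (i.2 l - j.2 l)%:~R * (coord o B x l - 2 * (i.2 l)%:~R + (i.2 l - j.2 l)%:~R) =
      4 * line (i.2 l) (u l x) - 4 * line (j.2 l) (u l x).
    by rewrite /line /u intrB; field.
  rewrite lE in g0 gE.
  have eE : ell i x - ell j x =
     (\sum_(l' | l' != l) 4 * line (i.2 l') (u l' x) - \sum_(l' | l' != l) 4 * line (j.2 l') (u l' x))
     + (\sum_a line (m i a) (d a x) - \sum_a line (m j a) (d a x))
     + (4 * line (i.2 l) (u l x) - 4 * line (j.2 l) (u l x) + apex i x - apex j x).
    by rewrite /ell (bigD1 l) //= [in X in _ - X](bigD1 l) //=; ring.
  have [[r0 rE] [d0 dE]] := (rL, dL).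
  have key (X Y Z : R) : 0 <= X -> 0 <= Y -> 0 <= Z ->
      0 <= X + Y + Z /\ (X + Y + Z = 0 -> [/\ X = 0, Y = 0 & Z = 0]).
    by move=> X0 Y0 Z0; split=> [|h]; [lra | split; lra].
  have [k0 kE] := key _ _ _ (etrans (subr_ge0 _ _) r0) (etrans (subr_ge0 _ _) d0) g0.
  rewrite -eE in k0 kE.
  split=> [|ee]; first by rewrite -subr_ge0.
  have [|/eqP X0 /eqP Y0 /gE aE] := kE; first by rewrite ee subrr.
  move: X0; rewrite subr_eq0 eq_sym rE => /forall_inP ul.
  move: Y0; rewrite subr_eq0 eq_sym dE => /forallP dl.
  have nm a : `|coord o B x a - 2 * (j.2 a)%:~R| <= apex i x.
    have [->|al] := eqVneq a l.
      have := M1; have := zM l; rewrite -aE; set t := _ - 2 * (j.2 l)%:~R.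
      have -> : apex j x = sgn R j.1.2 * t by [].
      have : 0 <= sgn R j.1.2 * t.
        have -> : sgn R j.1.2 * t = apex i x by rewrite -aE.
        exact: le_trans (normr_ge0 _) (zM l).
      move=> t0 _ _; rewrite -[leLHS]mul1r -(@normr_sign R j.1.2) -normrM ger0_norm //.
    have zaE : coord o B x a - 2 * (j.2 a)%:~R =
        coord o B x a - 2 * (i.2 a)%:~R + 2 * (i.2 a - j.2 a)%:~R by rewrite intrB; ring.
    rewrite zaE norm_two_cubes // -zaE.
    move: (ul a al); rewrite /u => /andP[? ?].
    by rewrite ler_norml; apply/andP; split; lra.
  apply/fP; pose y b := sgn R j.1.2 * (coord o B x (j.1.1 b) - 2 * (j.2 (j.1.1 b))%:~R).
  have cE b : coord o B x b = 2 * (j.2 b)%:~R + sgn R j.1.2 * y ((j.1.1^-1)%g b).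
    by rewrite /y mulrA sgnK mul1r permKV addrC subrK.
  have y0E : y o0 = apex i x by rewrite -aE.
  split; rewrite -/(y o0) -/(y o1) -/(y o2); first by rewrite y0E.
  - have := dl (j.1.1 o0, j.1.1 o1); rewrite /m /d /= !permK /= !cE !permK !intrB => /andP[].
    by case: (j.1.2); rewrite /sgn /= ?intrB ?expr1 ?expr0; lra.
  - have := dl (j.1.1 o1, j.1.1 o2); rewrite /m /d /= !permK /= !cE !permK !intrB => /andP[].
    by case: (j.1.2); rewrite /sgn /= ?intrB ?expr1 ?expr0; lra.
  have := nm (j.1.1 o2); rewrite -y0E.
  have -> : `|coord o B x (j.1.1 o2) - 2 * (j.2 (j.1.1 o2))%:~R| = `|y o2|.
    by rewrite /y normrM /sgn normr_sign mul1r.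
  by rewrite ler_norml => /andP[].
apply: (@tiles_of_support _ _ Vn _ f ell).
- by move=> i; apply: (place_isometry Vn VE gram); right.
- move=> i; apply: affine_funD; last first.
    apply: affine_funZ; apply: affine_funB; [exact: coord_affine | exact: affine_fun_cst].
  apply: affine_funD; apply: affine_fun_bigsum => a.
    apply: affine_funZ; apply: line_affine; apply: affine_funD; last exact: affine_fun_cst.
    by apply: affine_funZ; exact: coord_affine.
  by apply: line_affine; apply: affine_funZ; apply: affine_funB; exact: coord_affine.
- move=> x; pose k j := Num.floor (u j x).
  pose r j := coord o B x j - 2 * (k j)%:~R.
  have [s [s1 s2]] := sort3 (fun j => `|r j|).
  pose e := r (s o0) < 0.
  have E : sgn R e * r (s o0) = `|r (s o0)|.
    rewrite /sgn /e; case: (ltP (r _) 0) => h /=; first by rewrite expr1 mulN1r ltr0_norm.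
    by rewrite expr0 mul1r ger0_norm.
  have r1 j : `|r j| <= 1.
    have := floor_itv (u j x); rewrite -/(k j) intrD /r /u => /andP[l1 l2].
    by rewrite ler_norml; apply/andP; split; lra.
  have N j : `|sgn R e * r j| = `|r j| by rewrite normrM /sgn normr_sign mul1r.
  have P a b : uniq [:: s o0; a; b] -> `|r a| <= `|r (s o0)| -> `|r b| <= `|r (s o0)| ->
      sgn R e * r b <= sgn R e * r a -> exists i, (f i @` T) x.
    move=> /perm_of_uniq3[t [t0 t1 t2]] ra rb ab; exists ((t, e), k); apply/fP => /=.
    move: ra rb; rewrite -(N a) -(N b) !ler_norml => /andP[? ?] /andP[? ?].
    by split=> /=; rewrite ?t0 ?t1 ?t2 -!/(r _) ?E.
  have [h|/ltW h] := leP (sgn R e * r (s o2)) (sgn R e * r (s o1)).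
    by apply: (P (s o1) (s o2)) => //; [rewrite /= !inE !(inj_eq perm_inj) | exact: le_trans s2 s1].
  by apply: (P (s o2) (s o1)) => //; [rewrite /= !inE !(inj_eq perm_inj) | exact: le_trans s2 s1].
- by move=> i j x /(gap i j)[].
- by move=> i j x /(gap i j)[].
Qed.
End HalfKuhnTiling.

(** * Face areas and dihedral angles *)

(** For statements about an edge [ij] and its opposite [kl] that allow exchanging [i], [j] and
    exchanging [k], [l], one labelling per edge is enough. *)
Lemma uniq4_ind (P : 'I_4 -> 'I_4 -> 'I_4 -> 'I_4 -> Prop) :
  (forall i j k l, P i j k l -> P j i k l) -> (forall i j k l, P i j k l -> P i j l k) ->
  P i1 i2 i3 i4 -> P i1 i3 i2 i4 -> P i1 i4 i2 i3 ->
  P i2 i3 i1 i4 -> P i2 i4 i1 i3 -> P i3 i4 i1 i2 ->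
  forall i j k l, uniq [:: i; j; k; l] -> P i j k l.
Proof.
move=> s1 s2 p1 p2 p3 p4 p5 p6.
by apply: ord4_enum; apply: ord4_enum; apply: ord4_enum; apply: ord4_enum => //= _; auto.
Qed.

Section Normals.
Variables (R : realType) (V : 'I_4 -> 'rV[R]_3).
Hypothesis Vn : nondegenerate_tetrahedron V.

Let e2 := V i2 - V i1.
Let e3 := V i3 - V i1.
Let e4 := V i4 - V i1.

(** Normal of the face opposite [k], of length twice its area. All four point inward or all point
    outward, according to the sign of [vol]. *)
Definition normal (k : 'I_4) : 'rV[R]_3 :=
  nth 0 [:: - (cross e3 e4 + cross e4 e2 + cross e2 e3);
            cross e3 e4; cross e4 e2; cross e2 e3] k.
Definition vol : R := triple e2 e3 e4.
Definition farea k := enorm (normal k).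

Lemma vol_neq0 : vol != 0.
Proof.
have l1 : lift ord0 o0 = i2 by exact: val_inj.
have l2 : lift ord0 o1 = i3 by exact: val_inj.
have l3 : lift ord0 o2 = i4 by exact: val_inj.
have l0 : ord0 = i1 by exact: val_inj.
by have := edge_mx_unit Vn; rewrite unitmxE unitfE det_mx33 !rowK l1 l2 l3 l0.
Qed.

Lemma cross_swap (P Q S : 'rV[R]_3) : cross (P - Q) (S - Q) = - cross (Q - P) (S - P).
Proof. by apply: row3P; rewrite !coordE; ring. Qed.

Lemma cross_normal i j k l : uniq [:: i; j; k; l] -> exists e : bool,
  cross (V j - V i) (V k - V i) = (-1) ^+ e *: normal l /\
  cross (V j - V i) (V l - V i) = (-1) ^+ (~~ e) *: normal k.
Proof.
move: i j k l; apply: uniq4_ind.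
- move=> i j k l [e [E1 E2]]; exists (~~ e).
  rewrite cross_swap E1 [cross _ (V l - _)]cross_swap E2 -!scaleNr.
  by case: e {E1 E2}; rewrite !(expr1, expr0, opprK).
- by move=> i j k l [e [E1 E2]]; exists (~~ e); rewrite negbK.
all: rewrite /normal /e2 /e3 /e4 /=.
- by exists false; split; apply: row3P; rewrite /= !coordE; ring.
- by exists true; split; apply: row3P; rewrite /= !coordE; ring.
- by exists false; split; apply: row3P; rewrite /= !coordE; ring.
- by exists false; split; apply: row3P; rewrite /= !coordE; ring.
- by exists true; split; apply: row3P; rewrite /= !coordE; ring.
- by exists false; split; apply: row3P; rewrite /= !coordE; ring.
Qed.

Lemma enorm_sign (e : bool) u : enorm ((-1) ^+ e *: u : 'rV[R]_3) = enorm u.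
Proof. by apply/eq_enorm; rewrite !dotpL mulrA -expr2 sqrr_sign mul1r. Qed.

Lemma edge_neq0 i j k l : uniq [:: i; j; k; l] -> V j - V i != 0.
Proof.
move=> u; rewrite subr_eq0; apply: contraL u => /eqP /(vertex_inj Vn) ->.
by rewrite /= inE eqxx.
Qed.

(** Two normals that both point inward or both outward form the supplement of the dihedral angle,
    whence the sign. *)
Lemma dotp_normal i j k l : uniq [:: i; j; k; l] ->
  dotp (normal k) (normal l) =
  - (cos (dihedral_angle (V i) (V j) (V k) (V l)) * (farea k * farea l)).
Proof.
move=> u; have := cos_dihedral (V k) (V l) (edge_neq0 u).
have [e [-> ->]] := cross_normal u.
rewrite !enorm_sign !dotpL mulrCA mulrA -exprD.
have -> : (-1) ^+ (~~ e + e) = -1 :> R by case: e; rewrite /= ?addn0 ?add0n expr1.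
by rewrite -/(farea k) -/(farea l) mulN1r (dotpC (normal l)) (mulrC (farea k)) => <-; rewrite opprK.
Qed.

Lemma area2_normal i j k l : uniq [:: i; j; k; l] -> area2 (V i) (V j) (V k) = farea l ^+ 2.
Proof.
move=> /cross_normal[e [E _]].
by rewrite /area2 E /farea enorm_sqr !dotpL mulrA -expr2 sqrr_sign mul1r.
Qed.

Lemma normal_sum : normal i1 + normal i2 + normal i3 + normal i4 = 0.
Proof. by rewrite /normal /=; apply: row3P; rewrite !coordE; ring. Qed.

Lemma triple_edges i j k l : uniq [:: i; j; k; l] ->
  triple (V j - V i) (V k - V i) (V l - V i) ^+ 2 = vol ^+ 2.
Proof.
move: i j k l; apply: uniq4_ind; rewrite /vol /e2 /e3 /e4 /triple.
- by move=> i j k l <-; rewrite !dotpE !coordE; ring.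
- by move=> i j k l <-; rewrite !dotpE !coordE; ring.
all: by rewrite !dotpE !coordE; ring.
Qed.

(** The edge spans the intersection of its two face planes: up to sign, the cross product of their
    normals is [vol] times the edge vector. *)
Lemma edge_sqr i j k l : uniq [:: i; j; k; l] ->
  dotp (V j - V i) (V j - V i) * vol ^+ 2 =
  farea k ^+ 2 * farea l ^+ 2 *
    (1 - cos (dihedral_angle (V i) (V j) (V k) (V l)) ^+ 2).
Proof.
move=> u; rewrite -(triple_edges u); have [e [E1 E2]] := cross_normal u.
set x := V j - V i in E1 E2 *; set y := V k - V i in E1 *; set z := V l - V i in E2 *.
have id : dotp x x * triple x y z ^+ 2 = dotp (cross (cross x y) (cross x z)) (cross (cross x y) (cross x z)).
  by rewrite /triple !dotpE !coordE; ring.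
rewrite id dotp_cross E1 E2 !dotpL (dotpC (normal l) (normal k)) (dotp_normal u) /farea -!enorm_sqr.
by case: e {E1 E2}; rewrite /= !(expr1, expr0); ring.
Qed.

Lemma farea_gt0 k : 0 < farea k.
Proof.
rewrite enorm_gt0; apply/eqP => nk; have [i [j [l u]]] : exists i j l, uniq [:: i; j; k; l].
  by move: k {nk}; apply: ord4_enum; [exists i2, i3, i4|exists i1, i3, i4|exists i1, i2, i4|exists i1, i2, i3].
have := triple_edges u; have [e [_ E]] := cross_normal u.
have -> : triple (V j - V i) (V k - V i) (V l - V i) = - dotp (cross (V j - V i) (V l - V i)) (V k - V i).
  by rewrite /triple !dotpE !coordE; ring.
rewrite E nk scaler0 dotp0l oppr0 expr0n /= => /esym/eqP.
by rewrite sqrf_eq0 (negbTE vol_neq0).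
Qed.

Lemma gram3 (u v w : 'rV[R]_3) : triple u v w ^+ 2 =
  dotp u u * dotp v v * dotp w w + 2 * (dotp u v * dotp v w * dotp u w)
  - dotp u u * dotp v w ^+ 2 - dotp v v * dotp u w ^+ 2 - dotp w w * dotp u v ^+ 2.
Proof. by rewrite /triple !dotpE !coordE; ring. Qed.

(** The normals opposite [i2], [i3], [i4] are the rows of a cofactor matrix, whose determinant is
    the square of [vol]. As the four normals sum to zero, any three of them span the same volume. *)
Lemma triple_normal :
  [/\ triple (normal i2) (normal i3) (normal i4) ^+ 2 = vol ^+ 4,
      triple (normal i1) (normal i3) (normal i4) ^+ 2 = vol ^+ 4,
      triple (normal i1) (normal i2) (normal i4) ^+ 2 = vol ^+ 4
    & triple (normal i1) (normal i2) (normal i3) ^+ 2 = vol ^+ 4].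
Proof.
have tN u v w : triple (- u) v w = - triple u v w :> R.
  by rewrite /triple !dotpE !coordE; ring.
have tD u v w x : triple (u + v + w) v x = triple u v x + triple w v x :> R.
  by rewrite /triple !dotpE !coordE; ring.
have E : triple (normal i2) (normal i3) (normal i4) = vol ^+ 2.
  by rewrite /normal /vol /triple /= !dotpE !coordE; ring.
have n1 : normal i1 = - (normal i2 + normal i3 + normal i4).
  by apply/eqP; rewrite -subr_eq0 opprK !addrA normal_sum.
have P (u v w : 'rV[R]_3) : triple (- (u + v + w)) v w = - triple u v w /\
   triple (- (u + v + w)) u w = triple u v w /\ triple (- (u + v + w)) u v = - triple u v w.
  by rewrite /triple !dotpE !coordE; split; [|split]; ring.
have [P1 [P2 P3]] := P (normal i2) (normal i3) (normal i4).
by rewrite n1 P1 P2 P3 !sqrrN E -exprM.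
Qed.

End Normals.

(** Gram determinant of three unit vectors with products [- x], [- y], [- z], such as the unit
    normals of the faces at a vertex. *)
Definition det3 (R : realType) (x y z : R) := 1 - x ^+ 2 - y ^+ 2 - z ^+ 2 - 2 * x * y * z.

Lemma gram3_det3 (R : realType) (u v w : 'rV[R]_3) (a b c x y z : R) :
  dotp u u = a ^+ 2 -> dotp v v = b ^+ 2 -> dotp w w = c ^+ 2 ->
  dotp v w = - (x * (b * c)) -> dotp u w = - (y * (a * c)) -> dotp u v = - (z * (a * b)) ->
  0 < triple u v w ^+ 2 -> 0 < det3 x y z.
Proof.
move=> aE bE cE xE yE zE; rewrite gram3 aE bE cE xE yE zE.
have -> : a ^+ 2 * b ^+ 2 * c ^+ 2 + 2 * (- (z * (a * b)) * - (x * (b * c)) * - (y * (a * c))) -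
  a ^+ 2 * (- (x * (b * c))) ^+ 2 - b ^+ 2 * (- (y * (a * c))) ^+ 2 -
  c ^+ 2 * (- (z * (a * b))) ^+ 2 = (a * b * c) ^+ 2 * det3 x y z by rewrite /det3; ring.
by move=> h; rewrite -(pmulr_rgt0 _ (x := (a * b * c) ^+ 2)) // lt_def sqr_ge0 andbT;
  apply: contraTneq h => ->; rewrite mul0r ltxx.
Qed.

(* The face areas [a k] form a positive null vector of the matrix of the cosines; [c ij] is
   the cosine at the edge [ij], which lies on the two faces opposite to the other vertices. *)
Record tetra_system (R : realType) (c12 c13 c14 c23 c24 c34 a1 a2 a3 a4 : R) : Prop := {
  area1_gt0 : 0 < a1; area2_gt0 : 0 < a2; area3_gt0 : 0 < a3; area4_gt0 : 0 < a4;
  area1E : a1 = c34 * a2 + c24 * a3 + c23 * a4;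
  area2E : a2 = c34 * a1 + c14 * a3 + c13 * a4;
  area3E : a3 = c24 * a1 + c14 * a2 + c12 * a4;
  area4E : a4 = c23 * a1 + c13 * a2 + c12 * a3;
  det3_1 : 0 < det3 c12 c13 c14; det3_2 : 0 < det3 c12 c23 c24;
  det3_3 : 0 < det3 c13 c23 c34; det3_4 : 0 < det3 c14 c24 c34 }.

Section Angles.
Variables (R : realType) (V : 'I_4 -> 'rV[R]_3) (n : 'I_4 -> 'I_4 -> nat).
Hypothesis Vn : nondegenerate_tetrahedron V.
Hypothesis n_gt0 : forall i j : 'I_4, i != j -> (0 < n i j)%N.
Hypothesis angleV : forall i j k l : 'I_4, uniq [:: i; j; k; l] ->
     dihedral_angle (V i) (V j) (V k) (V l) = 2 * pi / (n i j)%:R.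

Definition cosn (m : nat) : R := cos (2 * pi / m%:R).

Lemma dihedral_swap (P Q A B : 'rV[R]_3) : dihedral_angle P Q A B = dihedral_angle Q P A B.
Proof.
have oN u e : orth_part (- e) u = orth_part e u :> 'rV[R]_3.
  by rewrite /orth_part dotpNr dotpNl dotpNr opprK mulNr scalerN scaleNr opprK.
have E C : orth_part (P - Q) (C - Q) = orth_part (Q - P) (C - P).
  have -> : C - Q = (C - P) + (-1) *: (Q - P) by rewrite scaleN1r opprB addrA subrK.
  by rewrite orth_partD orth_partZ -(opprB Q P) !oN orth_part_self scaler0 addr0.
by rewrite /dihedral_angle !E.
Qed.

Lemma uniq4_ex i j : i != j -> exists k l : 'I_4, uniq [:: i; j; k; l].
Proof.
move: i j; apply: ord4_enum; apply: ord4_enum => //= _;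
  by [exists i3, i4|exists i2, i4|exists i2, i3|exists i1, i4|exists i1, i3|exists i1, i2].
Qed.

Lemma n_sym i j : i != j -> n i j = n j i.
Proof.
move=> ij; have [k [l u]] := uniq4_ex ij.
have u' : uniq [:: j; i; k; l].
  by move: u; rewrite /= !inE !negb_or (eq_sym j i) => /and4P[/and3P[-> -> ->] /andP[-> ->] ->].
have := angleV u'; rewrite -dihedral_swap (angleV u).
have pi2 : 2 * pi != 0 :> R by rewrite mulf_neq0 // gt_eqF // pi_gt0.
by move/(mulfI pi2)/invr_inj/eqP; rewrite eqr_nat => /eqP.
Qed.

Lemma normal_cosn i j k l : uniq [:: i; j; k; l] ->
  dotp (normal V k) (normal V l) = - (cosn (n i j) * (farea V k * farea V l)).
Proof. by move=> u; rewrite (dotp_normal Vn u) (angleV u). Qed.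

Lemma edge_sqr_cosn i j k l : uniq [:: i; j; k; l] ->
  dotp (V j - V i) (V j - V i) * vol V ^+ 2 =
  farea V k ^+ 2 * farea V l ^+ 2 * (1 - cosn (n i j) ^+ 2).
Proof. by move=> u; rewrite (edge_sqr Vn u) (angleV u). Qed.

Lemma area_system : tetra_system (cosn (n i1 i2)) (cosn (n i1 i3)) (cosn (n i1 i4))
  (cosn (n i2 i3)) (cosn (n i2 i4)) (cosn (n i3 i4))
  (farea V i1) (farea V i2) (farea V i3) (farea V i4).
Proof.
have a1 := farea_gt0 Vn i1; have a2 := farea_gt0 Vn i2.
have a3 := farea_gt0 Vn i3; have a4 := farea_gt0 Vn i4.
have n34 : dotp (normal V i3) (normal V i4) = _ := @normal_cosn i1 i2 i3 i4 isT.
have n24 : dotp (normal V i2) (normal V i4) = _ := @normal_cosn i1 i3 i2 i4 isT.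
have n23 : dotp (normal V i2) (normal V i3) = _ := @normal_cosn i1 i4 i2 i3 isT.
have n14 : dotp (normal V i1) (normal V i4) = _ := @normal_cosn i2 i3 i1 i4 isT.
have n13 : dotp (normal V i1) (normal V i3) = _ := @normal_cosn i2 i4 i1 i3 isT.
have n12 : dotp (normal V i1) (normal V i2) = _ := @normal_cosn i3 i4 i1 i2 isT.
have nn k : dotp (normal V k) (normal V k) = farea V k ^+ 2 by rewrite enorm_sqr.
have S k : dotp (normal V k) (normal V i1) + dotp (normal V k) (normal V i2)
    + dotp (normal V k) (normal V i3) + dotp (normal V k) (normal V i4) = 0.
  by rewrite -!dotpDr normal_sum dotp0r.
have v4 : 0 < vol V ^+ 4 by rewrite lt_def expf_neq0 ?vol_neq0 //= (exprM _ 2 2) sqr_ge0.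
have [t1 t2 t3 t4] := triple_normal V; rewrite -t1 in v4.
have v2 := v4; rewrite t1 -t2 in v2; have v3 := v4; rewrite t1 -t3 in v3.
have v5 := v4; rewrite t1 -t4 in v5.
split=> //.
- apply: (mulfI (lt0r_neq0 a1)); have := S i1; rewrite nn n12 n13 n14; lra.
- apply: (mulfI (lt0r_neq0 a2)); have := S i2; rewrite nn (dotpC _ (normal V i1)) n12 n23 n24; lra.
- apply: (mulfI (lt0r_neq0 a3)); have := S i3.
  rewrite nn (dotpC _ (normal V i1)) (dotpC _ (normal V i2)) n13 n23 n34; lra.
- apply: (mulfI (lt0r_neq0 a4)); have := S i4.
  rewrite nn (dotpC _ (normal V i1)) (dotpC _ (normal V i2)) (dotpC _ (normal V i3)) n14 n24 n34; lra.
- exact: (gram3_det3 (nn i2) (nn i3) (nn i4) n34 n24 n23).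
- exact: (gram3_det3 (nn i1) (nn i3) (nn i4) n34 n14 n13).
- exact: (gram3_det3 (nn i1) (nn i2) (nn i4) n24 n14 n12).
- exact: (gram3_det3 (nn i1) (nn i2) (nn i3) n23 n13 n12).
Qed.

End Angles.

(** * Spherical triangles at the vertices *)

Section SphericalTriangle.
Variable R : realType.
Implicit Types a b c : nat.
Notation cosn := (@cosn R).

Lemma det3_cos (A B C : R) : det3 (cos A) (cos B) (cos C) =
  - (cos A + cos (B + C)) * (cos A + cos (B - C)).
Proof.
rewrite cosD cosB; have := cos2Dsin2 B; have := cos2Dsin2 C.
set x := cos A; set y := cos B; set z := cos C; set s := sin B; set t := sin C => zt ys.
have t2 : t ^+ 2 = 1 - z ^+ 2 by rewrite -zt; ring.
have s2 : s ^+ 2 = 1 - y ^+ 2 by rewrite -ys; ring.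
transitivity (- (x ^+ 2 + 2 * x * y * z + y ^+ 2 * z ^+ 2 - s ^+ 2 * t ^+ 2)); last by ring.
by rewrite s2 t2 /det3; ring.
Qed.

Lemma ler_cos_pi (x y : R) : 0 <= x -> x <= y -> y <= pi -> cos y <= cos x.
Proof.
move=> x0 xy ypi.
rewrite leNgt ltr_cos ?in_itv /= -?leNgt //; first by apply/andP; split; lra.
by apply/andP; split; lra.
Qed.

Lemma cosn_arg a : (2 < a)%N -> (0 < 2 * pi / a%:R :> R) && (2 * pi / a%:R < pi :> R).
Proof.
move=> a2; have a0 : 0 < a%:R :> R by rewrite ltr0n (ltn_trans _ a2).
have p0 := pi_gt0 R; rewrite divr_gt0 ?mulr_gt0 //= ltr_pdivrMr // mulrC ltr_pM2l //.
by rewrite ltr_nat.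
Qed.

Lemma cosn_le a b : (2 < a <= b)%N -> cosn a <= cosn b.
Proof.
move=> /andP[a2 ab]; have /andP[b0 b1] := cosn_arg (leq_trans a2 ab).
have /andP[a0 a1] := cosn_arg a2; apply: ler_cos_pi; [exact: ltW| |exact: ltW].
rewrite ler_pM2l ?mulr_gt0 ?pi_gt0 // lef_pV2 ?posrE ?ltr0n ?ler_nat //; last exact: ltn_trans a2.
by apply: leq_trans ab; exact: ltn_trans a2.
Qed.

(** For [a = 1] or [a = 2] the cosine is 1 or -1, and the determinant is minus a square. *)
Lemma det3_gt2 a b c : (0 < a)%N -> 0 < det3 (cosn a) (cosn b) (cosn c) -> (2 < a)%N.
Proof.
case: a => [//|[|[|a]]] // _; rewrite /cosn.
  have -> : 2 * pi / 1%:R = pi *+ 2 :> R by rewrite divr1 mulr_natl.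
  rewrite cos2pi /det3; set y := cos _; set z := cos _; have := sqr_ge0 (y + z); nra.
have -> : 2 * pi / 2%:R = pi :> R by field.
by rewrite cospi /det3; set y := cos _; set z := cos _; have := sqr_ge0 (y - z); nra.
Qed.

(** If either inequality fails, both cosine sums in the factorisation [det3_cos] are nonnegative and
    the determinant is not positive. *)
Lemma det3_angles (A B C : R) : 0 < A < pi -> 0 < B < pi -> 0 < C < pi ->
  0 < det3 (cos A) (cos B) (cos C) -> pi < A + B + C /\ B + C < A + pi.
Proof.
move=> /andP[A0 A1] /andP[B0 B1] /andP[C0 C1]; rewrite det3_cos => d.
have cpi x : cos (pi - x) = - cos x :> R by rewrite cosB cospi sinpi mul0r addr0 mulN1r.
have cN x : 0 <= x -> x <= pi - A -> 0 <= cos A + cos x.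
  move=> x0 xA; have : cos (pi - A) <= cos x by apply: ler_cos_pi => //; lra.
  by rewrite cpi; lra.
have cB : B - C <= pi - A -> C - B <= pi - A -> 0 <= cos A + cos (B - C).
  move=> h1 h2; have [h|/ltW h] := leP 0 (B - C); first exact: cN.
  by rewrite -(cosN (B - C)) opprB; apply: cN => //; lra.
have c2 x : cos (pi *+ 2 - x) = cos x :> R by rewrite -(cosN (_ - x)) opprB -(cosD2pi (x - _)) subrK.
split; rewrite ltNge; apply/negP => h.
  have f1 : 0 <= cos A + cos (B + C) by apply: cN; lra.
  have f2 : 0 <= cos A + cos (B - C) by apply: cB; lra.
  by have := mulr_ge0 f1 f2; lra.
have f1 : 0 <= cos A + cos (B + C) by rewrite -(c2 (B + C)); apply: cN; rewrite mulr2n; lra.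
have f2 : 0 <= cos A + cos (B - C) by apply: cB; lra.
by have := mulr_ge0 f1 f2; lra.
Qed.

(** The inequalities of [det3_angles] for the angles [2 pi / a], [2 pi / b], [2 pi / c], with
    denominators cleared. The second is not symmetric; its other forms come from rotating the
    arguments. *)
Definition spherical (a b c : nat) : Prop :=
  (a * b * c < 2 * (a * b + b * c + c * a))%N /\ (2 * a * (b + c) < (a + 2) * (b * c))%N.

Lemma det3_spherical a b c : (2 < a)%N -> (2 < b)%N -> (2 < c)%N ->
  0 < det3 (cosn a) (cosn b) (cosn c) -> spherical a b c.
Proof.
move=> a2 b2 c2 d; have [] := det3_angles (cosn_arg a2) (cosn_arg b2) (cosn_arg c2) d.
have a0 : 0 < a%:R :> R by rewrite ltr0n (ltn_trans _ a2).
have b0 : 0 < b%:R :> R by rewrite ltr0n (ltn_trans _ b2).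
have c0 : 0 < c%:R :> R by rewrite ltr0n (ltn_trans _ c2).
have p0 := pi_gt0 R.
rewrite /spherical -!(ltr_nat R) !(natrM, natrD).
set x := a%:R in a0 *; set y := b%:R in b0 *; set z := c%:R in c0 * => h1 h2.
set pp : R := pi in p0 h1 h2 *; clearbody pp.
have k0 : 0 < x * y * z / pp by rewrite divr_gt0 ?mulr_gt0.
have [nx ny nz np] : [/\ x != 0, y != 0, z != 0 & pp != 0 :> R] by rewrite !gt_eqF.
split.
  have -> : x * y * z = x * y * z / pp * pp by rewrite divfK.
  have -> : 2 * (x * y + y * z + z * x) =
    x * y * z / pp * (2 * pp / x + 2 * pp / y + 2 * pp / z) by field; rewrite ?nx ?ny ?nz ?np.
  by rewrite ltr_pM2l.
have -> : 2 * x * (y + z) = x * y * z / pp * (2 * pp / y + 2 * pp / z).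
  by field; rewrite ?nx ?ny ?nz ?np.
have -> : (x + 2) * (y * z) = x * y * z / pp * (2 * pp / x + pp) by field; rewrite ?nx ?ny ?nz ?np.
by rewrite ltr_pM2l.
Qed.

End SphericalTriangle.

(** * Taylor bounds for the cosine *)

Section Taylor.
Variable R : realType.

Lemma ge0_of_derive (f f' : R -> R) : (forall x : R, is_derive x 1 f (f' x)) ->
  (forall x, 0 <= x -> 0 <= f' x) -> f 0 = 0 -> forall x, 0 <= x -> 0 <= f x.
Proof.
move=> fd f0' f0 x x0.
have [|c] := @MVT_segment R f f' 0 x x0 (fun y _ => fd y).
  by apply: derivable_within_continuous => y _; exact: (@ex_derive _ _ _ _ _ _ _ (fd y)).
rewrite in_itv /= f0 !subr0 => /andP[c0 _] ->.
by rewrite mulr_ge0 // f0'.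
Qed.

Definition cosP (N : nat) : {poly R} := \sum_(k < N) ((-1) ^+ k / (2 * k)`!%:R) *: 'X^(2 * k).
Definition sinP (N : nat) : {poly R} := \sum_(k < N) ((-1) ^+ k / (2 * k).+1`!%:R) *: 'X^((2 * k).+1).

Lemma sinP_deriv N : (sinP N)^`() = cosP N.
Proof.
rewrite /sinP /cosP raddf_sum /=; apply: eq_bigr => k _.
rewrite derivZ derivXn /= -scalerMnr scalerMnl; congr (_ *: _).
rewrite -mulr_natr factS natrM invfM mulrA mulrAC mulfVK //; exact: (lt0r_neq0 (ltr0Sn _ _)).
Qed.

Lemma cosP_deriv N : (cosP N.+1)^`() = - sinP N.
Proof.
rewrite /sinP /cosP big_ord_recl raddfD raddf_sum /= derivZ muln0 derivXn /= mulr0n scaler0 add0r.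
rewrite -sumrN; apply: eq_bigr => k _; rewrite /bump leq0n add1n.
rewrite derivZ derivXn mulnS add2n /= -scalerMnr scalerMnl -scaleNr; congr (_ *: _).
rewrite -mulr_natr factS natrM invfM mulrA mulrAC mulfVK; last exact: (lt0r_neq0 (ltr0Sn _ _)).
by rewrite exprS mulN1r mulNr.
Qed.

Lemma cosP0 N : (cosP N.+1).[0] = 1.
Proof.
rewrite /cosP horner_sum big_ord_recl /= muln0 expr0 fact0 divr1 scale1r hornerXn expr0.
rewrite big1 ?addr0 // => k _; rewrite hornerZ hornerXn.
by rewrite expr0n mulr0.
Qed.

Lemma sinP0 N : (sinP N).[0] = 0.
Proof.
by rewrite /sinP horner_sum big1 // => k _; rewrite hornerZ hornerXn expr0n mulr0.
Qed.

(** Starting from [cos x <= 1], each inequality is the derivative of the next one. *)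
Lemma taylor_bounds N : (forall x, 0 <= x -> 0 <= (-1) ^+ N.+1 * (cos x - (cosP N.+1).[x])) /\
  (forall x, 0 <= x -> 0 <= (-1) ^+ N.+1 * (sin x - (sinP N.+1).[x])).
Proof.
have sin_of_cos M : (forall x, 0 <= x -> 0 <= (-1) ^+ M * (cos x - (cosP M).[x])) ->
    forall x, 0 <= x -> 0 <= (-1) ^+ M * (sin x - (sinP M).[x]).
  move=> H; apply: ge0_of_derive H _; last by rewrite sin0 sinP0 subrr mulr0.
  move=> x; rewrite -sinP_deriv; apply: is_derive_eq; rewrite /GRing.scale /=; ring.
elim: N => [|N [_ IH]].
  suff H x : 0 <= x -> 0 <= (-1) ^+ 1 * (cos x - (cosP 1).[x]) by split=> //; exact: sin_of_cos.
  have -> : (cosP 1).[x] = 1 by rewrite /cosP big_ord1 hornerZ hornerXn muln0 !expr0 fact0 divr1 mulr1.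
  by move=> _; have := cos_le1 x; lra.
suff H x : 0 <= x -> 0 <= (-1) ^+ N.+2 * (cos x - (cosP N.+2).[x]) by split=> //; exact: sin_of_cos.
apply: (@ge0_of_derive (fun x => (-1) ^+ N.+2 * (cos x - (cosP N.+2).[x])) _ _ IH).
  move=> y; apply: is_derive_eq; rewrite cosP_deriv hornerN exprS /GRing.scale /=; ring.
by rewrite cos0 cosP0 subrr mulr0.
Qed.

(** Horner scheme of the cosine series in [y = x ^ 2]. The innermost [h] stands for the tail: its
    values 0 and 1 give consecutive partial sums, which enclose the cosine. *)
Fixpoint hcos (N j : nat) (y h : R) : R :=
  if N is N'.+1 then 1 - y / ((2 * j).+1 * (2 * j).+2)%:R * hcos N' j.+1 y h else h.

Lemma hcos_last N j y : hcos N j y 1 = hcos N.+1 j y 0.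
Proof. by elim: N j => [|N IH] j /=; [rewrite mulr0 subr0 | rewrite IH]. Qed.

Lemma hcosE N j y : hcos N j y 0 = \sum_(k < N) (- y) ^+ k * ((2 * j)`!%:R / (2 * (j + k))`!%:R).
Proof.
elim: N j => [|N IH] j; first by rewrite big_ord0.
have fn0 m : m`!%:R != 0 :> R by rewrite pnatr_eq0 -lt0n fact_gt0.
rewrite big_ord_recl /= addn0 expr0 divff // mul1r IH -mulNr mulr_sumr; congr (_ + _).
apply: eq_bigr => k _; rewrite /bump leq0n add1n addSnnS exprS.
have -> : (2 * j.+1)`! = ((2 * j).+1 * (2 * j).+2 * (2 * j)`!)%N.
  by rewrite mulnS add2n !factS mulnA (mulnC (2 * j).+2).
set q := ((2 * j).+1 * (2 * j).+2)%N; rewrite natrM.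
have q0 : q%:R != 0 :> R by rewrite pnatr_eq0 muln_eq0.
set a := (2 * j)`!%:R; set b := (2 * (j + k.+1))`!%:R; have b0 : b != 0 by exact: fn0.
by field; rewrite q0 b0.
Qed.

Lemma cosP_hcos N x : (cosP N).[x] = hcos N 0 (x ^+ 2) 0.
Proof.
rewrite hcosE /cosP horner_sum; apply: eq_bigr => k _.
by rewrite hornerZ hornerXn muln0 fact0 add0n [in RHS]exprNn -exprM mul1r mulrAC.
Qed.

Lemma cos_enclosure N x l u : 0 <= x ->
  (forall h, 0 <= h <= 1 -> l <= hcos N.+1 0 (x ^+ 2) h <= u) -> l <= cos x <= u.
Proof.
move=> x0 H; have [b1 _] := taylor_bounds N; have [b2 _] := taylor_bounds N.+1.
have := b1 x x0; have := b2 x x0; rewrite !cosP_hcos -hcos_last [(-1) ^+ N.+2]exprS mulN1r mulNr.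
have := H 0; have := H 1; rewrite !lexx ler01 => /(_ isT)/andP[p1 p2] /(_ isT)/andP[p3 p4].
by rewrite -signr_odd; case: (odd _); rewrite ?expr1 ?expr0 => q1 q2; apply/andP; split; lra.
Qed.

End Taylor.

(* Locked: unfolding a large literal would produce a unary number. *)
HB.lock Definition ZR (R : realType) (z : Z) : R := (int_of_Z z)%:~R.

Section ZR.
Variable R : realType.
Notation ZR := (@ZR R).
Lemma ZRE z : ZR z = (int_of_Z z)%:~R. Proof. by rewrite unlock. Qed.
Lemma ZRD a b : ZR (Z.add a b) = ZR a + ZR b.
Proof. by rewrite !ZRE -intrD; congr (_%:~R); lia. Qed.
Lemma ZRB a b : ZR (Z.sub a b) = ZR a - ZR b.
Proof. by rewrite !ZRE -intrB; congr (_%:~R); lia. Qed.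
Lemma ZRM a b : ZR (Z.mul a b) = ZR a * ZR b.
Proof. by rewrite !ZRE -intrM; congr (_%:~R); lia. Qed.
Lemma ZR_nat (a : nat) : ZR (Z.of_nat a) = a%:R.
Proof. by rewrite !ZRE (_ : int_of_Z _ = a%:Z) //; lia. Qed.
Lemma ZR_le a b : Z.leb a b -> ZR a <= ZR b.
Proof. by rewrite !ZRE ler_int; lia. Qed.
Lemma ZR_lt a b : Z.ltb a b -> ZR a < ZR b.
Proof. by rewrite !ZRE ltr_int; lia. Qed.
Lemma ZR_ltE a b : (ZR a < ZR b) = Z.ltb a b.
Proof. by rewrite !ZRE ltr_int; lia. Qed.
Lemma ZR1 : ZR (Zpos xH) = 1. Proof. by rewrite ZRE. Qed.
Lemma ZR0 : ZR Z0 = 0. Proof. by rewrite ZRE. Qed.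
Lemma ZR_div a b : Z.ltb Z0 b -> ZR (Z.div a b) * ZR b <= ZR a < (ZR (Z.div a b) + 1) * ZR b.
Proof.
move=> b0; have := Z.mul_div_le a b; have := Z.mul_succ_div_gt a b => h1 h2.
rewrite -ZR1 -ZRD -!ZRM; apply/andP; split; [apply: ZR_le | apply: ZR_lt]; lia.
Qed.
End ZR.

(** * Rational enclosures of the cosines *)

Local Open Scope Z_scope.
Definition scale : Z := 1000000000000.
(* Bounds on [pi ^ 2], in units of [1 / scale]. *)
Definition pi2_lo : Z := 9869604401024.
Definition pi2_hi : Z := 9869604401152.
(** Interval version of [hcos] in units of [1 / scale], started with the whole range [0, 1] of [h].
    The flag records that the lower bounds stay nonnegative, so that products of bounds are bounds
    of products. The final -1 compensates the rounding of [Z.div]. *)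
Fixpoint hcosZ (N : nat) (j yl yh : Z) : bool * Z * Z :=
  if N is N'.+1 then
    let: (b, hl, hh) := hcosZ N' (Z.add j 1) yl yh in
    let m := Z.mul scale (Z.mul (Z.add (Z.mul 2 j) 1) (Z.add (Z.mul 2 j) 2)) in
    (b && Z.leb 0 hl, Z.sub (Z.sub scale (Z.div (Z.mul yh hh) m)) 1,
     Z.sub scale (Z.div (Z.mul yl hl) m))
  else (true, 0, scale).

Lemma hcosZS N j yl yh : hcosZ N.+1 j yl yh =
  let: (b, hl, hh) := hcosZ N (Z.add j 1) yl yh in
  let m := Z.mul scale (Z.mul (Z.add (Z.mul 2 j) 1) (Z.add (Z.mul 2 j) 2)) in
  (b && Z.leb 0 hl, Z.sub (Z.sub scale (Z.div (Z.mul yh hh) m)) 1,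
   Z.sub scale (Z.div (Z.mul yl hl) m)).
Proof. by []. Qed.
(** Lower end of an enclosure of [(pi / 2) ^ 2], the first zero of the cosine as a function of the
    square of its argument. *)
Definition quarter_lo : Z := 2467401100256.
Definition quarter_hi : Z := 2467401100288.
Local Close Scope Z_scope.

Section Enclosure.
Variable R : realType.
Notation ZR := (@ZR R).

Lemma scale_gt0 : 0 < ZR scale.
Proof. by have := @ZR_lt R Z0 scale isT; rewrite ZR0. Qed.

Lemma hcosZ_correct N j yl yh y h : 0 <= h <= 1 -> Z.leb Z0 yl ->
  ZR yl <= y * ZR scale <= ZR yh ->
  let: (b, hl, hh) := hcosZ N (Z.of_nat j) yl yh in
  b -> ZR hl <= hcos N j y h * ZR scale <= ZR hh.
Proof.
move=> /andP[h0 h1] yl0 /andP[y1 y2]; elim: N j => [|N IH] j.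
  move=> _; rewrite ZR0 [hcos _ _ _ _]/=.
  have s0 := scale_gt0.
  apply/andP; split.
    exact: mulr_ge0 h0 (ltW s0).
  by rewrite ler_piMl // ltW.
rewrite hcosZS [hcos _ _ _ _]/=; have := IH j.+1; have -> : Z.of_nat j.+1 = Z.add (Z.of_nat j) (Zpos xH) by lia.
case: (hcosZ N _ yl yh) => [[b hl] hh] H; cbv beta iota zeta => /andP[bT hl0].
have /andP[{H bT}l1 l2] := H bT.
set m := Z.mul _ (Z.mul _ _); set q := ((2 * j).+1 * (2 * j).+2)%N.
have mE : ZR m = ZR scale * q%:R.
  rewrite /m ZRM; congr (_ * _); rewrite -ZR_nat; congr (ZR _); rewrite /q; lia.
have q0 : 0 < q%:R :> R by rewrite ltr0n muln_gt0.
have s0 := scale_gt0.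
have m0 : Z.ltb Z0 m by rewrite -(ZR_ltE R) ZR0 mE mulr_gt0.
set s := ZR scale in s0 mE y1 y2 l1 l2 *.
set g := hcos N j.+1 y h in l1 l2 *.
have g0 : 0 <= ZR hl by rewrite -ZR0; exact: ZR_le.
have yl0' : 0 <= ZR yl by rewrite -ZR0; exact: ZR_le.
have e1 : ZR yl * ZR hl <= y * g * s * s.
  by rewrite (_ : y * g * s * s = (y * s) * (g * s)); [apply: ler_pM | ring].
have e2 : y * g * s * s <= ZR yh * ZR hh.
  rewrite (_ : y * g * s * s = (y * s) * (g * s)); last ring.
  by apply: ler_pM => //; [exact: le_trans y1 | exact: le_trans l1].
have E : (1 - y / q%:R * g) * s = s - y * g * s * s / (s * q%:R).
  by field; rewrite !lt0r_neq0.
rewrite E !ZRB ZR1 -/s.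
have sq : 0 < s * q%:R by rewrite mulr_gt0.
have /andP[d1 d2] := @ZR_div R (Z.mul yl hl) m m0.
have /andP[d3 d4] := @ZR_div R (Z.mul yh hh) m m0.
rewrite mE !ZRM in d1 d2 d3 d4.
apply/andP; split.
  suff : y * g * s * s / (s * q%:R) <= ZR (Z.div (Z.mul yh hh) m) + 1 by lra.
  by rewrite ler_pdivrMr //; apply: ltW; apply: le_lt_trans d4.
suff : ZR (Z.div (Z.mul yl hl) m) <= y * g * s * s / (s * q%:R) by lra.
by rewrite ler_pdivlMr //; apply: le_trans e1.
Qed.

(** Ten terms suffice: up to [pi / 2] the first omitted one, [x ^ 20 / 20!], is far below
    [1 / scale]. *)
Lemma cosZ_correct x yl yh : 0 <= x -> Z.leb Z0 yl ->
  ZR yl <= x ^+ 2 * ZR scale <= ZR yh ->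
  let: (b, hl, hh) := hcosZ 10 Z0 yl yh in
  b -> ZR hl <= cos x * ZR scale <= ZR hh.
Proof.
move=> x0 yl0 yy; have H h (hh : 0 <= h <= 1) := hcosZ_correct 10 0 hh yl0 yy.
move: H; rewrite -[Z.of_nat 0]/Z0; case: (hcosZ 10 Z0 yl yh) => [[b hl] hh] H bT.
have s0 := scale_gt0.
have : ZR hl / ZR scale <= cos x <= ZR hh / ZR scale.
  apply: (cos_enclosure (N := 9)) => // h h01.
  by rewrite ler_pdivrMr // ler_pdivlMr //; exact: H.
by rewrite ler_pdivrMr // ler_pdivlMr.
Qed.

Lemma pi2_bounds : ZR pi2_lo < pi ^+ 2 * ZR scale < ZR pi2_hi.
Proof.
have s0 := scale_gt0; have p1 := pihalf_ge1 R; have p2 := pihalf_lt2 R.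
have root (q : Z) : Z.leb Z0 q -> let x := Num.sqrt (ZR q / ZR scale) in
    0 <= x /\ x ^+ 2 * ZR scale = ZR q.
  move=> q0 x; have q0' : 0 <= ZR q by rewrite -ZR0; exact: ZR_le.
  by split; [exact: sqrtr_ge0 | rewrite sqr_sqrtr ?divfK ?gt_eqF // divr_ge0 // ltW].
have [l0 lE] := root quarter_lo isT; have [u0 uE] := root quarter_hi isT.
set l := Num.sqrt _ in l0 lE; set u := Num.sqrt _ in u0 uE.
have cl := @cosZ_correct l quarter_lo quarter_lo l0 isT; rewrite lE lexx in cl.
have cu := @cosZ_correct u quarter_hi quarter_hi u0 isT; rewrite uE lexx in cu.
have cl0 : 0 < cos l.
  move/(_ isT): cl; have : let: (b, hl, _) := hcosZ 10 Z0 quarter_lo quarter_lo in b && Z.ltb Z0 hl.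
    by vm_compute.
  case: (hcosZ _ _ _ _) => [[b hl] hh] /andP[bT hl0] /(_ bT)/andP[c1 _].
  by rewrite -(pmulr_lgt0 _ s0); apply: lt_le_trans c1; rewrite -ZR0; exact: ZR_lt.
have cu0 : cos u < 0.
  move/(_ isT): cu; have : let: (b, _, hh) := hcosZ 10 Z0 quarter_hi quarter_hi in b && Z.ltb hh Z0.
    by vm_compute.
  case: (hcosZ _ _ _ _) => [[b hl] hh] /andP[bT hh0] /(_ bT)/andP[_ c1].
  by rewrite -(pmulr_llt0 _ s0); apply: le_lt_trans c1 _; rewrite -ZR0; exact: ZR_lt.
have four : ZR (Zpos 4) = 4 by rewrite ZRE.
have pihalf_le_pi : pi / 2 <= pi :> R by have := pi_gt0 R; lra.
(* This keeps [l] below [pi], in the range where the cosine decreases. *)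
have l2 : l < 2.
  have : ZR quarter_lo < 4 * ZR scale by rewrite -four -ZRM; exact: ZR_lt.
  by rewrite -lE ltr_pM2r // => h; have := sqr_ge0 (l - 2); nra.
have ll : l < pi / 2.
  rewrite ltNge; apply/negP => h; have := ler_cos_pi (divr_ge0 (pi_ge0 R) (ler0n _ 2)) h.
  by rewrite cos_pihalf => /(_ (le_trans (ltW l2) (pi_ge2 R))); rewrite leNgt cl0.
have uu : pi / 2 < u.
  rewrite ltNge; apply/negP => h; have := ler_cos_pi u0 h pihalf_le_pi.
  by rewrite cos_pihalf leNgt cu0.
have -> : ZR pi2_lo = 4 * (l ^+ 2 * ZR scale) by rewrite lE -four -ZRM; congr (ZR _); vm_compute.
have -> : ZR pi2_hi = 4 * (u ^+ 2 * ZR scale) by rewrite uE -four -ZRM; congr (ZR _); vm_compute.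
rewrite (mulrA 4 (l ^+ 2)) (mulrA 4 (u ^+ 2)) !ltr_pM2r //.
have p0 : 0 < pi / 2 :> R by rewrite divr_gt0 ?pi_gt0.
have E (x : R) : x ^+ 2 = 4 * (x / 2) ^+ 2 by field.
rewrite (E pi).
by rewrite !ltr_pM2l // !ltr_pXn2r ?nnegrE ?(ltW p0) // ll uu.
Qed.

End Enclosure.

(** * Algebraic values of the cosine *)

Section SpecialCosines.
Variable R : realType.
Notation cosn := (@cosn R).

Lemma cos_double (x : R) : cos (x + x) = 2 * cos x ^+ 2 - 1.
Proof.
by rewrite cosD -!expr2; have := cos2Dsin2 x; lra.
Qed.

Lemma cos_triple (x : R) : cos (x + x + x) = 4 * cos x ^+ 3 - 3 * cos x.
Proof.
rewrite cosD cos_double sinD; have := cos2Dsin2 x.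
set c := cos x; set s := sin x => cs.
have s2 : s ^+ 2 = 1 - c ^+ 2 by rewrite -cs; ring.
transitivity ((2 * c ^+ 2 - 1) * c - 2 * c * s ^+ 2); first ring.
by rewrite s2; ring.
Qed.

Lemma cosn1_lt n : (2 < n)%N -> -1 < cosn n < 1.
Proof.
move=> n2; have /andP[a0 a1] := cosn_arg R n2.
have p0 := pi_gt0 R.
apply/andP; split; [rewrite -(cospi R) | rewrite -(cos0 R)]; rewrite ltr_cos ?in_itv //=;
  by apply/andP; split; lra.
Qed.

Lemma cosn_gt0 n : (4 < n)%N -> 0 < cosn n.
Proof.
move=> n4; have n2 : (2 < n)%N by exact: ltn_trans n4.
have /andP[a0 a1] := cosn_arg R n2; apply: cos_gt0_pihalf; apply/andP; split.
  by apply: lt_trans a0; rewrite oppr_lt0 divr_gt0 ?pi_gt0.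
rewrite (_ : 2 * pi / n%:R = pi * (2 / n%:R)); last by rewrite mulrA (mulrC pi).
rewrite ltr_pM2l ?pi_gt0 // ltr_pdivrMr ?ltr0n ?(ltn_trans _ n2) //.
by rewrite mulrC ltr_pdivlMr // -natrM ltr_nat.
Qed.

Lemma cosn3 : cosn 3 = - 2^-1.
Proof.
have /andP[_ c1] := @cosn1_lt 3 isT.
have E (x : R) : 2 * x / 3%:R + 2 * x / 3%:R + 2 * x / 3%:R = x *+ 2 by rewrite mulr2n; field.
have := cos_triple (2 * pi / 3%:R); rewrite E cos2pi -/(cosn 3).
set c := cosn 3 in c1 * => h.
have : (c - 1) * (2 * c + 1) ^+ 2 = 0.
  by transitivity (4 * c ^+ 3 - 3 * c - 1); [ring | rewrite -h subrr].
by move/eqP; rewrite mulf_eq0 sqrf_eq0 subr_eq0 lt_eqF //= => /eqP; lra.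
Qed.

Lemma cosn4 : cosn 4 = 0.
Proof.
by rewrite /cosn (_ : 2 * pi / 4%:R = pi / 2) ?cos_pihalf //; move: (pi : R) => x; field.
Qed.

Lemma cosn6 : cosn 6 = 2^-1.
Proof.
have c0 := @cosn_gt0 6 isT.
have E (x : R) : 2 * x / 6%:R + 2 * x / 6%:R + 2 * x / 6%:R = x by field.
have := cos_triple (2 * pi / 6%:R); rewrite E cospi -/(cosn 6).
set c := cosn 6 in c0 * => h.
have : (c + 1) * (2 * c - 1) ^+ 2 = 0.
  by transitivity (4 * c ^+ 3 - 3 * c - (-1)); [ring | rewrite -h subrr].
move/eqP; rewrite mulf_eq0 sqrf_eq0 gt_eqF /=; last by lra.
by move/eqP; lra.
Qed.

Lemma cosn8 : cosn 8 ^+ 2 = 2^-1.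
Proof.
have E (x : R) : 2 * x / 8%:R + 2 * x / 8%:R = x / 2 by field.
by have := cos_double (2 * pi / 8%:R); rewrite E cos_pihalf -/(cosn 8); lra.
Qed.

(** With [x = pi / 5] one has [3 x = pi - 2 x]; after removing the factor [c + 1], the formulas for
    double and triple angles give [4 c ^ 2 = 2 c + 1]. *)
Lemma cosn10 : cosn 10 = cosn 5 + 2^-1.
Proof.
have c0 := @cosn_gt0 10 isT.
have E2 (x : R) : 2 * x / 10%:R + 2 * x / 10%:R = 2 * x / 5%:R by field.
have E3 (x : R) : 2 * x / 10%:R + 2 * x / 10%:R + 2 * x / 10%:R = x - 2 * x / 5%:R by field.
have := cos_triple (2 * pi / 10%:R); have := cos_double (2 * pi / 10%:R).
rewrite E3 E2 cosB cospi sinpi mul0r addr0 mulN1r -/(cosn 10) -/(cosn 5).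
set c := cosn 10 in c0 *; set d := cosn 5 => h2 h3.
have : (c + 1) * (4 * c ^+ 2 - 2 * c - 1) = 0.
  by transitivity (4 * c ^+ 3 - 3 * c + (2 * c ^+ 2 - 1)); [ring | rewrite -h2 -h3 addNr].
by move/eqP; rewrite mulf_eq0 gt_eqF /=; [move/eqP; lra | lra].
Qed.

Lemma cosn5 : 4 * cosn 5 ^+ 2 = 1 - 2 * cosn 5.
Proof.
have E2 (x : R) : 2 * x / 10%:R + 2 * x / 10%:R = 2 * x / 5%:R by field.
have := cos_double (2 * pi / 10%:R); rewrite E2 -/(cosn 10) -/(cosn 5) cosn10.
by lra.
Qed.

End SpecialCosines.

Local Open Scope Z_scope.
(** The rational cosines get one-point intervals, so that rounding does not spoil the Farkas tests
    that hold with equality. *)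
Definition cosn_itv (n : nat) : Z * Z :=
  if n == 3%N then (-500000000000, -500000000000)
  else if n == 4%N then (0, 0)
  else if n == 6%N then (500000000000, 500000000000)
  else let q := Z.mul (Z.of_nat n) (Z.of_nat n) in
    let: (b, l, h) := hcosZ 10 0 (Z.div (Z.mul 4 pi2_lo) q) (Z.add (Z.div (Z.mul 4 pi2_hi) q) 1) in
    if b then (l, h) else (Z.opp scale, scale).
Local Close Scope Z_scope.

Section CosineTable.
Variable R : realType.
Notation ZR := (@ZR R).

Lemma ZR_opp z : ZR (Z.opp z) = - ZR z.
Proof. by rewrite !ZRE -intrN; congr (_%:~R); lia. Qed.

Lemma cosn_itvP n : (2 < n)%N ->
  ZR (cosn_itv n).1 <= cosn R n * ZR scale <= ZR (cosn_itv n).2.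
Proof.
move=> n2; have s0 := scale_gt0 R; have ZR2 : ZR (Zpos 2) = 2 by rewrite ZRE.
rewrite /cosn_itv; case: eqP => [->|_].
  set h := (X in (X, X)); rewrite cosn3 -[scale]/(Z.opp (Z.mul (Zpos 2) h)) ZR_opp ZRM ZR2.
  by apply/andP; split; lra.
case: eqP => [->|_]; first by rewrite cosn4 mul0r ZR0 lexx.
case: eqP => [->|_].
  set h := (X in (X, X)); rewrite cosn6 -[scale]/(Z.mul (Zpos 2) h) ZRM ZR2.
  by apply/andP; split; lra.
set q := Z.mul (Z.of_nat n) _; have qE : ZR q = n%:R ^+ 2 by rewrite ZRM ZR_nat expr2.
have n0 : 0 < n%:R :> R by rewrite ltr0n (ltn_trans _ n2).
have q0 : 0 < ZR q by rewrite qE exprn_gt0.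
have q0' : Z.ltb Z0 q by rewrite -(ZR_ltE R) ZR0.
set yl := Z.div _ _; set yh := Z.add _ _.
have yl0 : Z.leb Z0 yl by apply/Z.leb_le; apply: Z.div_pos; [vm_compute | exact/Z.ltb_lt].
have /andP[x0 _] := cosn_arg R n2.
have xE : (2 * pi / n%:R) ^+ 2 * ZR scale = 4 * (pi ^+ 2 * ZR scale) / ZR q.
  rewrite qE; move: (pi : R) (ZR scale) => p s; by field; rewrite gt_eqF.
have /andP[p1 p2] := pi2_bounds R.
have ZR4 : ZR (Zpos 4) = 4 by rewrite ZRE.
have := cosZ_correct (ltW x0) yl0 (yh := yh); rewrite xE.
have -> : ZR yl <= 4 * (pi ^+ 2 * ZR scale) / ZR q <= ZR yh.
  have /andP[d1 _] := ZR_div R (Z.mul (Zpos 4) pi2_lo) q0'.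
  have /andP[_ d2] := ZR_div R (Z.mul (Zpos 4) pi2_hi) q0'.
  rewrite ZRM ZR4 in d1; rewrite ZRM ZR4 in d2.
  rewrite ler_pdivlMr // ler_pdivrMr // /yh ZRD ZR1; apply/andP; split.
    by apply: le_trans d1 _; lra.
  by apply: ltW; apply: lt_trans d2; lra.
move=> /(_ isT); case: (hcosZ _ _ _ _) => [[b l] h]; case: b => [/(_ isT)//|_]; cbv beta iota delta [fst snd].
have /andP[c1 c2] := cosn1_lt R n2.
by rewrite ZR_opp; apply/andP; split; nra.
Qed.

End CosineTable.

(** * Branch and bound *)

Definition cos_table : seq (Z * Z) := Eval vm_compute in [seq cosn_itv n | n <- iota 0 50].
Lemma cos_tableE n : (n < 50)%N -> nth (Z0, Z0) cos_table n = cosn_itv n.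
Proof.
have -> : cos_table = [seq cosn_itv n | n <- iota 0 50] by vm_compute.
by move=> n50; rewrite (nth_map 0%N) ?size_iota // nth_iota.
Qed.

(** Twenty labelled sextuples for eleven types, because the normalisation in [tighten] does not
    single out one labelling. *)
Definition accepted : seq (seq nat) := [::
  [:: 3; 4; 5; 10; 6; 6];
  [:: 3; 5; 5; 10; 10; 4];
  [:: 3; 5; 10; 10; 6; 4];
  [:: 3; 6; 6; 8; 8; 4];
  [:: 3; 6; 10; 10; 10; 3];
  [:: 4; 4; 4; 5; 6; 10];
  [:: 4; 4; 4; 5; 10; 6];
  [:: 4; 4; 4; 6; 5; 10];
  [:: 4; 4; 4; 6; 6; 8];
  [:: 4; 4; 4; 6; 8; 6];
  [:: 4; 4; 4; 6; 10; 5];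
  [:: 4; 4; 4; 8; 6; 6];
  [:: 4; 4; 4; 10; 5; 6];
  [:: 4; 4; 4; 10; 6; 5];
  [:: 4; 4; 8; 8; 4; 6];
  [:: 4; 4; 8; 8; 6; 4];
  [:: 4; 5; 6; 5; 6; 5];
  [:: 4; 5; 6; 10; 5; 4];
  [:: 4; 5; 10; 6; 5; 4];
  [:: 4; 6; 6; 6; 6; 4]]%N.

Local Open Scope Z_scope.

(** [a], [b], [c] are the lower and [a'], [b'], [c'] the upper ends. Each inequality of [spherical]
    is refuted at the corner of the box most favourable to it: largest angles for the angle sum; for
    the others, one angle largest and the other two smallest. *)
Definition nonspherical (a b c a' b' c' : Z) : bool :=
  [|| 2 * (a * b + b * c + c * a) <=? a * b * c,
      (a + 2) * (b' * c') <=? 2 * a * (b' + c'),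
      (b + 2) * (c' * a') <=? 2 * b * (c' + a') |
      (c + 2) * (a' * b') <=? 2 * c * (a' + b')].

Definition cos_lo (n : Z) := (nth (0, 0) cos_table (Z.to_nat n)).1.
Definition cos_hi (n : Z) := (nth (0, 0) cos_table (Z.to_nat n)).2.

(** Upper bound for [y] times the cosine: [cosn] increases with its index, so the sign of [y]
    selects the end of the interval. *)
Definition cos_up (y l h : Z) : Z := y * (if 0 <=? y then cos_hi h else cos_lo l).

Definition leafP (l0 h0 l1 h1 l2 h2 l3 h3 l4 h4 l5 h5 : Z) : bool :=
  [|| h0 <? l0, h1 <? l1, h2 <? l2, h3 <? l3, h4 <? l4, h5 <? l5 |
  (3 <=? l0) &&
    [|| nonspherical l0 l1 l2 h0 h1 h2, nonspherical l0 l3 l4 h0 h3 h4,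
        nonspherical l1 l3 l5 h1 h3 h5 | nonspherical l2 l4 l5 h2 h4 h5]].

Definition leafA (l0 h0 l1 h1 l2 h2 l3 h3 l4 h4 l5 h5 : Z) : bool :=
  [&& l0 =? h0, l1 =? h1, l2 =? h2, l3 =? h3, l4 =? h4, l5 =? h5 &
      [seq Z.to_nat z | z <- [:: l0; l1; l2; l3; l4; l5]] \in accepted].

(* A Farkas vector: if all components of [G y] are nonnegative, and not all zero, for every
   matrix [G] of the box, then no [G] of the box has a positive null vector. *)
Definition leafC (y1 y2 y3 y4 l0 h0 l1 h1 l2 h2 l3 h3 l4 h4 l5 h5 : Z) : bool :=
  let d1 := y1 * scale - cos_up y2 l5 h5 - cos_up y3 l4 h4 - cos_up y4 l3 h3 in
  let d2 := y2 * scale - cos_up y1 l5 h5 - cos_up y3 l2 h2 - cos_up y4 l1 h1 in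
  let d3 := y3 * scale - cos_up y1 l4 h4 - cos_up y2 l2 h2 - cos_up y4 l0 h0 in
  let d4 := y4 * scale - cos_up y1 l3 h3 - cos_up y2 l1 h1 - cos_up y3 l0 h0 in
  [&& 3 <=? l0, h0 <? 50, h1 <? 50, h2 <? 50, h3 <? 50, h4 <? 50, h5 <? 50,
      0 <=? d1, 0 <=? d2, 0 <=? d3, 0 <=? d4 & 0 <? d1 + d2 + d3 + d4].

(* Only sextuples with n12 minimal, and n13 minimal among n13, n14, n23, n24, are searched. *)
Definition tighten (K : Z -> Z -> Z -> Z -> Z -> Z -> Z -> Z -> Z -> Z -> Z -> Z -> bool)
    (l0 h0 l1 h1 l2 h2 l3 h3 l4 h4 l5 h5 : Z) : bool :=
  let l1 := Z.max l1 l0 in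
  K l0 (Z.min h0 (Z.min h1 (Z.min h2 (Z.min h3 (Z.min h4 h5)))))
    l1 (Z.min h1 (Z.min h2 (Z.min h3 h4)))
    (Z.max (Z.max l2 l0) l1) h2 (Z.max (Z.max l3 l0) l1) h3
    (Z.max (Z.max l4 l0) l1) h4 (Z.max l5 l0) h5.

(* With [G] the symmetric matrix with diagonal [u] and off-diagonal entries [- a], ..., [- f],
   the components of the solution [y] of [G y = (det G) 1]. *)
Definition cofactor_sum (u a b c d e f : Z) : Z :=
  let p := b - d in let q := b - f in let r := c - e in let s := c - f in
  (u + a) * ((u + b) * (u + c) - q * s) - (a - d) * (p * (u + c) - q * r)
  + (a - e) * (p * s - (u + b) * r).

(* Up to the sign of the determinant, the solution of [G y = (det G) 1] at the centre of the box
   is a candidate for [leafC], which tests it rigorously: rounding it to [k] bits is harmless. *)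
Definition leafG (k u a b c d e f : Z) (l0 h0 l1 h1 l2 h2 l3 h3 l4 h4 l5 h5 : Z) : bool :=
  let y1 := cofactor_sum u a b c d e f in let y2 := cofactor_sum u a d e b c f in
  let y3 := cofactor_sum u b d f a c e in let y4 := cofactor_sum u c e f a b d in
  let s := Z.log2 (Z.abs y1 + Z.abs y2 + Z.abs y3 + Z.abs y4) - k in
  if 0 <=? u * y1 - a * y2 - b * y3 - c * y4
  then leafC (Z.shiftr y1 s) (Z.shiftr y2 s) (Z.shiftr y3 s) (Z.shiftr y4 s) l0 h0 l1 h1 l2 h2 l3 h3 l4 h4 l5 h5
  else leafC (Z.shiftr (- y1) s) (Z.shiftr (- y2) s) (Z.shiftr (- y3) s) (Z.shiftr (- y4) s) l0 h0 l1 h1 l2 h2 l3 h3 l4 h4 l5 h5.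

(** Cosines in thousandths. They only propose Farkas vectors and choose where to split, so their
    accuracy does not affect soundness. *)
Definition coarse_table : seq Z :=
  Eval vm_compute in [seq c.1 / 1000000000 | c <- cos_table].
Definition coarse_cos (n : Z) := nth 0 coarse_table (Z.to_nat n).
Definition coarse_mid (l h : Z) := coarse_cos l + coarse_cos h.
(** Mainly the spread of the cosine, which governs the Farkas test; [h - l] keeps the width positive
    when rounded cosines coincide. *)
Definition width (l h : Z) : Z := 50 * (coarse_cos h - coarse_cos l) + (h - l).
Definition fine_cos (n : Z) : Z := cos_lo n / 1000000.
(** The harmonic mean, which bisects the interval of the angles [2 pi / n]. *)
Definition mid (l h : Z) : Z := 2 * l * h / (l + h).

Definition singleton (l0 h0 l1 h1 l2 h2 l3 h3 l4 h4 l5 h5 : Z) : bool :=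
  [&& l0 =? h0, l1 =? h1, l2 =? h2, l3 =? h3, l4 =? h4 & l5 =? h5].

Definition leaf (l0 h0 l1 h1 l2 h2 l3 h3 l4 h4 l5 h5 : Z) : bool :=
  if leafP l0 h0 l1 h1 l2 h2 l3 h3 l4 h4 l5 h5 then true else
  (* The diagonal is 2000, twice the unit of [coarse_table], because [coarse_mid] adds the two end
     values instead of averaging them. *)
  if leafG 10 2000 (coarse_mid l5 h5) (coarse_mid l4 h4) (coarse_mid l3 h3)
    (coarse_mid l2 h2) (coarse_mid l1 h1) (coarse_mid l0 h0) l0 h0 l1 h1 l2 h2 l3 h3 l4 h4 l5 h5 then true else
  if singleton l0 h0 l1 h1 l2 h2 l3 h3 l4 h4 l5 h5 then
  if leafA l0 h0 l1 h1 l2 h2 l3 h3 l4 h4 l5 h5 then true else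
  if leafG 27 1000000 (fine_cos l5) (fine_cos l4) (fine_cos l3)
    (fine_cos l2) (fine_cos l1) (fine_cos l0) l0 h0 l1 h1 l2 h2 l3 h3 l4 h4 l5 h5 then true else
  (* Singular matrices, for which the candidate of [leafG] is a null vector. *)
  has (fun y : Z * Z * Z * Z => leafC y.1.1.1 y.1.1.2 y.1.2 y.2 l0 h0 l1 h1 l2 h2 l3 h3 l4 h4 l5 h5)
     [:: (2, 1, 0, 2); (2, 0, 1, 2); (1, 2, 3, 0); (2, 1, 0, 3)]
  else false.

Fixpoint search (k : nat) : Z -> Z -> Z -> Z -> Z -> Z -> Z -> Z -> Z -> Z -> Z -> Z -> bool :=
  tighten (fun l0 h0 l1 h1 l2 h2 l3 h3 l4 h4 l5 h5 =>
    if leaf l0 h0 l1 h1 l2 h2 l3 h3 l4 h4 l5 h5 then true else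
    if k is k.+1 then
    let w := Z.max (Z.max (Z.max (width l0 h0) (width l1 h1)) (Z.max (width l2 h2) (width l3 h3)))
      (Z.max (width l4 h4) (width l5 h5)) in
    if width l0 h0 =? w then
        search k l0 (mid l0 h0) l1 h1 l2 h2 l3 h3 l4 h4 l5 h5 &&
        search k (mid l0 h0 + 1) h0 l1 h1 l2 h2 l3 h3 l4 h4 l5 h5
    else if width l1 h1 =? w then
        search k l0 h0 l1 (mid l1 h1) l2 h2 l3 h3 l4 h4 l5 h5 &&
        search k l0 h0 (mid l1 h1 + 1) h1 l2 h2 l3 h3 l4 h4 l5 h5
    else if width l2 h2 =? w then
        search k l0 h0 l1 h1 l2 (mid l2 h2) l3 h3 l4 h4 l5 h5 &&
        search k l0 h0 l1 h1 (mid l2 h2 + 1) h2 l3 h3 l4 h4 l5 h5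
    else if width l3 h3 =? w then
        search k l0 h0 l1 h1 l2 h2 l3 (mid l3 h3) l4 h4 l5 h5 &&
        search k l0 h0 l1 h1 l2 h2 (mid l3 h3 + 1) h3 l4 h4 l5 h5
    else if width l4 h4 =? w then
        search k l0 h0 l1 h1 l2 h2 l3 h3 l4 (mid l4 h4) l5 h5 &&
        search k l0 h0 l1 h1 l2 h2 l3 h3 (mid l4 h4 + 1) h4 l5 h5
    else search k l0 h0 l1 h1 l2 h2 l3 h3 l4 h4 l5 (mid l5 h5) &&
        search k l0 h0 l1 h1 l2 h2 l3 h3 l4 h4 (mid l5 h5 + 1) h5
    else false).

Lemma search_ok : search 30 3 49 3 49 3 49 3 49 3 49 3 49.
Proof. by vm_compute. Qed.
Local Close Scope Z_scope.

Definition between (l h : Z) (n : nat) : Prop := Z.le l (Z.of_nat n) /\ Z.le (Z.of_nat n) h.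

(** In divided form, [2 / x + 2 / y + 2 / z <= 1] survives an increase of [x]. The next two lemmas
    treat [1 + 2 / x <= 2 / y + 2 / z] in the same way. *)
Lemma angle_sum_mono (x y z x' : Z) : Z.lt Z0 x -> Z.lt Z0 y -> Z.lt Z0 z -> Z.le x x' ->
  Z.le (Z.mul 2 (Z.add (Z.add (Z.mul x y) (Z.mul y z)) (Z.mul z x))) (Z.mul (Z.mul x y) z) ->
  Z.le (Z.mul 2 (Z.add (Z.add (Z.mul x' y) (Z.mul y z)) (Z.mul z x'))) (Z.mul (Z.mul x' y) z).
Proof.
move=> x0 y0 z0 xx h.
have k : Z.lt Z0 (Z.sub (Z.mul y z) (Z.mul 2 (Z.add y z))) by nia.
nia.
Qed.

Lemma scale_le_mono (x x' p s : Z) : Z.le Z0 p -> Z.lt Z0 x -> Z.le x x' ->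
  Z.le (Z.mul (Z.add x 2) p) (Z.mul (Z.mul 2 x) s) ->
  Z.le (Z.mul (Z.add x' 2) p) (Z.mul (Z.mul 2 x') s).
Proof.
move=> p0 x0 xx h; have k : Z.le Z0 (Z.sub (Z.mul 2 s) p) by nia.
nia.
Qed.

Lemma product_le_mono (x y y' z : Z) : Z.le Z0 x -> Z.le Z0 z -> Z.le Z0 y -> Z.le y y' ->
  Z.le (Z.mul (Z.add x 2) (Z.mul y' z)) (Z.mul (Z.mul 2 x) (Z.add y' z)) ->
  Z.le (Z.mul (Z.add x 2) (Z.mul y z)) (Z.mul (Z.mul 2 x) (Z.add y z)).
Proof.
move=> x0 z0 y0 yy; set k := Z.sub (Z.mul (Z.add x 2) z) (Z.mul 2 x).
have E t : Z.le (Z.mul (Z.add x 2) (Z.mul t z)) (Z.mul (Z.mul 2 x) (Z.add t z)) <->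
    Z.le (Z.mul t k) (Z.mul (Z.mul 2 x) z) by rewrite /k; split; lia.
rewrite !E; move: k {E} => k; have xz : Z.le Z0 (Z.mul x z) by nia.
have [k0|k0] := Z.le_gt_cases Z0 k; last by nia.
have : Z.le (Z.mul y k) (Z.mul y' k) by nia.
lia.
Qed.

Lemma nonsphericalP a b c (la lb lc ha hb hc : Z) :
  Z.lt Z0 la -> Z.lt Z0 lb -> Z.lt Z0 lc ->
  between la ha a -> between lb hb b -> between lc hc c ->
  spherical a b c -> spherical b c a -> spherical c a b ->
  nonspherical la lb lc ha hb hc = false.
Proof.
move=> a0 b0 c0 [a1 a2] [b1 b2] [c1 c2] [s1 t1] [_ t2] [_ t3].
have T (x y z : nat) (lx hy hz : Z) : Z.lt Z0 lx -> Z.lt Z0 (Z.of_nat y) -> Z.lt Z0 (Z.of_nat z) ->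
    Z.le lx (Z.of_nat x) -> Z.le (Z.of_nat y) hy ->
    Z.le (Z.of_nat z) hz -> (2 * x * (y + z) < (x + 2) * (y * z))%N ->
    Z.leb (Z.mul (Z.add lx 2) (Z.mul hy hz)) (Z.mul (Z.mul 2 lx) (Z.add hy hz)) = false.
  move=> lx0 y0 z0 xl yh zh t; apply/Z.leb_gt; apply/Z.lt_nge => h.
  have e1 : Z.le (Z.mul (Z.add (Z.of_nat x) 2) (Z.mul hy hz))
      (Z.mul (Z.mul 2 (Z.of_nat x)) (Z.add hy hz)).
    by apply: scale_le_mono lx0 xl h; apply: Z.mul_nonneg_nonneg; lia.
  have e2 : Z.le (Z.mul (Z.add (Z.of_nat x) 2) (Z.mul (Z.of_nat y) hz))
      (Z.mul (Z.mul 2 (Z.of_nat x)) (Z.add (Z.of_nat y) hz)).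
    by apply: product_le_mono yh e1; lia.
  have e3 : Z.le (Z.mul (Z.add (Z.of_nat x) 2) (Z.mul (Z.of_nat z) (Z.of_nat y)))
      (Z.mul (Z.mul 2 (Z.of_nat x)) (Z.add (Z.of_nat z) (Z.of_nat y))).
    apply: product_le_mono zh _; [lia|lia|lia|].
    by rewrite Z.mul_comm (Z.mul_comm hz) Z.mul_comm (Z.add_comm hz).
  by move: t e3; clear; lia.
have [pa pb pc] : [/\ Z.lt Z0 (Z.of_nat a), Z.lt Z0 (Z.of_nat b) & Z.lt Z0 (Z.of_nat c)].
  by split; lia.
rewrite /nonspherical (T a b c la hb hc) // (T b c a lb hc ha) // (T c a b lc ha hb) //.
rewrite !orbF; apply/Z.leb_gt; apply/Z.lt_nge => h.
have := angle_sum_mono a0 b0 c0 a1 h => h1.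
have h2 : Z.le (Z.mul 2 (Z.add (Z.add (Z.mul lb lc) (Z.mul lc (Z.of_nat a))) (Z.mul (Z.of_nat a) lb)))
   (Z.mul (Z.mul lb lc) (Z.of_nat a)) by lia.
have h3 := angle_sum_mono b0 c0 (Z.lt_le_trans _ _ _ a0 a1) b1 h2.
have h4 : Z.le (Z.mul 2 (Z.add (Z.add (Z.mul lc (Z.of_nat a)) (Z.mul (Z.of_nat a) (Z.of_nat b)))
   (Z.mul (Z.of_nat b) lc))) (Z.mul (Z.mul lc (Z.of_nat a)) (Z.of_nat b)) by lia.
have h5 := angle_sum_mono c0 (Z.lt_le_trans _ _ _ a0 a1) (Z.lt_le_trans _ _ _ b0 b1) c1 h4.
by move: s1 h5; clear; lia.
Qed.

Lemma cos_upP (R : realType) y l h n (a : R) :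
  (2 < n)%N -> between l h n -> Z.leb (Zpos 3) l -> Z.ltb h (Zpos 50) ->
  0 < a -> ZR R y * (cosn R n * a) * ZR R scale <= ZR R (cos_up y l h) * a.
Proof.
move=> n2 [ln nh] l3 h50 a0; rewrite /cos_up ZRM.
have [l' lE] : exists l', l = Z.of_nat l' by exists (Z.to_nat l); lia.
have [h' hE] : exists h', h = Z.of_nat h' by exists (Z.to_nat h); lia.
subst l h; rewrite /cos_hi /cos_lo !Nat2Z.id !cos_tableE; try lia.
have [l'2 h'2] : (2 < l')%N /\ (2 < h')%N by lia.
have /andP[u1 u2] := cosn_itvP R h'2; have /andP[v1 v2] := cosn_itvP R l'2.
have s0 := scale_gt0 R.
have m1 : cosn R l' <= cosn R n by apply: cosn_le; lia.
have m2 : cosn R n <= cosn R h' by apply: cosn_le; lia.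
rewrite (_ : _ * ZR R scale = ZR R y * (cosn R n * ZR R scale) * a); last ring.
rewrite ler_pM2r //.
have [y0|y0] := boolP (Z.leb Z0 y).
  apply: ler_wpM2l; first by rewrite -(ZR0 R); exact: ZR_le.
  by apply: le_trans u2; rewrite ler_pM2r.
apply: ler_wnM2l; first by rewrite -(ZR0 R); apply: ZR_le; lia.
by apply: le_trans v1 _; rewrite ler_pM2r.
Qed.

(** * Soundness of the search *)

Section Soundness.
Variable R : realType.
Notation ZR := (@ZR R).
Notation cosn := (@cosn R).
Variables (n0 n1 n2 n3 n4 n5 : nat) (a1 a2 a3 a4 : R).
Hypothesis sys : tetra_system (cosn n0) (cosn n1) (cosn n2) (cosn n3) (cosn n4) (cosn n5) a1 a2 a3 a4.
Hypotheses (n0_min : [/\ (n0 <= n1)%N, (n0 <= n2)%N, (n0 <= n3)%N, (n0 <= n4)%N & (n0 <= n5)%N])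
  (n1_min : [/\ (n1 <= n2)%N, (n1 <= n3)%N & (n1 <= n4)%N]).
Hypothesis n0_gt2 : (2 < n0)%N.
Hypothesis sph : forall a b c : nat,
  (a, b, c) \in [:: (n0, n1, n2); (n0, n3, n4); (n1, n3, n5); (n2, n4, n5)] ->
  [/\ spherical a b c, spherical b c a & spherical c a b].

Lemma leafP_correct l0 h0 l1 h1 l2 h2 l3 h3 l4 h4 l5 h5 :
  between l0 h0 n0 -> between l1 h1 n1 -> between l2 h2 n2 ->
  between l3 h3 n3 -> between l4 h4 n4 -> between l5 h5 n5 ->
  Z.le l0 l1 -> Z.le l0 l2 -> Z.le l0 l3 -> Z.le l0 l4 -> Z.le l0 l5 ->
  leafP l0 h0 l1 h1 l2 h2 l3 h3 l4 h4 l5 h5 = false.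
Proof.
move=> b0 b1 b2 b3 b4 b5 o1 o2 o3 o4 o5.
have B l h n : between l h n -> Z.ltb h l = false by move=> [h1' h2']; lia.
rewrite /leafP (B _ _ n0) // (B _ _ n1) // (B _ _ n2) // (B _ _ n3) // (B _ _ n4) // (B _ _ n5) //=.
case: (boolP (Z.leb _ _)) => //= l03; have {l03} l03 : Z.lt Z0 l0 by lia.
have L x : Z.le l0 x -> Z.lt Z0 x by lia.
have [s1 s2 s3] := sph (a := n0) (b := n1) (c := n2) (mem_head _ _).
have [t1 t2 t3] : [/\ spherical n0 n3 n4, spherical n3 n4 n0 & spherical n4 n0 n3].
  by apply: sph; rewrite !inE eqxx ?orbT.
have [u1 u2 u3] : [/\ spherical n1 n3 n5, spherical n3 n5 n1 & spherical n5 n1 n3].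
  by apply: sph; rewrite !inE eqxx ?orbT.
have [w1 w2 w3] : [/\ spherical n2 n4 n5, spherical n4 n5 n2 & spherical n5 n2 n4].
  by apply: sph; rewrite !inE eqxx ?orbT.
by rewrite (nonsphericalP _ _ _ b0 b1 b2) ?(nonsphericalP _ _ _ b0 b3 b4)
  ?(nonsphericalP _ _ _ b1 b3 b5) ?(nonsphericalP _ _ _ b2 b4 b5) //; exact: L.
Qed.

Lemma leafC_correct y1 y2 y3 y4 l0 h0 l1 h1 l2 h2 l3 h3 l4 h4 l5 h5 :
  between l0 h0 n0 -> between l1 h1 n1 -> between l2 h2 n2 ->
  between l3 h3 n3 -> between l4 h4 n4 -> between l5 h5 n5 ->
  Z.le l0 l1 -> Z.le l0 l2 -> Z.le l0 l3 -> Z.le l0 l4 -> Z.le l0 l5 ->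
  leafC y1 y2 y3 y4 l0 h0 l1 h1 l2 h2 l3 h3 l4 h4 l5 h5 = false.
Proof.
move=> b0 b1 b2 b3 b4 b5 o1 o2 o3 o4 o5; apply/negP.
rewrite /leafC => /and5P[l03 h0' h1' h2' /and5P[h3' h4' h5' d1 /and4P[d2 d3 d4 d]]].
have Lx x : Z.le l0 x -> Z.leb (Zpos 3) x by lia.
have [m1 m2 m3 m4 m5] := n0_min.
have N n : (n0 <= n)%N -> (2 < n)%N by exact: leq_trans.
case: sys => p1 p2 p3 p4 E1 E2 E3 E4 _ _ _ _.
have s0 := scale_gt0 R.
pose up y l h n (a : R) (n2' : (2 < n)%N) (b : between l h n) (l3 : Z.leb (Zpos 3) l)
  (h5 : Z.ltb h (Zpos 50)) (a0 : 0 < a) := cos_upP (R := R) y n2' b l3 h5 a0.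
have U0 y a (a0 : 0 < a) := up y _ _ _ a n0_gt2 b0 l03 h0' a0.
have U1 y a (a0 : 0 < a) := up y _ _ _ a (N _ m1) b1 (Lx _ o1) h1' a0.
have U2 y a (a0 : 0 < a) := up y _ _ _ a (N _ m2) b2 (Lx _ o2) h2' a0.
have U3 y a (a0 : 0 < a) := up y _ _ _ a (N _ m3) b3 (Lx _ o3) h3' a0.
have U4 y a (a0 : 0 < a) := up y _ _ _ a (N _ m4) b4 (Lx _ o4) h4' a0.
have U5 y a (a0 : 0 < a) := up y _ _ _ a (N _ m5) b5 (Lx _ o5) h5' a0.
have := U5 y2 _ p1; have := U4 y3 _ p1; have := U3 y4 _ p1.
have := U5 y1 _ p2; have := U2 y3 _ p2; have := U1 y4 _ p2.
have := U4 y1 _ p3; have := U2 y2 _ p3; have := U0 y4 _ p3.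
have := U3 y1 _ p4; have := U1 y2 _ p4; have := U0 y3 _ p4.
clear U0 U1 U2 U3 U4 U5.
move: (ZR_le R d1) (ZR_le R d2) (ZR_le R d3) (ZR_le R d4) (ZR_lt R d).
rewrite ZR0 !ZRB 3!ZRD !ZRB !(ZRM _ _ scale).
set u1 := ZR (cos_up y2 l5 h5); set u2 := ZR (cos_up y3 l4 h4); set u3 := ZR (cos_up y4 l3 h3).
set u4 := ZR (cos_up y1 l5 h5); set u5 := ZR (cos_up y3 l2 h2); set u6 := ZR (cos_up y4 l1 h1).
set u7 := ZR (cos_up y1 l4 h4); set u8 := ZR (cos_up y2 l2 h2); set u9 := ZR (cos_up y4 l0 h0).
set u10 := ZR (cos_up y1 l3 h3); set u11 := ZR (cos_up y2 l1 h1); set u12 := ZR (cos_up y3 l0 h0).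
set s := ZR scale in s0 *.
move: (ZR y1) (ZR y2) (ZR y3) (ZR y4) => z1 z2 z3 z4 {d1 d2 d3 d4 d}.
set d1 := _ - u3; set d2 := _ - u6; set d3 := _ - u9; set d4 := _ - u12 => d1p d2p d3p d4p dp.
move=> i1' i2' i3' i4' i5' i6' i7' i8' i9' i10' i11' i12'.
(* The [d] are lower bounds for [scale] times the components of [G y]. Pairing [G y] with the areas
   gives zero, because [G] is symmetric and kills the areas. *)
have S : d1 * a1 + d2 * a2 + d3 * a3 + d4 * a4 <= 0.
  have Z : z1 * a1 + z2 * a2 + z3 * a3 + z4 * a4 =
    z1 * (cosn n5 * a2 + cosn n4 * a3 + cosn n3 * a4) +
    z2 * (cosn n5 * a1 + cosn n2 * a3 + cosn n1 * a4) +
    z3 * (cosn n4 * a1 + cosn n2 * a2 + cosn n0 * a4) +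
    z4 * (cosn n3 * a1 + cosn n1 * a2 + cosn n0 * a3) by rewrite -E1 -E2 -E3 -E4.
  have : (z1 * a1 + z2 * a2 + z3 * a3 + z4 * a4) * s =
     z1 * (cosn n5 * a2) * s + z1 * (cosn n4 * a3) * s + z1 * (cosn n3 * a4) * s +
     (z2 * (cosn n5 * a1) * s + z2 * (cosn n2 * a3) * s + z2 * (cosn n1 * a4) * s) +
     (z3 * (cosn n4 * a1) * s + z3 * (cosn n2 * a2) * s + z3 * (cosn n0 * a4) * s) +
     (z4 * (cosn n3 * a1) * s + z4 * (cosn n1 * a2) * s + z4 * (cosn n0 * a3) * s).
    by rewrite Z; ring.
  rewrite /d1 /d2 /d3 /d4; lra.
have q1 := mulr_ge0 d1p (ltW p1); have q2 := mulr_ge0 d2p (ltW p2).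
have q3 := mulr_ge0 d3p (ltW p3); have q4 := mulr_ge0 d4p (ltW p4).
have z (x y : R) : 0 < y -> x * y = 0 -> x = 0.
  by move=> y0 /eqP; rewrite mulf_eq0 (gt_eqF y0) orbF => /eqP.
have r1 : d1 = 0 by apply: z p1 _; lra.
have r2 : d2 = 0 by apply: z p2 _; lra.
have r3 : d3 = 0 by apply: z p3 _; lra.
have r4 : d4 = 0 by apply: z p4 _; lra.
by move: dp; rewrite r1 r2 r3 r4 !addr0 ltxx.
Qed.

Lemma tightenP (K : Z -> Z -> Z -> Z -> Z -> Z -> Z -> Z -> Z -> Z -> Z -> Z -> bool)
    l0 h0 l1 h1 l2 h2 l3 h3 l4 h4 l5 h5 (Q : Prop) :
  (forall l0 h0 l1 h1 l2 h2 l3 h3 l4 h4 l5 h5,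
    between l0 h0 n0 -> between l1 h1 n1 -> between l2 h2 n2 ->
    between l3 h3 n3 -> between l4 h4 n4 -> between l5 h5 n5 ->
    Z.le l0 l1 -> Z.le l0 l2 -> Z.le l0 l3 -> Z.le l0 l4 -> Z.le l0 l5 ->
    K l0 h0 l1 h1 l2 h2 l3 h3 l4 h4 l5 h5 -> Q) ->
  between l0 h0 n0 -> between l1 h1 n1 -> between l2 h2 n2 ->
  between l3 h3 n3 -> between l4 h4 n4 -> between l5 h5 n5 ->
  tighten K l0 h0 l1 h1 l2 h2 l3 h3 l4 h4 l5 h5 -> Q.
Proof.
move=> KQ [x0 y0] [x1 y1] [x2 y2] [x3 y3] [x4 y4] [x5 y5].
have [m1 m2 m3 m4 m5] := n0_min; have [k1 k2 k3] := n1_min.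
by rewrite /tighten; apply: KQ; try split; lia.
Qed.

Lemma leaf_correct l0 h0 l1 h1 l2 h2 l3 h3 l4 h4 l5 h5 :
  between l0 h0 n0 -> between l1 h1 n1 -> between l2 h2 n2 ->
  between l3 h3 n3 -> between l4 h4 n4 -> between l5 h5 n5 ->
  Z.le l0 l1 -> Z.le l0 l2 -> Z.le l0 l3 -> Z.le l0 l4 -> Z.le l0 l5 ->
  leaf l0 h0 l1 h1 l2 h2 l3 h3 l4 h4 l5 h5 -> [:: n0; n1; n2; n3; n4; n5] \in accepted.
Proof.
move=> b0 b1 b2 b3 b4 b5 o1 o2 o3 o4 o5.
have C y1 y2 y3 y4 : leafC y1 y2 y3 y4 l0 h0 l1 h1 l2 h2 l3 h3 l4 h4 l5 h5 = false by exact: leafC_correct.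
have G k u a b c d e f : leafG k u a b c d e f l0 h0 l1 h1 l2 h2 l3 h3 l4 h4 l5 h5 = false.
  by rewrite /leafG; case: ifP => _; exact: C.
rewrite /leaf leafP_correct // !G /= !C /=; case: ifP => // _; case: ifP => // + _.
move=> /and5P[/Z.eqb_spec e0 /Z.eqb_spec e1 /Z.eqb_spec e2 /Z.eqb_spec e3
  /and3P[/Z.eqb_spec e4 /Z.eqb_spec e5]].
have V l h n : between l h n -> l = h -> Z.to_nat l = n by move=> [? ?] ?; lia.
by rewrite /= (V _ _ _ b0 e0) (V _ _ _ b1 e1) (V _ _ _ b2 e2) (V _ _ _ b3 e3)
  (V _ _ _ b4 e4) (V _ _ _ b5 e5).
Qed.

Theorem search_correct k l0 h0 l1 h1 l2 h2 l3 h3 l4 h4 l5 h5 :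
  between l0 h0 n0 -> between l1 h1 n1 -> between l2 h2 n2 ->
  between l3 h3 n3 -> between l4 h4 n4 -> between l5 h5 n5 ->
  search k l0 h0 l1 h1 l2 h2 l3 h3 l4 h4 l5 h5 -> [:: n0; n1; n2; n3; n4; n5] \in accepted.
Proof.
have B l h m n : between l h n -> between l m n \/ between (Z.add m 1) h n.
  by move=> [? ?]; have [?|?] := Z.le_gt_cases (Z.of_nat n) m; [left|right]; split; lia.
elim: k l0 h0 l1 h1 l2 h2 l3 h3 l4 h4 l5 h5 => [|k IH] l0 h0 l1 h1 l2 h2 l3 h3 l4 h4 l5 h5;
  apply: tightenP => {l0 h0 l1 h1 l2 h2 l3 h3 l4 h4 l5 h5}
    l0 h0 l1 h1 l2 h2 l3 h3 l4 h4 l5 h5 b0 b1 b2 b3 b4 b5 o1 o2 o3 o4 o5;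
  case: ifP => [lf _|_]; try exact: leaf_correct lf; first by [].
cbv zeta; do 5?[case: ifP => _].
- by move=> /andP[r1 r2]; have [b|b] := B _ _ (mid l0 h0) _ b0; [apply: IH r1|apply: IH r2].
- by move=> /andP[r1 r2]; have [b|b] := B _ _ (mid l1 h1) _ b1; [apply: IH r1|apply: IH r2].
- by move=> /andP[r1 r2]; have [b|b] := B _ _ (mid l2 h2) _ b2; [apply: IH r1|apply: IH r2].
- by move=> /andP[r1 r2]; have [b|b] := B _ _ (mid l3 h3) _ b3; [apply: IH r1|apply: IH r2].
- by move=> /andP[r1 r2]; have [b|b] := B _ _ (mid l4 h4) _ b4; [apply: IH r1|apply: IH r2].
- by move=> /andP[r1 r2]; have [b|b] := B _ _ (mid l5 h5) _ b5; [apply: IH r1|apply: IH r2].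
Qed.

End Soundness.

(** * Classification *)

Lemma nondegenerate_perm (R : realType) (V : 'I_4 -> 'rV[R]_3) (s : 'S_4) :
  nondegenerate_tetrahedron V -> nondegenerate_tetrahedron (V \o s).
Proof.
move=> Vn; rewrite /nondegenerate_tetrahedron row_free_unit unitmxE unitfE det_mx33 !rowK /=.
have l1 : lift ord0 o0 = i2 by exact: val_inj.
have l2 : lift ord0 o1 = i3 by exact: val_inj.
have l3 : lift ord0 o2 = i4 by exact: val_inj.
have l0 : ord0 = i1 by exact: val_inj.
rewrite l1 l2 l3 l0 -sqrf_eq0 triple_edges ?sqrf_eq0 ?vol_neq0 //.
by rewrite -[X in uniq X]/(map s [:: i1; i2; i3; i4]) (map_inj_uniq (@perm_inj _ s)).
Qed.

Lemma face_perm (R : realType) (V : 'I_4 -> 'rV[R]_3) (s : 'S_4) (A : {set 'I_4}) :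
  face (V \o s) A = face V (s @: A).
Proof.
apply/seteqP; split=> x [w [w0 w1 ->]].
  exists (w \o (s^-1)%g); split.
  - by move=> i /imsetP[j jA ->]; rewrite /= permK; exact: w0.
  - rewrite big_imset /=; last by move=> i j _ _; exact: perm_inj.
    by rewrite -w1; apply: eq_bigr => i _; rewrite permK.
  - rewrite big_imset /=; last by move=> i j _ _; exact: perm_inj.
    by apply: eq_bigr => i _; rewrite permK.
exists (w \o s); split.
- by move=> i iA; apply: w0; exact: imset_f.
- by rewrite -w1 big_imset //= => i j _ _; exact: perm_inj.
- by rewrite big_imset //= => i j _ _; exact: perm_inj.
Qed.

Lemma tiles_perm (R : realType) (V : 'I_4 -> 'rV[R]_3) (s : 'S_4) :
  tiles_face_to_face V -> tiles_face_to_face (V \o s).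
Proof.
have TE : tetrahedron (V \o s) = tetrahedron V.
  rewrite /tetrahedron face_perm; congr face.
  by apply/setP => i; rewrite !inE; apply/imsetP; exists ((s^-1)%g i); rewrite ?inE ?permKV.
have fE A : face V A = face (V \o s) ((s^-1)%g @: A).
  rewrite face_perm -imset_comp (eq_imset (g := id)) ?imset_id // => i /=.
  by rewrite permKV.
rewrite /tiles_face_to_face TE => -[F [F1 F2 F3 F4]]; exists F; split=> // f g Ff Fg fg.
have [A [B [A3 B3 EA EB]]] := F4 f g Ff Fg fg.
exists ((s^-1)%g @: A), ((s^-1)%g @: B); rewrite -!fE !card_imset //; exact: perm_inj.
Qed.

Record tetra_angles (R : realType) (V : 'I_4 -> 'rV[R]_3) (n : 'I_4 -> 'I_4 -> nat) : Prop := {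
  tetra_nondegenerate : nondegenerate_tetrahedron V;
  tetra_n_gt0 : forall i j : 'I_4, i != j -> (0 < n i j)%N;
  tetra_angleE : forall i j k l : 'I_4, uniq [:: i; j; k; l] ->
     dihedral_angle (V i) (V j) (V k) (V l) = 2 * pi / (n i j)%:R }.

Lemma tetra_angles_perm (R : realType) (V : 'I_4 -> 'rV[R]_3) n (s : 'S_4) :
  tetra_angles V n -> tetra_angles (V \o s) (fun i j => n (s i) (s j)).
Proof.
move=> [Vn n0 aE]; split; first exact: nondegenerate_perm.
- by move=> i j ij; apply: n0; rewrite (inj_eq perm_inj).
- move=> i j k l u; apply: aE.
  by rewrite -[X in uniq X]/(map s [:: i; j; k; l]) (map_inj_uniq (@perm_inj _ s)).
Qed.

Lemma perm_of_uniq4 (i j k l : 'I_4) : uniq [:: i; j; k; l] ->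
  exists s : 'S_4, [/\ s i1 = i, s i2 = j, s i3 = k & s i4 = l].
Proof.
by move=> u; have [s sE] := perm_of_uniq (t := [tuple i; j; k; l]) u; exists s; rewrite !sE.
Qed.

(* The other two angles sum to [pi] up to [2 pi / a], hence exactly. *)
Lemma spherical_large a b c : (50 <= a)%N -> (2 < b)%N -> (2 < c)%N ->
  spherical a b c -> (b, c) \in [:: (4, 4); (3, 6); (6, 3)]%N.
Proof.
move=> a50 b2 c2 [s1 s2].
have s3 : (12 * (b * c) < 25 * (b + c))%N.
  have [h|h] := leqP (b * c) (2 * (b + c)); first by lia.
  have [d dE] : exists d, (b * c = 2 * (b + c) + d)%N by exists (b * c - 2 * (b + c))%N; lia.
  nia.
have s4 : (25 * (b + c) < 13 * (b * c))%N.
  have [h|h] := leqP (2 * (b + c)) (b * c); first by nia.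
  have [d dE] : exists d, (b * c + d = 2 * (b + c))%N by exists (2 * (b + c) - b * c)%N; lia.
  nia.
have b6 : (b < 7)%N by nia.
have c6 : (c < 7)%N by nia.
by move: b6 c6 s3 s4 b2 c2; case: b {s1 s2} => [|[|[|[|[|[|[|b]]]]]]] // _;
  case: c => [|[|[|[|[|[|[|c]]]]]]].
Qed.

Section AngleDenominators.
Variables (R : realType) (V : 'I_4 -> 'rV[R]_3) (n : 'I_4 -> 'I_4 -> nat).
Hypothesis tV : tetra_angles V n.
Notation cosn := (@cosn R).

Lemma n_symm i j : i != j -> n i j = n j i.
Proof. by move=> ij; exact: (n_sym (tetra_angleE tV) ij). Qed.

Lemma vertex_det3 i j k l : uniq [:: i; j; k; l] ->
  0 < det3 (cosn (n i j)) (cosn (n i k)) (cosn (n i l)).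
Proof.
move=> /perm_of_uniq4[s [<- <- <- <-]].
by have [Vn _ aE] := tetra_angles_perm s tV; case: (area_system Vn aE).
Qed.

Lemma n_gt2 i j : i != j -> (2 < n i j)%N.
Proof.
move=> ij; have [k [l u]] := uniq4_ex ij.
exact: det3_gt2 (tetra_n_gt0 tV ij) (vertex_det3 u).
Qed.

Lemma vertex_spherical i j k l : uniq [:: i; j; k; l] -> spherical (n i j) (n i k) (n i l).
Proof.
move=> u; apply: (@det3_spherical R) (vertex_det3 u); apply: n_gt2;
  by move: u; rewrite /= !inE !negb_or => /andP[/and3P[]].
Qed.

Lemma n_lt50 i j : i != j -> (n i j < 50)%N.
Proof.
move=> ij; have [k [l u]] := uniq4_ex ij.
have [s [s1 s2 s3 s4]] := perm_of_uniq4 u.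
have [Vn _ aE] := tetra_angles_perm s tV.
have [] := area_system Vn aE; rewrite s1 s2 s3 s4.
move: (farea _ i1) (farea _ i2) (farea _ i3) (farea _ i4) => a1 a2 a3 a4 _ _ p3 p4 _ _ E3 E4 _ _ _ _.
have u' : uniq [:: j; i; k; l].
  by move: u; rewrite /= !inE !negb_or (eq_sym j i) => /and4P[/and3P[-> -> ->] /andP[-> ->] ->].
have [ik il jk jl] : [/\ i != k, i != l, j != k & j != l].
  by move: u; rewrite /= !inE !negb_or => /and4P[/and3P[_ -> ->] /andP[-> ->] _ _].
rewrite ltnNge; apply/negP => n50.
have S1 := spherical_large n50 (n_gt2 ik) (n_gt2 il) (vertex_spherical u).
have n50' : (50 <= n j i)%N by rewrite n_symm // eq_sym.
have S2 := spherical_large n50' (n_gt2 jk) (n_gt2 jl) (vertex_spherical u').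
have C (b c : nat) : (b, c) \in [:: (4, 4); (3, 6); (6, 3)]%N -> cosn b + cosn c = 0.
  rewrite !inE => /or3P[]/eqP[-> ->]; rewrite ?cosn4 ?cosn3 ?cosn6; lra.
have := C _ _ S1; have := C _ _ S2 => c2 c1.
have /andP[_ c3] := cosn1_lt R (n_gt2 ij).
(* The sum of the equations of the two faces that meet in the edge [ij]. The two angles at either
   end are supplementary, so their cosines cancel. *)
have : (a3 + a4) * (1 - cosn (n i j)) = 0.
  have -> : (a3 + a4) * (1 - cosn (n i j)) = (cosn (n j k) + cosn (n j l)) * a1 +
    (cosn (n i k) + cosn (n i l)) * a2 by move: E3 E4; clear; lra.
  by rewrite c1 c2 !mul0r addr0.
have : 0 < (a3 + a4) * (1 - cosn (n i j)).
  by apply: mulr_gt0; [exact: addr_gt0 | rewrite subr_gt0].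
by move=> h e; rewrite e ltxx in h.
Qed.

End AngleDenominators.

Theorem classification (R : realType) (V : 'I_4 -> 'rV[R]_3) (n : 'I_4 -> 'I_4 -> nat) :
  tetra_angles V n ->
  exists s : 'S_4, sextuple (fun i j => n (s i) (s j)) \in accepted.
Proof.
(* As all entries are below 50, minimising [key] is lexicographic minimisation; it gives the
   normalisation that [tighten] assumes. *)
move=> tV; pose key (s : 'S_4) := (50 * n (s i1) (s i2) + n (s i1) (s i3))%N.
have [s _ smin] := arg_minnP (P := predT) key (erefl true : predT (1%g : 'S_4)).
exists s; have tW := tetra_angles_perm s tV.
set W := V \o s in tW *; set m := fun i j => n (s i) (s j) in tW *.
have K (i j k l : 'I_4) : uniq [:: i; j; k; l] ->
    (50 * m i1 i2 + m i1 i3 <= 50 * m i j + m i k)%N.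
  move=> /perm_of_uniq4[t [t1 t2 t3 t4]]; have := smin (t * s)%g isT.
  by rewrite /key !permM t1 t2 t3.
have L i j : i != j -> (m i j < 50)%N := n_lt50 tW (i := i) (j := j).
have G i j : i != j -> (2 < m i j)%N := n_gt2 tW (i := i) (j := j).
have S i j : i != j -> m i j = m j i := n_symm tW (i := i) (j := j).
have B i j : i != j -> between 3 49 (m i j).
  by move=> ij; have := G i j ij; have := L i j ij; rewrite /between; lia.
have X i j : i != j -> (m i1 i2 <= m i j)%N.
  move=> ij; have [k [l u]] := uniq4_ex ij; have := K i j k l u.
  have ik : i != k by move: u; rewrite /= !inE !negb_or => /andP[/and3P[]].
  by have := L i k ik; have := L i1 i3 isT; lia.
have Q i j k l : uniq [:: i; j; k; l] ->
    [/\ spherical (m i j) (m i k) (m i l), spherical (m i k) (m i l) (m i j)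
      & spherical (m i l) (m i j) (m i k)].
  have rot3 (a b c d : 'I_4) : uniq [:: a; b; c; d] -> uniq [:: a; c; d; b].
    by rewrite -[[:: c; d; b]]/(rot 1 [:: b; c; d]) !(cons_uniq a) mem_rot rot_uniq.
  move=> u; split; first exact: (vertex_spherical tW u).
    exact: (vertex_spherical tW (rot3 _ _ _ _ u)).
  exact: (vertex_spherical tW (rot3 _ _ _ _ (rot3 _ _ _ _ u))).
have [Wn _ aE] := tW.
have M : [/\ (m i1 i3 <= m i1 i4)%N, (m i1 i3 <= m i2 i3)%N & (m i1 i3 <= m i2 i4)%N].
  have := K i1 i2 i4 i3 isT; have := K i2 i1 i3 i4 isT; have := K i2 i1 i4 i3 isT.
  by rewrite (S i2 i1) //; split; lia.
apply: (search_correct (area_system Wn aE) _ _ _ _ (B i1 i2 isT) (B i1 i3 isT)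
  (B i1 i4 isT) (B i2 i3 isT) (B i2 i4 isT) (B i3 i4 isT) search_ok).
- by split; exact: X.
- exact: M.
- exact: G.
- move=> a b c; rewrite !inE => /or4P[]/eqP[-> -> ->].
  + exact: (Q i1 i2 i3 i4).
  + by rewrite (S i1 i2) //; exact: (Q i2 i1 i3 i4).
  + by rewrite (S i1 i3) // (S i2 i3) //; exact: (Q i3 i1 i2 i4).
  + by rewrite (S i1 i4) // (S i2 i4) // (S i3 i4) //; exact: (Q i4 i1 i2 i3).
Qed.

(** * The golden sextuples do not tile *)

Section EdgeClass.
Variables (R : realType) (V : 'I_4 -> 'rV[R]_3) (n : 'I_4 -> 'I_4 -> nat).
Hypothesis tV : tetra_angles V n.
Notation cosn := (@cosn R).

(* The left-hand side is proportional to the square of the length of the edge [ij]. *)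
Lemma edge_class_obstruction (x : 'I_4 -> R) (a t : R) (p : nat) (i j k l : 'I_4) :
  odd p -> (2 < p)%N -> 0 < a -> 0 < t -> (forall b, farea V b = a * x b) -> uniq [:: i; j; k; l] ->
  let P i' j' k' l' :=
    x k' ^+ 2 * x l' ^+ 2 * (1 - cosn (n i' j') ^+ 2) = x k ^+ 2 * x l ^+ 2 * (1 - cosn (n i j) ^+ 2) ->
    n i' j' = p /\ (x k' < t <= x l' \/ x l' < t <= x k') in
  P i1 i2 i3 i4 -> P i1 i3 i2 i4 -> P i1 i4 i2 i3 ->
  P i2 i3 i1 i4 -> P i2 i4 i1 i3 -> P i3 i4 i1 i2 -> ~ tiles_face_to_face V.
Proof.
move=> po p2 a0 t0 xE u P p12 p13 p14 p23 p24 p34 [F [F1 F2 F3 F4]].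
have Vn := tetra_nondegenerate tV; have aE := tetra_angleE tV.
have PP i' j' k' l' : uniq [:: i'; j'; k'; l'] -> P i' j' k' l'.
  move: i' j' k' l'; apply: uniq4_ind => //.
    move=> i' j' k' l'; rewrite /P; have [->//|ij] := eqVneq i' j'.
    by rewrite (n_symm tV (i := j')) // eq_sym.
  move=> i' j' k' l'; rewrite /P (mulrC (x l' ^+ 2)) => h /h[-> h']; split=> //.
  by case: h'; [right|left].
have v0 : vol V ^+ 2 != 0 by rewrite sqrf_eq0 vol_neq0.
have LP i' j' k' l' : uniq [:: i'; j'; k'; l'] ->
    dotp (V j' - V i') (V j' - V i') = dotp (V j - V i) (V j - V i) ->
    n i' j' = p /\ (x k' < t <= x l' \/ x l' < t <= x k').
  move=> u' /(congr1 (fun r => r * vol V ^+ 2)).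
  rewrite (edge_sqr_cosn Vn aE u') (edge_sqr_cosn Vn aE u) !xE => e; apply: PP u' _.
  apply: (mulfI (expf_neq0 4 (lt0r_neq0 a0))); move: e; rewrite !exprMn.
  by move=> e; move: e; clear; lra.
have sq_lt b : (farea V b ^+ 2 < (a * t) ^+ 2) = (x b < t).
  rewrite xE !exprMn ltr_pM2l ?exprn_gt0 //.
  have x0 : 0 < x b by have := farea_gt0 Vn b; rewrite xE pmulr_rgt0.
  by rewrite ltr_pXn2r // ?nnegrE ltW.
apply: (no_odd_edge_class Vn F1 F2 F3 F4 p2 (L := dotp (V j - V i) (V j - V i)) (t := (a * t) ^+ 2)
  _ _ po u erefl).
- by move=> i' j' k' l' u' /(LP _ _ _ _ u')[<- _]; exact: aE.
- move=> i' j' k' l' u' /(LP _ _ _ _ u')[_]; rewrite (area2_normal _ u').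
  have u2 : uniq [:: i'; j'; l'; k'].
    by move: u'; rewrite /= !inE !negb_or (eq_sym l' k') => /and4P[/and3P[-> -> ->] /andP[-> ->] -> _].
  rewrite (area2_normal _ u2) !sq_lt.
  by case=> /andP[h1 h2]; rewrite h1 ltNge h2.
Qed.

End EdgeClass.

(** [g] is [(sqrt 5 - 1) / 2]. Its bounds are ratios of consecutive Fibonacci numbers, close enough
    to decide the comparisons of edge lengths below. *)
Lemma golden_cosn (R : realType) : exists g : R,
  [/\ g ^+ 2 = 1 - g, 8 / 13 < g < 5 / 8, cosn R 5 = g / 2 & cosn R 10 = (1 + g) / 2].
Proof.
have h := cosn5 R; have h0 : 0 < cosn R 5 by exact: cosn_gt0.
exists (2 * cosn R 5); split; [lra| |lra|by rewrite cosn10; lra].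
move: (cosn R 5) h h0 => c h h0; apply/andP; split; nra.
Qed.

Lemma golden_powers (R : realType) (g : R) : g ^+ 2 = 1 - g ->
  [/\ g ^+ 3 = 2 * g - 1, g ^+ 4 = 2 - 3 * g, g ^+ 5 = 5 * g - 3, g ^+ 6 = 5 - 8 * g
    & (forall a, g * (g * a) = a - g * a)].
Proof.
move=> g2; have S m : g ^+ m.+2 = g ^+ m - g ^+ m.+1.
  by rewrite -addn2 exprD g2 exprSr; ring.
split; last by move=> a; rewrite mulrA -expr2 g2; ring.
all: by rewrite !S !expr1; lra.
Qed.

(* The remaining sextuples; their face areas have ratios in Q(sqrt 5). *)
Definition golden_types : seq (seq nat) :=
  [:: [:: 3; 4; 5; 10; 6; 6]; [:: 3; 5; 5; 10; 10; 4]; [:: 3; 5; 10; 10; 6; 4];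
      [:: 3; 6; 10; 10; 10; 3]; [:: 4; 4; 4; 5; 6; 10]; [:: 4; 5; 6; 5; 6; 5]]%N.

Lemma golden_not_tiling (R : realType) (V : 'I_4 -> 'rV[R]_3) (n : 'I_4 -> 'I_4 -> nat) :
  tetra_angles V n -> sextuple n \in golden_types -> ~ tiles_face_to_face V.
Proof.
move=> tV sx; have [g [g2 /andP[g_gt g_lt] c5 c10]] := golden_cosn R.
have [g3 g4 g5 g6 gg] := golden_powers g2.
have [p1 _ _ _ E1 E2 E3 E4 _ _ _ _] := area_system (tetra_nondegenerate tV) (tetra_angleE tV).
have [t1 t2] : (0 : R) < 2^-1 /\ (0 : R) < 4 / 5 by split; lra.
pose P (x : seq R) (t : R) (p : nat) (i j k l : 'I_4) := [/\
  [/\ farea V i1 = farea V i1 * x`_0, farea V i2 = farea V i1 * x`_1,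
      farea V i3 = farea V i1 * x`_2 & farea V i4 = farea V i1 * x`_3],
  0 < t, odd p && (2 < p)%N, uniq [:: i; j; k; l] &
  let Q (i' j' k' l' : 'I_4) :=
    x`_k' ^+ 2 * x`_l' ^+ 2 * (1 - cosn R (n i' j') ^+ 2) =
      x`_k ^+ 2 * x`_l ^+ 2 * (1 - cosn R (n i j) ^+ 2) ->
    n i' j' = p /\ (x`_k' < t <= x`_l' \/ x`_l' < t <= x`_k') in
  [/\ Q i1 i2 i3 i4, Q i1 i3 i2 i4 & [/\ Q i1 i4 i2 i3, Q i2 i3 i1 i4, Q i2 i4 i1 i3 & Q i3 i4 i1 i2]]].
(* [x] lists the face areas relative to the first one, [g] being the golden ratio minus one. *)
have PT x t p i j k l : P x t p i j k l -> ~ tiles_face_to_face V.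
  move=> [[A1 A2 A3 A4] t0 /andP[po p2] u [q1 q2 [q3 q4 q5 q6]]].
  by apply: (edge_class_obstruction tV (x := fun b : 'I_4 => x`_b) po p2 p1 t0 _ u) => //; apply: ord4_enum.
move: sx; rewrite !inE => /or4P[|||/or3P[]] /eqP[n12 n13 n14 n23 n24 n34];
  [ apply: (PT [:: 1; g; 1 - g; g] 2^-1 3 i1 i2 i3 i4)
  | apply: (PT [:: 1; 1 - g; g; g] 2^-1 5 i1 i3 i2 i4)
  | apply: (PT [:: 1; 1; 1; g] (4 / 5) 3 i1 i2 i3 i4)
  | apply: (PT [:: 1; g; 1; g] (4 / 5) 3 i1 i2 i3 i4)
  | apply: (PT [:: 1; (1 + g) / 2; 2^-1; g / 2] 2^-1 5 i2 i3 i1 i4)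
  | apply: (PT [:: 1; 1; 1; g] (4 / 5) 5 i1 i3 i2 i4) ];
  rewrite n12 n13 n14 n23 n24 n34 ?cosn3 ?cosn4 ?cosn6 ?c5 ?c10 in E1 E2 E3 E4;
  (split=> //; [ move: (farea V i1) (farea V i2) (farea V i3) (farea V i4) E1 E2 E3 E4;
      clear -gg => b1 b2 b3 b4 E1 E2 E3 E4;
      (* With [g * g] reduced, the equations and their multiples by [g] are linear in the areas and
         their products with [g], so [lra] can solve for the ratios. *)
      move: (congr1 ( *%R g) E1) (congr1 ( *%R g) E2) (congr1 ( *%R g) E3) (congr1 ( *%R g) E4)
        (gg b1) (gg b2) (gg b3) (gg b4); clear gg => *; split=> /=; lra
    | split; last split;
      rewrite ?n12 ?n13 ?n14 ?n23 ?n24 ?n34 ?cosn3 ?cosn4 ?cosn6 ?c5 ?c10 /=;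
      clear -g2 g3 g4 g5 g6 g_gt g_lt => e;
      (* Either the edge belongs to the class and [t] separates its faces in one of the two orders,
         or the equality [e] of lengths contradicts the bounds on [g]. *)
      first [ split; [by [] | left; apply/andP; split; lra]
        | split; [by [] | right; apply/andP; split; lra]
        | have h : 1 <= 0 :> R; [lra | by move: h; rewrite ler10] ] ]).
Qed.

(** * The five tilings *)

Section TilingByEdges.
Variables (R : realType) (V : 'I_4 -> 'rV[R]_3).
Hypothesis Vn : nondegenerate_tetrahedron V.

Definition dist2 (u v : 'rV[R]_3) : R := dotp (v - u) (v - u).

Lemma dist2C u v : dist2 u v = dist2 v u.
Proof. by rewrite /dist2 !dotpE !coordE; ring. Qed.

Definition rows3 (u v w : 'rV[R]_3) : 'M[R]_3 := \matrix_(a < 3) [:: u; v; w]`_a.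

Lemma mulmx_rows3 a b c u v w : vec3 a b c *m rows3 u v w = a *: u + b *: v + c *: w.
Proof. by rewrite mulmx_sum_row sum3E !rowK !mxE /=. Qed.

Lemma rows3_gram (u v w : 'rV[R]_3) p q :
  dotp u u = p -> dotp v v = p -> dotp w w = p -> dotp u v = q -> dotp u w = q -> dotp v w = q ->
  forall a b, dotp (row a (rows3 u v w)) (row b (rows3 u v w)) = if a == b then p else q.
Proof.
move=> h1 h2 h3 h4 h5 h6.
by apply: ord3P; apply: ord3P; rewrite !rowK //= dotpC.
Qed.

Lemma tiles_of_perm (s : 'S_4) : tiles_face_to_face (V \o s) -> tiles_face_to_face V.
Proof.
move=> /tiles_perm -/(_ (s^-1)%g); have -> // : (V \o s) \o (s^-1)%g = V.
by apply/funext => a; rewrite /= permKV.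
Qed.

Lemma frame_tiles (v : 'I_4 -> 'rV[R]_3) (s : 'S_4) o e0 e1 e2 p q :
  (forall (U : 'I_4 -> 'rV[R]_3) (B : 'M[R]_3), nondegenerate_tetrahedron U ->
     (forall a b, dotp (row a B) (row b B) = if a == b then p else q) ->
     (forall a, U a = o + v a *m B) -> tiles_face_to_face U) ->
  dotp e0 e0 = p -> dotp e1 e1 = p -> dotp e2 e2 = p ->
  dotp e0 e1 = q -> dotp e0 e2 = q -> dotp e1 e2 = q ->
  (forall a, V (s a) = o + v a *m rows3 e0 e1 e2) -> tiles_face_to_face V.
Proof.
move=> T p0 p1 p2 q01 q02 q12 VE; apply: (tiles_of_perm (s := s)).
exact: T (nondegenerate_perm s Vn) (rows3_gram p0 p1 p2 q01 q02 q12) VE.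
Qed.

(** The conditions say that the three steps of the path [i], [j], [k], [l] have equal lengths and
    equal pairwise products, so they span a rhombohedron of which the tetrahedron is a Kuhn
    simplex. *)
Lemma kuhn_tiles_edges i j k l : uniq [:: i; j; k; l] ->
  dist2 (V j) (V k) = dist2 (V i) (V j) -> dist2 (V k) (V l) = dist2 (V i) (V j) ->
  dist2 (V j) (V l) = dist2 (V i) (V k) ->
  dist2 (V i) (V l) = 3 * dist2 (V i) (V k) - 3 * dist2 (V i) (V j) -> tiles_face_to_face V.
Proof.
move=> u; have [s [s1 s2 s3 s4]] := perm_of_uniq4 u; rewrite /dist2.
have [x xE] : exists x, x = V j - V i by eexists.
have [y yE] : exists y, y = V k - V j by eexists.
have [z zE] : exists z, z = V l - V k by eexists.
have -> : V k - V i = x + y by rewrite xE yE; apply: row3P; rewrite !coordE; ring.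
have -> : V l - V j = y + z by rewrite yE zE; apply: row3P; rewrite !coordE; ring.
have -> : V l - V i = x + y + z by rewrite xE yE zE; apply: row3P; rewrite !coordE; ring.
rewrite -xE -yE -zE !dotpL (dotpC y x) (dotpC z x) (dotpC z y) => h1 h2 h3 h4.
have [q1 q2] : dotp x z = dotp x y /\ dotp y z = dotp x y by split; lra.
apply: (frame_tiles (v := @kuhn_vertex R) (s := s) (o := V i) (e0 := x) (e1 := y) (e2 := z)
  (p := dotp x x) (q := dotp x y)) => //.
  by move=> U B Un g UE; exact: (kuhn_tiles Un g UE).
apply: ord4_enum; rewrite ?s1 ?s2 ?s3 ?s4 /kuhn_vertex /simplex_vertex /= ?mul0mx ?mulmx_rows3;
  apply: row3P; rewrite ?xE ?yE ?zE !coordE; ring.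
Qed.

Let subDl (a b c : 'rV[R]_3) : a + b - (a + c) = b - c.
Proof. by rewrite opprD addrACA subrr add0r. Qed.
Let subDr (a b : 'rV[R]_3) : a + b - a = b.
Proof. by rewrite addrAC subrr add0r. Qed.

Lemma b3_tiles_edges i j k l : uniq [:: i; j; k; l] ->
  dist2 (V i) (V k) = 3 * dist2 (V i) (V j) -> dist2 (V i) (V l) = 3 * dist2 (V i) (V j) ->
  dist2 (V j) (V k) = 2 * dist2 (V i) (V j) -> dist2 (V j) (V l) = 2 * dist2 (V i) (V j) ->
  dist2 (V k) (V l) = 4 * dist2 (V i) (V j) -> tiles_face_to_face V.
Proof.
move=> u; have [s [s1 s2 s3 s4]] := perm_of_uniq4 u; rewrite /dist2.
(* The frame is read off from [b3_vertex]: the midpoint of its last two vertices is [(1, 1, 0)]. *)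
have [x xE] : exists x, x = V j - V i by eexists.
have [y yE] : exists y, y = 2^-1 *: (V k + V l) - V j by eexists.
have [z zE] : exists z, z = 2^-1 *: (V k - V l) by eexists.
have kE : V k = V i + (x + y + z).
  by rewrite xE yE zE; apply: row3P; rewrite !coordE; field.
have lE : V l = V i + (x + y - z).
  by rewrite xE yE zE; apply: row3P; rewrite !coordE; field.
have jE : V j = V i + x by rewrite xE addrC subrK.
rewrite kE lE jE !subDl !subDr !dotpL (dotpC y x) (dotpC z x) (dotpC z y) => h1 h2 h3 h4 h5.
have [q1 q2 q3 q4 q5] : [/\ dotp y y = dotp x x, dotp z z = dotp x x, dotp x y = 0,
  dotp x z = 0 & dotp y z = 0] by split; lra.
apply: (frame_tiles (v := @b3_vertex R) (s := s) (o := V i) (e0 := x) (e1 := y) (e2 := z)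
  (p := dotp x x) (q := 0)) => //.
  by move=> U B' Un g UE; exact: (b3_tiles Un g UE).
apply: ord4_enum; rewrite ?s1 ?s2 ?s3 ?s4 /b3_vertex /simplex_vertex /= ?mul0mx ?mulmx_rows3;
  apply: row3P; rewrite ?kE ?lE ?jE !coordE; ring.
Qed.

Lemma half_kuhn_tiles_edges i j k l : uniq [:: i; j; k; l] ->
  dist2 (V i) (V k) = dist2 (V i) (V j) -> dist2 (V i) (V l) = dist2 (V i) (V j) ->
  3 * dist2 (V j) (V k) = 4 * dist2 (V i) (V j) -> 3 * dist2 (V k) (V l) = 4 * dist2 (V i) (V j) ->
  3 * dist2 (V j) (V l) = 8 * dist2 (V i) (V j) -> tiles_face_to_face V.
Proof.
move=> u; have [s [s1 s2 s3 s4]] := perm_of_uniq4 u; rewrite /dist2.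
(* In [half_vertex] the edge [jl] is a diagonal of the face of the cube, so its midpoint is the
   centre of that face. *)
have [x xE] : exists x, x = 2^-1 *: (V j + V l) - V i by eexists.
have [y yE] : exists y, y = 2^-1 *: (V k - V l) by eexists.
have [z zE] : exists z, z = 2^-1 *: (V j - V k) by eexists.
have jE : V j = V i + (x + y + z).
  by rewrite xE yE zE; apply: row3P; rewrite !coordE; field.
have kE : V k = V i + (x + y - z).
  by rewrite xE yE zE; apply: row3P; rewrite !coordE; field.
have lE : V l = V i + (x - y - z).
  by rewrite xE yE zE; apply: row3P; rewrite !coordE; field.
rewrite kE lE jE !subDl !subDr !dotpL (dotpC y x) (dotpC z x) (dotpC z y) => h1 h2 h3 h4 h5.
have [q1 q2 q3 q4 q5] : [/\ dotp y y = dotp x x, dotp z z = dotp x x, dotp x y = 0,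
  dotp x z = 0 & dotp y z = 0] by split; lra.
apply: (frame_tiles (v := @half_vertex R) (s := s) (o := V i) (e0 := x) (e1 := y) (e2 := z)
  (p := dotp x x) (q := 0)) => //.
  by move=> U B' Un g UE; exact: (half_kuhn_tiles Un g UE).
apply: ord4_enum; rewrite ?s1 ?s2 ?s3 ?s4 /half_vertex /simplex_vertex /= ?mul0mx ?mulmx_rows3;
  apply: row3P; rewrite ?kE ?lE ?jE !coordE; ring.
Qed.

End TilingByEdges.

Section TilingTypes.
Variables (R : realType) (V : 'I_4 -> 'rV[R]_3) (n : 'I_4 -> 'I_4 -> nat).
Hypothesis tV : tetra_angles V n.
Notation cosn := (@cosn R).

Lemma dist2_farea (x : 'I_4 -> R) (a : R) : (forall b, farea V b = a * x b) ->
  exists S, forall i j k l, uniq [:: i; j; k; l] ->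
    dist2 (V i) (V j) = S * (x k ^+ 2 * x l ^+ 2 * (1 - cosn (n i j) ^+ 2)).
Proof.
move=> xE; have Vn := tetra_nondegenerate tV; exists (a ^+ 4 / vol V ^+ 2) => i j k l u.
have v0 : vol V ^+ 2 != 0 by rewrite sqrf_eq0 vol_neq0.
apply: (mulIf v0); rewrite /dist2 (edge_sqr_cosn Vn (tetra_angleE tV) u) !xE.
by move: v0; set v := vol V ^+ 2; move: v (cosn _) => v c v0; field.
Qed.

Lemma sqrt_half_powers (h : R) : h ^+ 2 = 2^-1 ->
  [/\ h ^+ 3 = h / 2, h ^+ 4 = 4^-1 & (forall b, h * (h * b) = 2^-1 * b)].
Proof.
move=> h2; split; first by rewrite exprS h2.
- by rewrite (exprM _ 2 2) h2; field.
- by move=> b; rewrite mulrA -expr2 h2.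
Qed.

Definition tiling_types : seq (seq nat) :=
  [:: [:: 3; 6; 6; 8; 8; 4];
      [:: 4; 4; 4; 6; 6; 8];
      [:: 4; 4; 8; 8; 4; 6];
      [:: 4; 5; 6; 10; 5; 4];
      [:: 4; 6; 6; 6; 6; 4]]%N.

Lemma tiling_types_tile : sextuple n \in tiling_types -> tiles_face_to_face V.
Proof.
have Vn := tetra_nondegenerate tV.
have [c [c2 c8]] : exists c, c ^+ 2 = 2^-1 /\ cosn 8 = c by exists (cosn 8); rewrite cosn8.
have [c3 c4 cc] := sqrt_half_powers c2.
have [g [g2 _ c5 c10]] := golden_cosn R; have [g3 g4 _ _ gg] := golden_powers g2.
have [_ _ _ _ E1 E2 E3 E4 _ _ _ _] := area_system Vn (tetra_angleE tV).
have CE := (dist2C (V i2) (V i1), dist2C (V i3) (V i1), dist2C (V i4) (V i1),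
  dist2C (V i3) (V i2), dist2C (V i4) (V i2), dist2C (V i4) (V i3)).
have lengths (x : seq R) a : [/\ farea V i1 = a * x`_0, farea V i2 = a * x`_1,
    farea V i3 = a * x`_2 & farea V i4 = a * x`_3] ->
    exists S, forall i j k l : 'I_4, uniq [:: i; j; k; l] ->
    dist2 (V i) (V j) = S * (x`_k ^+ 2 * x`_l ^+ 2 * (1 - cosn (n i j) ^+ 2)).
  by move=> [A1 A2 A3 A4]; apply: (@dist2_farea (fun b => x`_b) a); exact: ord4_enum.
(* Area ratios of the five types, with [c ^ 2 = 1 / 2] and [g] golden. The reference face must have
   entry 1; in the first type [i1] has entry [2 * c], so [i2] is used. *)
move=> sx; have {lengths} [|S SE] := lengths
    (nth [::] [:: [:: 2 * c; 1; 1; 1]; [:: 1; c; 2^-1; 2^-1]; [:: 1; 1; c; c];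
      [:: 1; g; g; 1]; [:: 1; 1; 1; 1]] (index (sextuple n) tiling_types))
    (farea V (if sextuple n == [:: 3; 6; 6; 8; 8; 4]%N then i2 else i1)).
  move: sx; rewrite !inE => /or4P[|||/orP[]] /eqP sx; rewrite sx /=; case: sx => n12 n13 n14 n23 n24 n34;
  rewrite n12 n13 n14 n23 n24 n34 ?cosn3 ?cosn4 ?cosn6 ?c5 ?c8 ?c10 in E1 E2 E3 E4;
  move: (farea V i1) (farea V i2) (farea V i3) (farea V i4) E1 E2 E3 E4 => b1 b2 b3 b4 E1 E2 E3 E4;
  move: (cc b1) (cc b2) (cc b3) (cc b4) (congr1 ( *%R c) E1) (congr1 ( *%R c) E2)
    (congr1 ( *%R c) E3) (congr1 ( *%R c) E4);
  move: (gg b1) (gg b2) (gg b3) (gg b4) (congr1 ( *%R g) E1) (congr1 ( *%R g) E2)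
    (congr1 ( *%R g) E3) (congr1 ( *%R g) E4);
  move: E1 E2 E3 E4; clear => *; split; lra.
have DE := (SE i1 i2 i3 i4 isT, SE i1 i3 i2 i4 isT, SE i1 i4 i2 i3 isT,
  SE i2 i3 i1 i4 isT, SE i2 i4 i1 i3 isT, SE i3 i4 i1 i2 isT); clear SE.
have [[S2 S3] S4] := (congr1 ( *%R S) c2, congr1 ( *%R S) c3, congr1 ( *%R S) c4).
have [[T2 T3] T4] := (congr1 ( *%R S) g2, congr1 ( *%R S) g3, congr1 ( *%R S) g4).
(* The three Kuhn cases belong to the cube, to a rhombohedron with golden ratios, and to the
   primitive cell of the body-centred cubic lattice. *)
move: sx; rewrite !inE => /or4P[|||/orP[]] /eqP sx;
  [ apply: (half_kuhn_tiles_edges Vn (_ : uniq [:: i1; i3; i2; i4]))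
  | apply: (b3_tiles_edges Vn (_ : uniq [:: i2; i1; i3; i4]))
  | apply: (kuhn_tiles_edges Vn (_ : uniq [:: i4; i1; i2; i3]))
  | apply: (kuhn_tiles_edges Vn (_ : uniq [:: i1; i3; i2; i4]))
  | apply: (kuhn_tiles_edges Vn (_ : uniq [:: i1; i3; i2; i4])) ] => //;
  rewrite ?CE !DE sx; case: sx => n12 n13 n14 n23 n24 n34;
  rewrite ?n12 ?n13 ?n14 ?n23 ?n24 ?n34 ?cosn3 ?cosn4 ?cosn6 ?c5 ?c8 ?c10 /=;
  move: S2 S3 S4 T2 T3 T4; clear; lra.
Qed.

End TilingTypes.

Lemma accepted_canonical (n : 'I_4 -> 'I_4 -> nat) : (forall i j, i != j -> n i j = n j i) ->
  sextuple n \in accepted ->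
  exists s : 'S_4, sextuple (fun i j => n (s i) (s j)) \in tiling_types ++ golden_types.
Proof.
move=> S.
have P i j k l : uniq [:: i; j; k; l] ->
    [:: n i j; n i k; n i l; n j k; n j l; n k l] \in tiling_types ++ golden_types ->
    exists s : 'S_4, sextuple (fun i j => n (s i) (s j)) \in tiling_types ++ golden_types.
  by move=> /perm_of_uniq4[s [<- <- <- <-]]; exists s.
have SE := (S i2 i1 isT, S i3 i1 isT, S i4 i1 isT, S i3 i2 isT, S i4 i2 isT, S i4 i3 isT).
rewrite /accepted /sextuple; do 20?
  (rewrite in_cons => /predU1P[[n12 n13 n14 n23 n24 n34]|];
  first (first [(apply: (P i1 i2 i3 i4) => //; by rewrite n12 n13 n14 n23 n24 n34)
    | (apply: (P i1 i3 i2 i4) => //; by rewrite !SE n12 n13 n14 n23 n24 n34)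
    | (apply: (P i1 i2 i4 i3) => //; by rewrite !SE n12 n13 n14 n23 n24 n34)
    | (apply: (P i1 i3 i4 i2) => //; by rewrite !SE n12 n13 n14 n23 n24 n34)
    | (apply: (P i1 i4 i2 i3) => //; by rewrite !SE n12 n13 n14 n23 n24 n34)
    | (apply: (P i1 i4 i3 i2) => //; by rewrite !SE n12 n13 n14 n23 n24 n34)
    | (apply: (P i2 i1 i4 i3) => //; by rewrite !SE n12 n13 n14 n23 n24 n34)])).
by [].
Qed.

Theorem theorem5p6 (R : realType) (V : 'I_4 -> 'rV[R]_3)
  (n : 'I_4 -> 'I_4 -> nat)
  (V_nondeg : nondegenerate_tetrahedron V)
  (n_gt0 : forall i j : 'I_4, i != j -> (0 < n i j)%N)
  (angleV : forall i j k l : 'I_4, uniq [:: i; j; k; l] ->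
     dihedral_angle (V i) (V j) (V k) (V l) = 2 * pi / (n i j)%:R) :
  tiles_face_to_face V <->
  exists s : 'S_4,
    sextuple (fun i j => n (s i) (s j)) \in
      [:: [:: 3; 6; 6; 8; 8; 4];
          [:: 4; 4; 4; 6; 6; 8];
          [:: 4; 4; 8; 8; 4; 6];
          [:: 4; 5; 6; 10; 5; 4];
          [:: 4; 6; 6; 6; 6; 4]]%N.
Proof.
have tV : tetra_angles V n by split.
rewrite -/tiling_types; split=> [tiles|[s sn]].
  have [s sn] := classification tV.
  have [t tn] := accepted_canonical (n_symm (tetra_angles_perm s tV)) sn.
  have E : (fun i j => n (s (t i)) (s (t j))) = (fun i j => n ((t * s)%g i) ((t * s)%g j)).
    by apply/funext => i; apply/funext => j; rewrite !permM.
  rewrite E mem_cat in tn; exists (t * s)%g; case/orP: tn => // tn; exfalso.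
  have tW := tetra_angles_perm (t * s)%g tV; exact: (golden_not_tiling tW tn) (tiles_perm (t * s)%g tiles).
apply: (tiles_of_perm (s := s)); exact: tiling_types_tile (tetra_angles_perm s tV) sn.
Qed.
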